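(* Let $A_\Gamma$ be an irreducible finite-type Artin group and let $\{A_{X_i}\}$ be a collection of standard parabolic subgroups ($X_i\subseteq V(\Gamma)$) which is the vertex set of a maximal simplex of $C_{parab}(A_\Gamma)$. If $g\in A_\Gamma$ stabilizes $\{A_{X_i}\}$ (i.e. conjugation by $g$ maps the set $\{A_{X_i}\}$ to itself), then $g$ can be written as an ascending product of powers of the $\Delta_{X_i}$ and $\Delta_\Gamma$.
   Context: A finite-type Artin group $A_\Gamma$ has a finite generating set $V(\Gamma)$ (the Artin generators) and, for each pair of distinct generators $s,t$, one relation $sts\cdots = tst\cdots$ with $m_{st}=m_{ts}\ge 2$ letters on each side, such that the associated Coxeter group (obtained by adding $s^2=1$ for all generators $s$) is finite. The defining graph $\Gamma$ has vertex set $V(\Gamma)$, with $s,t$ adjacent iff $m_{st}\ge 3$. $A_\Gamma$ is irreducible if $\Gamma$ is connected. For $X\subseteq V(\Gamma)$, $A_X=\langle X\rangle$ is a standard parabolic subgroup; a parabolic subgroup is any conjugate $gA_Xg^{-1}$, $g\in A_\Gamma$; it is irreducible if the induced subgraph of $\Gamma$ on $X$ is (nonempty and) connected. $\Delta_X$ is the least common multiple of the elements of $X$ in the positive monoid generated by $V(\Gamma)$, and $\Delta_\Gamma=\Delta_{V(\Gamma)}$. $\Delta_X^2$ is always central in $A_X$; $z_X$ denotes $\Delta_X$ if it is central in $A_X$ and $\Delta_X^2$ otherwise. For $P=gA_Xg^{-1}$, $z_P=gz_Xg^{-1}$ (well-defined). $C_{parab}(A_\Gamma)$ is the simplicial complex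 whose vertices are the irreducible proper parabolic subgroups of $A_\Gamma$, where vertices $P_1,\dots,P_n$ span a simplex iff the $z_{P_i}$ pairwise commute. For a simplex with vertex set $\{A_{X_i}\}$, an ascending product of powers of $\Delta_{X_i}$ and $\Delta_\Gamma$ is a product of the form $\Delta_{X_{i_1}}^{n_1}\cdots\Delta_{X_{i_m}}^{n_m}\Delta_\Gamma^{n_{m+1}}$ with exactly one term for each vertex $A_{X_i}$ of the simplex, with arbitrary integer (possibly zero) exponents, with the power of $\Delta_\Gamma$ at the right end, and such that $X_i\subseteq X_q$ implies that the $\Delta_{X_i}$ term is to the left of the $\Delta_{X_q}$ term. *)

(* Defs.v *)
From HB Require Import structures.
From mathcomp Require Import all_boot all_order ssralg ssrint.
From mathcomp Require Import boolp classical_sets cardinality.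

Set Implicit Arguments.
Unset Strict Implicit.
Unset Printing Implicit Defensive.

Local Open Scope classical_set_scope.
Local Open Scope quotient_scope.
Local Open Scope group_scope.

(* A letter [(s, true)] stands for [s] and [(s, false)] for its inverse. *)
Definition word (V : finType) := seq (V * bool).

Definition inv_letter (V : finType) (x : V * bool) : V * bool := (x.1, ~~ x.2).

Inductive pres_eq (V : finType) (R : word V -> word V -> Prop) :
    word V -> word V -> Prop :=
| pres_rel l u v r : R u v -> pres_eq R (l ++ u ++ r) (l ++ v ++ r)
| pres_cancel l x r : pres_eq R (l ++ [:: x; inv_letter x] ++ r) (l ++ r)
| pres_refl u : pres_eq R u u
| pres_sym u v : pres_eq R u v -> pres_eq R v u
| pres_trans u v w : pres_eq R u v -> pres_eq R v w -> pres_eq R u w.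

Section Presentation.
Variables (V : finType) (R : word V -> word V -> Prop).
Implicit Types u v : word V.

Definition pres_eqb : rel (word V) := fun u v => `[< pres_eq R u v >].

Fact pres_eqb_refl : reflexive pres_eqb.
Proof. by move=> u; apply/asboolP/pres_refl. Qed.

Fact pres_eqb_sym : symmetric pres_eqb.
Proof. by move=> u v; apply/asboolP/asboolP; apply: pres_sym. Qed.

Fact pres_eqb_trans : transitive pres_eqb.
Proof.
move=> v u w /asboolP uv /asboolP vw.
by apply/asboolP; apply: pres_trans uv vw.
Qed.

Canonical pres_equiv :=
  EquivRel pres_eqb pres_eqb_refl pres_eqb_sym pres_eqb_trans.

Definition pres_group := {eq_quot pres_equiv}.
HB.instance Definition _ := Choice.on pres_group.
HB.instance Definition _ := Quotient.on pres_group.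

Definition pres_class u : pres_group := \pi_pres_group u.

Lemma pres_classP u v : pres_class u = pres_class v <-> pres_eq R u v.
Proof.
split=> [/eqmodP/asboolP //|uv]; by apply/eqmodP; apply/asboolP.
Qed.

Definition inv_word u : word V := rev (map (@inv_letter V) u).

Definition pres_one : pres_group := pres_class [::].
Definition pres_mul (x y : pres_group) := pres_class (repr x ++ repr y).
Definition pres_inv (x : pres_group) := pres_class (inv_word (repr x)).

Lemma inv_letterK : involutive (@inv_letter V).
Proof. by case=> s b; rewrite /inv_letter /= negbK. Qed.

Lemma inv_wordK : involutive inv_word.
Proof.
by move=> u; rewrite /inv_word map_rev revK -map_comp map_id_in // => x _;
   apply: inv_letterK.
Qed.

Lemma pres_eq_cat l r u v : pres_eq R u v -> pres_eq R (l ++ u ++ r) (l ++ v ++ r).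
Proof.
elim=> {u v} [l' u v r' uv|l' x r'|u|u v _ IH|u v w _ IH1 _ IH2].
- have := pres_rel (l ++ l') (r' ++ r) uv.
  by rewrite -!catA.
- have := pres_cancel R (l ++ l') x (r' ++ r).
  by rewrite -!catA.
- exact: pres_refl.
- exact: pres_sym.
- exact: pres_trans IH1 IH2.
Qed.

Lemma pres_eq_cat2 u u' v v' :
  pres_eq R u u' -> pres_eq R v v' -> pres_eq R (u ++ v) (u' ++ v').
Proof.
move=> uu' vv'; apply: (@pres_trans _ _ _ (u' ++ v)).
  exact: (pres_eq_cat [::] v uu').
by have := pres_eq_cat u' [::] vv'; rewrite !cats0.
Qed.

Lemma pres_repr u : pres_eq R (repr (pres_class u)) u.
Proof. by apply/pres_classP; rewrite /pres_class reprK. Qed.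

Lemma pres_class_repr (x : pres_group) : pres_class (repr x) = x.
Proof. exact: reprK. Qed.

Lemma pres_eq_mulV u : pres_eq R (u ++ inv_word u) [::].
Proof.
elim: u => [|x u IH]; first exact: pres_refl.
rewrite /inv_word /= rev_cons -cats1 -/(inv_word u).
apply: pres_trans (pres_cancel R [::] x [::]).
have := pres_eq_cat [:: x] [:: inv_letter x] IH.
by rewrite /= catA.
Qed.

Lemma pres_mulA : associative pres_mul.
Proof.
move=> x y z; apply/pres_classP.
apply: (@pres_trans _ _ _ (repr x ++ repr y ++ repr z)).
  by apply: pres_eq_cat2 (pres_refl _ _) (pres_repr _).
rewrite catA; apply: pres_sym.
by apply: pres_eq_cat2 (pres_repr _) (pres_refl _ _).
Qed.

Lemma pres_mul1 : left_id pres_one pres_mul.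
Proof.
move=> x; rewrite -[RHS]pres_class_repr; apply/pres_classP.
exact: (pres_eq_cat2 (pres_repr [::]) (pres_refl R (repr x))).
Qed.

Lemma pres_mulr1 : right_id pres_one pres_mul.
Proof.
move=> x; rewrite -[RHS]pres_class_repr; apply/pres_classP.
by have := pres_eq_cat2 (pres_refl R (repr x)) (pres_repr [::]); rewrite cats0.
Qed.

Lemma pres_mulrV : right_inverse pres_one pres_inv pres_mul.
Proof.
move=> x; apply/pres_classP; apply: pres_trans (pres_eq_mulV (repr x)).
by apply: pres_eq_cat2 (pres_refl _ _) (pres_repr _).
Qed.

Lemma pres_mulVr : left_inverse pres_one pres_inv pres_mul.
Proof.
move=> x; apply/pres_classP.
apply: pres_trans (pres_eq_cat2 (pres_repr _) (pres_refl R (repr x))) _.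
by have := pres_eq_mulV (inv_word (repr x)); rewrite inv_wordK.
Qed.

HB.instance Definition _ := isMonoid.Build pres_group
  pres_mulA pres_mul1 pres_mulr1.
HB.instance Definition _ := hasInv.Build pres_group pres_inv.
HB.instance Definition _ := Monoid_isGroup.Build pres_group pres_mulVr pres_mulrV.

Definition pres_gen (s : V) : pres_group := pres_class [:: (s, true)].

End Presentation.

Definition zexpg (G : groupType) (x : G) (n : int) : G :=
  match n with Posz k => x ^+ k | Negz k => x ^- k.+1 end.

Definition subgroup_set (G : groupType) (H : set G) : Prop :=
  [/\ H 1, forall x y, H x -> H y -> H (x * y) & forall x, H x -> H x^-1].

Definition submonoid_set (G : groupType) (H : set G) : Prop :=
  H 1 /\ forall x y, H x -> H y -> H (x * y).

Definition conj_set (G : groupType) (g : G) (H : set G) : set G :=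
  [set g * x * g^-1 | x in H].

(* Every label is a (finite) natural number, so there is exactly one braid
   relation for each pair of distinct generators. *)
Record coxeter_matrix (V : finType) := CoxeterMatrix {
  cox_label :> V -> V -> nat;
  cox_diag : forall s, cox_label s s = 1%N;
  cox_sym : forall s t, cox_label s t = cox_label t s;
  cox_ge2 : forall s t, s != t -> (2 <= cox_label s t)%N
}.

(* The word [s t s ...] with [n] letters. *)
Fixpoint alt_word (V : finType) (s t : V) (n : nat) : word V :=
  if n is k.+1 then (s, true) :: alt_word t s k else [::].

Section Artin.
Variables (V : finType) (M : coxeter_matrix V).

Definition braid_rel (u v : word V) : Prop :=
  exists s t, [/\ s != t, u = alt_word s t (M s t) & v = alt_word t s (M s t)].

Definition coxeter_rel (u v : word V) : Prop :=
  braid_rel u v \/ exists s, u = [:: (s, true); (s, true)] /\ v = [::].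

Definition artin := pres_group braid_rel.
HB.instance Definition _ := Group.on artin.

Definition coxeter := pres_group coxeter_rel.
HB.instance Definition _ := Group.on coxeter.

Definition finite_type : Prop := finite_set [set: coxeter].

Definition sigma (s : V) : artin := pres_gen braid_rel s.

Implicit Types (X Y : {set V}) (P Q : set artin) (S : set (set artin)).

Definition adjacent : rel V := [rel s t | (s != t) && (3 <= M s t)%N].

Definition connected_on X : Prop :=
  X != finset.set0 /\
  {in X &, forall s t,
    connect [rel a b | [&& a \in X, b \in X & adjacent a b]] s t}.

Definition irreducible_type : Prop := connected_on (finset.setTfor V).

Definition std_parabolic X : set artin :=
  smallest (@subgroup_set artin) [set sigma s | s in [set` X]].

Definition positive_monoid : set artin :=
  smallest (@submonoid_set artin) (range sigma).

Definition pos_dvd (a b : artin) : Prop := positive_monoid (a^-1 * b).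

(* Least common multiple for left divisibility in the positive monoid; it is
   unique, since the only unit of that monoid is [1]. In finite type the least
   common multiple of generators for right divisibility is the same element. *)
Definition is_lcm X (d : artin) : Prop :=
  [/\ positive_monoid d,
      forall s, s \in X -> pos_dvd (sigma s) d &
      forall e, positive_monoid e ->
        (forall s, s \in X -> pos_dvd (sigma s) e) -> pos_dvd d e].

(* [xget 1] picks an element of a set, and is [1] on the empty set; in finite
   type these least common multiples always exist. *)
Definition Delta X : artin := xget 1 [set d | is_lcm X d].

Definition zX X : artin :=
  if `[< forall a, std_parabolic X a -> commute a (Delta X) >]
  then Delta X else Delta X ^+ 2.

(* The element chosen by [xget] is independent of the presentation
   [P = g A_X g^-1] for the parabolic subgroups of a finite-type group. *)
Definition zP P : artin :=
  xget 1 [set z | exists g X,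
    P = conj_set g (std_parabolic X) /\ z = g * zX X * g^-1].

Definition irreducible_parabolic P : Prop :=
  exists g X, connected_on X /\ P = conj_set g (std_parabolic X).

Definition Cparab_vertex P : Prop :=
  irreducible_parabolic P /\ P <> [set: artin].

(* The empty set of vertices is allowed: it is maximal only when the complex
   has no vertices, that is, when there is a single generator. *)
Definition Cparab_simplex S : Prop :=
  [/\ finite_set S,
      forall P, S P -> Cparab_vertex P &
      forall P Q, S P -> S Q -> commute (zP P) (zP Q)].

Definition Cparab_maximal_simplex S : Prop :=
  Cparab_simplex S /\ forall S', Cparab_simplex S' -> S `<=` S' -> S' = S.

(* The terms are listed from left to right by [s], which enumerates the family
   without repetition; [n X] is the exponent of [Delta X]. *)
Definition ascending_product (F : {set {set V}}) (g : artin) : Prop :=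
  exists (s : seq {set V}) (n : {set V} -> int) (k : int),
    [/\ uniq s, s =i F,
        {in s &, forall X Y, X \subset Y -> (index X s <= index Y s)%N} &
        g = (\prod_(X <- s) zexpg (Delta X) (n X))
            * zexpg (Delta (finset.setTfor V)) k].

End Artin.

Arguments std_parabolic {V} M X.
Arguments Delta {V} M X.
Arguments zX {V} M X.
Arguments sigma {V} M s.
Arguments ascending_product {V M} F g.

(* Main.v *)
(* The positive monoid embeds in the Artin group and has Garside's lcm property:
   a positive word has a greatest simple left divisor, its head, which lives in
   the finite Coxeter group and is computed by a left action of words on pairs
   (head, tail); the inverse of a letter exists because the square of the longest
   element is central.

   Let [X] be connected and [Z = X - v].  If [a] in A_X conjugates A_Y to A_Z,
   write a positive multiple of [a] as [b c] with [b] in A_Z and no generator of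
   [Z] dividing [c].  Then [c] conjugates generators to generators, Delta_X divides
   Delta_Z c, and by induction [c] is a product of ribbons Delta_Z^-1 Delta_X;
   hence [a] is in A_Z Delta_X^n.

   The z_X commute exactly when the [X] are pairwise nested or orthogonal, so a
   maximal simplex of standard parabolics is a maximal nested family, whose
   members other than [X] have union [X - v].  An element carrying one such
   family to another is therefore [b Delta_X^n] with [b] in A_(X - v), and [b]
   splits along the connected components of [X - v]; induct on [X]. *)

Require Import Defs.
From mathcomp Require Import all_boot all_order ssralg ssrint.
From mathcomp Require Import boolp classical_sets cardinality.
From mathcomp Require Import poly ssrnum algC cyclotomic.
From mathcomp Require Import zify ring.

Set Implicit Arguments.
Unset Strict Implicit.
Unset Printing Implicit Defensive.

(** Relations only bound orders and lengths from above. That [s t] has order exactly [M s t] needs a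
    model: the reflection representation, taken over the algebraic numbers, where [2 cos (pi / m)]
    is a sum of two roots of unity. Other lower bounds come from letting words act on sets: on
    signed group elements for the length, on (head, tail) pairs for the monoid.

    Two features shape the recursion. The power of Delta_X that is split off permutes the letters of
    X, so what remains of a stabilizer need not stabilize the family; the induction therefore
    compares two families. And X - v may be disconnected, so nested families are defined for
    arbitrary X, and only a connected X contributes a factor.

    The element [zP] is picked by choice among all presentations of a parabolic. What is established
    of the pick is that its square is a positive power of the central element Delta_X^2; commutation
    of two elements passes to their squares. *)

Section AlternatingIterates.
Variables (T : Type).
Implicit Types f g : T -> T.

Fixpoint alt_iter f g n x : T := if n is k.+1 then f (alt_iter g f k x) else x.

(** For involutions, [f g f ...] times the inverse of [g f g ...], both with [n] factors, is an
    alternating product of [2 n] factors, that is [(f g)^n]. So a braid relation and [(f g)^n = 1]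
    are interchangeable. *)
Lemma alt_iter_swap f g n x : involutive f -> involutive g ->
  alt_iter f g n x = iter n (f \o g) (alt_iter g f n x).
Proof.
move=> fK gK; elim: n f g fK gK => //= n IH f g fK gK.
rewrite (IH g f) //; elim: n (alt_iter f g n x) {IH} => [|n IH] y /=.
  by rewrite gK.
by rewrite IH.
Qed.

Lemma alt_iter_comm f g n x : involutive f -> involutive g ->
  iter n (f \o g) =1 id -> alt_iter f g n x = alt_iter g f n x.
Proof. by move=> fK gK fg1; rewrite alt_iter_swap. Qed.

End AlternatingIterates.

Section CoxeterFold.
Variables (V : finType) (M : coxeter_matrix V).
Implicit Types (u v : seq V) (s t : V).

Fixpoint alt_seq s t n : seq V := if n is k.+1 then s :: alt_seq t s k else [::].

Lemma size_alt_seq s t n : size (alt_seq s t n) = n.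
Proof. by elim: n s t => //= n IH s t; rewrite IH. Qed.

Lemma foldr_alt_seq T (a : V -> T -> T) s t n x :
  foldr a x (alt_seq s t n) = alt_iter (a s) (a t) n x.
Proof. by elim: n s t => //= n IH s t; rewrite IH. Qed.

Definition pos_word u : word V := [seq (s, true) | s <- u].

Lemma pos_word_alt s t n : pos_word (alt_seq s t n) = alt_word s t n.
Proof. by elim: n s t => //= n IH s t; rewrite -IH. Qed.

(** Universal property of the Coxeter group, in the form of an action. The sign of a letter may be
    dropped because each generator acts as its own inverse. *)
Lemma coxeter_fold T (a : V -> T -> T) :
  (forall s, involutive (a s)) ->
  (forall s t, s != t -> iter (M s t) (a s \o a t) =1 id) ->
  forall u v : word V, pres_eq (coxeter_rel M) u v ->
  forall x, foldr (fun l => a l.1) x u = foldr (fun l => a l.1) x v.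
Proof.
move=> aK abK u v; elim=> {u v} [l u v r uv|l y r|u|u v _ IH|u v w _ IH1 _ IH2] x //.
- rewrite !foldr_cat; congr foldr; move: (foldr _ x r) => {r} y.
  case: uv => [[s [t [st -> ->]]]|[s [-> ->]]] /=; last by rewrite aK.
  have E p q n : foldr (fun l : V * bool => a l.1) y (alt_word p q n) =
                 alt_iter (a p) (a q) n y.
    by elim: n p q => //= n IH p q; rewrite IH.
  by rewrite !E; apply: alt_iter_comm => //; apply: abK.
- by rewrite !foldr_cat /= aK.
- by rewrite IH1 IH2.
Qed.

End CoxeterFold.

(** * The reflection representation and the order of a product of two generators *)

Section Representation.
Variables (V : finType) (M : coxeter_matrix V).
Import GRing.Theory Num.Theory.
Local Open Scope ring_scope.
Implicit Types (s t r : V) (x : V -> algC).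

Lemma cox_gt0 s t : (0 < M s t)%N.
Proof.
by case: (eqVneq s t) => [->|/(cox_ge2 M)]; [rewrite cox_diag | case: (M s t)].
Qed.

(** The order is written as the successor of [(2 * M s t).-1] so that it is visibly positive; as
    labels are positive, it is [2 * M s t]. *)
Definition half_root s t : algC := sval (C_prim_root_exists (ltn0Sn (2 * M s t).-1)).

Lemma half_rootP s t : (2 * M s t).-primitive_root (half_root s t).
Proof.
rewrite /half_root; case: C_prim_root_exists => z /=.
by rewrite prednK // muln_gt0 cox_gt0.
Qed.

Lemma half_root_sym s t : half_root s t = half_root t s.
Proof. by rewrite /half_root cox_sym. Qed.

Lemma half_root_neq0 s t : half_root s t != 0.
Proof.
have /prim_expr_order/(congr1 (fun y => y == 0)) := half_rootP s t.
rewrite oner_eq0 expf_eq0 muln_gt0 cox_gt0 /=.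
by move=> ->.
Qed.

(* [refl_act s x] is the contragredient action of the simple reflection [s]
   on the values [x t] of a linear form at the simple roots: the Cartan entry
   is [- (xi + xi^-1) = - 2 cos (pi / M s t)] with [xi] a primitive root of
   unity of order [2 * M s t]; on the diagonal, [xi = -1] gives [2]. *)
Definition refl_act s x : V -> algC :=
  fun t => x t + (half_root s t + (half_root s t)^-1) * x s.

Lemma half_root_diag s : half_root s s = -1.
Proof.
have := half_rootP s s; rewrite cox_diag muln1 => h.
have h2 := prim_expr_order h.
have : (half_root s s - 1) * (half_root s s + 1) = 0 by rewrite -subr_sqr h2 expr1n subrr.
move/eqP; rewrite mulf_eq0 => /orP[|]; last by rewrite addr_eq0 => /eqP.
rewrite subr_eq0 => /eqP h1.
have := prim_order_dvd h 1; by rewrite h1 expr1n eqxx.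
Qed.

Lemma refl_actK s : involutive (refl_act s).
Proof.
move=> x; apply/funext => t; rewrite /refl_act half_root_diag invrN1; ring.
Qed.

(* On the form [x s + xi x t] the rotation acts by [xi ^ 2]; the same holds
   with [xi] replaced by its inverse. *)
Lemma rotation_eigen s t (z := half_root s t) (x : V -> algC) :
  let y := refl_act s (refl_act t x) in
  (y s + z * y t = z ^+ 2 * (x s + z * x t)) /\
  (y s + z^-1 * y t = z^-1 ^+ 2 * (x s + z^-1 * x t)).
Proof.
move=> y; rewrite /y /refl_act !half_root_diag (half_root_sym t s) -/z invrN1.
have z0 : z != 0 := half_root_neq0 s t.
by split; field.
Qed.

Lemma half_root_sq_neq1 s t : s != t -> half_root s t ^+ 2 != 1.
Proof.
move=> /(cox_ge2 M) m2; rewrite -(prim_order_dvd (half_rootP s t)).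
by apply/negP => /dvdn_leq; lia.
Qed.

Lemma rotation_iter_eigen s t n (z := half_root s t) (x : V -> algC) :
  let y := iter n (refl_act s \o refl_act t) x in
  (y s + z * y t = z ^+ (2 * n) * (x s + z * x t)) /\
  (y s + z^-1 * y t = z^-1 ^+ (2 * n) * (x s + z^-1 * x t)).
Proof.
elim: n => [|n [IH1 IH2]] /=; first by rewrite muln0 !expr0 !mul1r.
have [-> ->] := rotation_eigen s t (iter n (refl_act s \o refl_act t) x).
by rewrite -/z IH1 IH2 !mulrA -!exprD mulnS.
Qed.

(* [x r + c * (x s + z x t) + c' * (x s + z^-1 x t)] is fixed by the rotation
   for suitable [c], [c'], because neither eigenvalue is 1. *)
Lemma rotation_invariant s t r (z := half_root s t) : s != t ->
  exists c c', forall x : V -> algC,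
  let f x := x r + c * (x s + z * x t) + c' * (x s + z^-1 * x t) in
  f (refl_act s (refl_act t x)) = f x.
Proof.
move=> st; have z0 : z != 0 := half_root_neq0 s t.
have z1 : z ^+ 2 - 1 != 0 by rewrite subr_eq0 half_root_sq_neq1.
pose p := half_root t r + (half_root t r)^-1.
pose q := half_root s r + (half_root s r)^-1.
pose b := (p + q * z) * z / (z ^+ 2 - 1).
exists (- b / (z ^+ 2 - 1)), ((q - b) * z ^+ 2 / (z ^+ 2 - 1)) => x f.
rewrite /f; have [-> ->] := rotation_eigen s t x; rewrite -/z.
rewrite /refl_act (half_root_sym t s) -/z -/p -/q /b.
by field; rewrite z0 -[_ - 1]/(_ - 1) -?expr2 z1.
Qed.

(** On the two eigenforms the rotation has eigenvalues [z ^ 2] and [z ^ -2], whose [M s t]-th powers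
    are 1. The value at any [r] then returns as well, since it differs from an invariant form by a
    combination of the eigenforms. *)
Lemma rotation_order s t : s != t ->
  iter (M s t) (refl_act s \o refl_act t) =1 id.
Proof.
move=> st x; set z := half_root s t.
have z0 : z != 0 := half_root_neq0 s t.
have z1 : z ^+ 2 - 1 != 0 by rewrite subr_eq0 half_root_sq_neq1.
have [] := rotation_iter_eigen s t (M s t) x.
set y := iter _ _ _ => /=.
rewrite -/z exprVn (prim_expr_order (half_rootP s t)) invr1 !mul1r => e1 e2.
apply/funext => r; have [c [c' inv]] := rotation_invariant r st.
have : y r + c * (y s + z * y t) + c' * (y s + z^-1 * y t)
     = x r + c * (x s + z * x t) + c' * (x s + z^-1 * x t).
  rewrite /y; elim: (M s t) => //= n <-; exact: inv.
by rewrite e1 e2 => /addIr/addIr.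
Qed.


End Representation.

Section PresentedGroup.
Variables (V : finType) (R : word V -> word V -> Prop).
Local Open Scope group_scope.

Lemma pres_class_cat (u v : word V) :
  pres_class R (u ++ v) = pres_class R u * pres_class R v.
Proof. by apply/pres_classP/pres_sym; apply: pres_eq_cat2; apply: pres_repr. Qed.

Lemma pres_class_letterV s :
  pres_class R [:: (s, false)] = (pres_class R [:: (s, true)])^-1.
Proof.
apply/esym/mulg1_eq; rewrite -pres_class_cat; apply/pres_classP.
exact: (pres_cancel R [::] (s, true) [::]).
Qed.

End PresentedGroup.

Section GroupEquations.
Variable G : groupType.
Local Open Scope group_scope.

Lemma mulgr_eq (z x y : G) : (x * z == y * z) = (x == y).
Proof. exact: (inj_eq (@mulIg _ z)). Qed.

Lemma mulgl_eq (z x y : G) : (z * x == z * y) = (x == y).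
Proof. exact: (inj_eq (@mulgI _ z)). Qed.

Lemma mulgg_eq (a x b c : G) : (a * x * b == c) = (x == a^-1 * c * b^-1).
Proof. by rewrite -(mulgr_eq b^-1) mulgK -(mulgl_eq a^-1) mulKg mulgA. Qed.

End GroupEquations.

(* An abstract copy of [coxeter M]: the quotient type itself is unfolded by
   unification. *)
Record coxeter_system (V : finType) (M : coxeter_matrix V) := CoxeterSystem {
  cox_group :> groupType;
  cox_gen : V -> cox_group;
  cox_word u := (foldr (fun s x => cox_gen s * x) 1 u)%g;
  cox_gen_sq : forall s, (cox_gen s * cox_gen s = 1)%g;
  cox_word_surj : forall x, exists u, cox_word u = x;
  cox_braid_pow : forall s t, s != t -> ((cox_gen s * cox_gen t) ^+ M s t = 1)%g;
  cox_rot_neq1 : forall s t n, s != t -> (0 < n < M s t)%N ->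
    ((cox_gen s * cox_gen t) ^+ n != 1)%g;
  cox_act : forall T (a : V -> T -> T), (forall s, involutive (a s)) ->
    (forall s t, s != t -> iter (M s t) (a s \o a t) =1 id) ->
    forall u v, cox_word u = cox_word v -> forall p, foldr a p u = foldr a p v;
  cox_enum_seq : seq cox_group;
  mem_cox_enum_seq : forall x, x \in cox_enum_seq
}.
Arguments cox_word {V M} c u : simpl never.
Arguments cox_gen {V M} c s.
Arguments cox_braid_pow {V M} c [s t].
Arguments cox_rot_neq1 {V M} c [s t n].
Arguments cox_act {V M} c [T a].

Section CoxeterGroup.
Variables (V : finType) (M : coxeter_matrix V).
Local Open Scope group_scope.

Local Notation W := (coxeter M).
Implicit Types (u v : seq V) (s t : V) (x y z w : W).

Let gen s : W := pres_class (coxeter_rel M) [:: (s, true)].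
Let wrd u : W := foldr (fun s x => gen s * x) 1 u.

Let wrdE u : wrd u = pres_class (coxeter_rel M) (pos_word u).
Proof.
elim: u => //= s u IH; rewrite -/(wrd u) IH.
by rewrite -[(s, true) :: _]/([:: (s, true)] ++ _) pres_class_cat.
Qed.

Let gen_sq s : gen s * gen s = 1.
Proof.
rewrite /gen -pres_class_cat; apply/pres_classP.
have h : coxeter_rel M [:: (s, true); (s, true)] [::] by right; exists s.
exact: (pres_rel [::] [::] h).
Qed.

Let genV s : (gen s)^-1 = gen s.
Proof. by apply: mulg1_eq; apply: gen_sq. Qed.

Let wrd_surj x : exists u, wrd u = x.
Proof.
exists [seq l.1 | l <- repr x]; rewrite -[RHS]pres_class_repr.
elim: (repr x) => //= -[s b] v IH; rewrite IH.
rewrite -[(s, b) :: v]/([:: (s, b)] ++ v) pres_class_cat; congr (_ * _).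
by case: b; rewrite // pres_class_letterV -[LHS]genV.
Qed.

Let genK s : involutive (fun x => gen s * x).
Proof. by move=> x; rewrite mulgA gen_sq mul1g. Qed.

Let iter_mulg2 x y n z : iter n ((fun z => x * z) \o (fun z => y * z)) z = (x * y) ^+ n * z.
Proof. by elim: n => [|n IH] /=; rewrite ?mul1g // IH expgS !mulgA. Qed.

Let braid_pow s t : s != t -> (gen s * gen t) ^+ M s t = 1.
Proof.
move=> st; have e : wrd (alt_seq s t (M s t)) = wrd (alt_seq t s (M s t)).
  rewrite !wrdE; apply/pres_classP; rewrite !pos_word_alt.
  have := @pres_rel V (coxeter_rel M) [::] _ _ [::] (or_introl (ex_intro _ s
    (ex_intro _ t (And3 st erefl erefl)))).
  by rewrite !cats0.
move: e; rewrite /wrd !foldr_alt_seq alt_iter_swap ?iter_mulg2; try exact: genK.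
by rewrite -[RHS]mul1g => /mulIg.
Qed.

Let act T (a : V -> T -> T) : (forall s, involutive (a s)) ->
  (forall s t, s != t -> iter (M s t) (a s \o a t) =1 id) ->
  forall u v, wrd u = wrd v -> forall p : T, foldr a p u = foldr a p v.
Proof.
move=> aK abK u v; rewrite !wrdE => /pres_classP/(coxeter_fold aK abK) h p.
have E b : foldr a p b = foldr (fun l => a l.1) p (pos_word b) by rewrite foldr_map.
by rewrite !E.
Qed.

(* The order of [s t] is exactly [M s t]: otherwise [s t] would have the
   eigenvalue [xi ^ 2] of too small order. *)
Let rot_neq1 s t n : s != t -> (0 < n < M s t)%N ->
  (gen s * gen t) ^+ n != 1.
Proof.
move=> st nm; apply/eqP => e.
have e' : wrd (flatten (nseq n [:: s; t])) = wrd [::].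
  rewrite [RHS]/= -e; elim: n {nm e} => //= n IH.
  by rewrite IH expgS mulgA.
pose x0 r : algC := (if r == s then 1 else 0)%R.
have := act (@refl_actK _ M) (@rotation_order _ M) e' x0.
rewrite /=.
have -> : foldr (@refl_act _ M) x0 (flatten (nseq n [:: s; t])) =
   iter n (@refl_act _ M s \o @refl_act _ M t) x0.
  by elim: n {nm e e'} => //= n ->.
move=> e2; have [h _] := rotation_iter_eigen M s t n x0.
move: h; rewrite e2 /x0 eqxx eq_sym (negbTE st) GRing.mulr0 GRing.addr0 GRing.mulr1.
move=> /esym h; have := half_rootP M s t => /prim_order_dvd/(_ (2 * n)%N).
by rewrite h eqxx => /dvdn_leq; lia.
Qed.

Lemma coxeter_systemP : finite_type M -> inhabited (coxeter_system M).
Proof.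
move=> /finite_seqP[r rP].
have mem_r x : x \in r by have : [set: W]%classic x by []; rewrite rP.
by constructor; exists W gen r.
Qed.

End CoxeterGroup.

(** * Inversions, the exchange condition and the length function *)

Section Length.
Variables (V : finType) (M : coxeter_matrix V) (W : coxeter_system M).
Local Open Scope group_scope.

Local Notation cox_gen := (cox_gen W).
Local Notation cox_word := (cox_word W).
Implicit Types (u v : seq V) (s t : V) (x y z w : W).

Lemma cox_word_nil : cox_word [::] = 1. Proof. by []. Qed.

Lemma cox_word_cons s u : cox_word (s :: u) = cox_gen s * cox_word u.
Proof. by []. Qed.

Lemma cox_word1 s : cox_word [:: s] = cox_gen s.
Proof. exact: mulg1. Qed.

Lemma cox_word_cat u v : cox_word (u ++ v) = cox_word u * cox_word v.
Proof.
by elim: u => [|s u IH]; rewrite ?mul1g // cat_cons !cox_word_cons IH mulgA.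
Qed.

Lemma cox_word_rcons u s : cox_word (rcons u s) = cox_word u * cox_gen s.
Proof. by rewrite -cats1 cox_word_cat cox_word_cons cox_word_nil mulg1. Qed.

Lemma cox_genV s : (cox_gen s)^-1 = cox_gen s.
Proof. by apply: mulg1_eq; apply: cox_gen_sq. Qed.

Lemma cox_genK s : cancel (fun x => cox_gen s * x) (fun x => cox_gen s * x).
Proof. by move=> x; rewrite mulgA cox_gen_sq mul1g. Qed.

Lemma cox_genKr s : cancel (fun x => x * cox_gen s) (fun x => x * cox_gen s).
Proof. by move=> x; rewrite -mulgA cox_gen_sq mulg1. Qed.

Lemma cox_wordV u : (cox_word u)^-1 = cox_word (rev u).
Proof.
elim: u => [|s u IH]; first by rewrite cox_word_nil invg1.
by rewrite rev_cons cox_word_rcons cox_word_cons invgM IH cox_genV.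
Qed.

Lemma cox_alt s t : s != t ->
  cox_word (alt_seq s t (M s t)) = cox_word (alt_seq t s (M s t)).
Proof.
move=> st; rewrite /cox_word !foldr_alt_seq alt_iter_swap; try exact: cox_genK.
have E x y n z : iter n ((fun z => x * z) \o (fun z => y * z)) z = (x * y) ^+ n * z.
  by elim: n => [|n IH] /=; rewrite ?mul1g // IH expgS !mulgA.
by rewrite E (cox_braid_pow W) // mul1g.
Qed.

(** The classical action of a Coxeter group on pairs of a reflection and a sign. Arbitrary group
    elements stand in for reflections, so that no subtype of reflections has to be formed. *)
Definition inv_step s (p : W * bool) : W * bool :=
  (cox_gen s * p.1 * cox_gen s, p.2 (+) (p.1 == cox_gen s)).

Lemma inv_stepK s : involutive (inv_step s).
Proof.
move=> [x e]; rewrite /inv_step /=; congr (_, _).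
  by rewrite !mulgA cox_gen_sq mul1g cox_genKr.
by rewrite mulgg_eq mulgK cox_genV -addbA addbb addbF.
Qed.

Lemma inv_step_rot_fst s t n p :
  (iter n (inv_step s \o inv_step t) p).1 =
  (cox_gen s * cox_gen t) ^+ n * p.1 * (cox_gen t * cox_gen s) ^+ n.
Proof.
elim: n => [|n IH] /=; first by rewrite mul1g mulg1.
by rewrite IH expgS expgSr !mulgA.
Qed.

Lemma cox_rotV s t n :
  ((cox_gen s * cox_gen t) ^+ n)^-1 = (cox_gen t * cox_gen s) ^+ n.
Proof. by rewrite -expVgn invgM !cox_genV. Qed.

Lemma cox_rot_swap s t n :
  (cox_gen s * cox_gen t) ^+ n * cox_gen s = cox_gen s * (cox_gen t * cox_gen s) ^+ n.
Proof.
by elim: n => [|n IH]; rewrite ?mul1g ?mulg1 // expgS -mulgA IH expgS !mulgA.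
Qed.

Lemma inv_step_rot_snd s t n p :
  (iter n (inv_step s \o inv_step t) p).2 =
  p.2 (+) odd (count (fun j => p.1 == (cox_gen t * cox_gen s) ^+ j * cox_gen t) (iota 0 (2 * n))).
Proof.
elim: n => [|n IH]; first by rewrite addbF.
have -> : (2 * n.+1 = 2 * n + 2)%N by lia.
rewrite iterS {1}/comp /inv_step [fst]lock [snd]lock /= -!lock IH inv_step_rot_fst iotaD count_cat oddD addbA -!addbA; congr (_ (+) (_ (+) _)).
rewrite add0n /= addn0 oddD !oddb; set r := cox_gen s * cox_gen t.
set q := cox_gen t * cox_gen s.
have rq : (r ^+ n)^-1 = q ^+ n by rewrite cox_rotV.
have qr : (q ^+ n)^-1 = r ^+ n by rewrite cox_rotV.
have tr : cox_gen t * r ^+ n = q ^+ n * cox_gen t by rewrite cox_rot_swap.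
rewrite !mulgg_eq rq qr !cox_genV -!mulgA tr; congr (_ (+) _).
  by rewrite [in LHS]mulgA -expgnDr addnn -mul2n.
congr (_ == _); rewrite !mulgA; congr (_ * _); rewrite -[_ * _ * cox_gen s]mulgA -/q.
rewrite -expgSr -expgnDr; by congr (_ ^+ _); lia.
Qed.

(** The sign is flipped once for every [j < 2 M] with [p.1 = (t s)^j t]. As [(t s)^M = 1], these [j]
    come in pairs [j], [j + M], so the number of flips is even. *)
Lemma inv_step_order s t : s != t -> iter (M s t) (inv_step s \o inv_step t) =1 id.
Proof.
move=> st p; have ts : t != s by rewrite eq_sym.
have p1 := cox_braid_pow W st.
have p2 : (cox_gen t * cox_gen s) ^+ M s t = 1 by rewrite (cox_sym M) (cox_braid_pow W).
rewrite [LHS]surjective_pairing inv_step_rot_fst inv_step_rot_snd p1 p2 mul1g mulg1.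
rewrite [RHS]surjective_pairing; congr (_, _).
rewrite mul2n -addnn iotaD count_cat add0n -[in iota (M s t)](addn0 (M s t)) iotaDl count_map.
have -> : forall r, count (preim (addn (M s t)) (fun j => p.1 == (cox_gen t * cox_gen s) ^+ j * cox_gen t)) r =
  count (fun j => p.1 == (cox_gen t * cox_gen s) ^+ j * cox_gen t) r.
  by move=> r; apply: eq_count => j /=; rewrite expgnDr p2 mul1g.
by rewrite addnn odd_double addbF.
Qed.

Definition cox_repr x : seq V := sval (cid (@cox_word_surj _ _ W x)).
Lemma cox_reprK x : cox_word (cox_repr x) = x.
Proof. by rewrite /cox_repr; case: cid. Qed.

(* For a reflection [y], [invs x y] says that [y] shortens [x] on the right. *)
Definition invs x y : bool := (foldr inv_step (y, false) (cox_repr x)).2.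

Lemma foldr_inv_step u p :
  foldr inv_step p u = (cox_word u * p.1 * (cox_word u)^-1, p.2 (+) invs (cox_word u) p.1).
Proof.
have fst_eq v q : (foldr inv_step q v).1 = cox_word v * q.1 * (cox_word v)^-1.
  elim: v => [|s v IH] /=; first by rewrite cox_word_nil invg1 mul1g mulg1.
  by rewrite IH cox_word_cons invgM cox_genV !mulgA.
have snd_eq v y b : (foldr inv_step (y, b) v).2 = b (+) (foldr inv_step (y, false) v).2.
  elim: v => [|s v IH] /=; first by rewrite addbF.
  by rewrite IH !fst_eq /= addbA.
case: p => y b; rewrite [LHS]surjective_pairing fst_eq snd_eq /invs /=; congr (_, _ (+) _.2).
by apply: (cox_act W inv_stepK inv_step_order); rewrite cox_reprK.
Qed.

Lemma invs1 y : invs 1 y = false.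
Proof. by have := foldr_inv_step [::] (y, false); case. Qed.

(** The cocycle identity of inversion sets: it is the sign component of the action of a product. *)
Lemma invsM x z y : invs (x * z) y = invs z y (+) invs x (z * y * z^-1).
Proof.
have [[u <-] [v <-]] := (@cox_word_surj _ _ W x, @cox_word_surj _ _ W z).
have := foldr_inv_step (u ++ v) (y, false).
rewrite foldr_cat (foldr_inv_step v) /= foldr_inv_step /= cox_word_cat.
by case=> _ <-.
Qed.

Lemma invs_gen s y : invs (cox_gen s) y = (y == cox_gen s).
Proof. by have := foldr_inv_step [:: s] (y, false); rewrite cox_word1 /= => -[_ <-]. Qed.

Lemma invs_genM s x y : invs (cox_gen s * x) y = invs x y (+) (y == x^-1 * cox_gen s * x).
Proof. by rewrite invsM invs_gen mulgg_eq invgK. Qed.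

Definition cox_enum : seq W := undup (cox_enum_seq W).

Lemma mem_cox_enum x : x \in cox_enum.
Proof. by rewrite mem_undup mem_cox_enum_seq. Qed.

(** The length as a number of inversions. Only conjugates of generators are ever counted;
    [len_word_le] and [reduced_word] identify the count with the least length of a word. *)
Definition len x := count (invs x) cox_enum.

Lemma count_mem_enum y : count (pred1 y) cox_enum = 1%N.
Proof. by rewrite count_uniq_mem ?undup_uniq // mem_cox_enum. Qed.

Lemma len1 : len 1 = 0%N.
Proof. by rewrite /len (eq_count invs1) count_pred0. Qed.

Lemma len_genM s x (y := x^-1 * cox_gen s * x) :
  len (cox_gen s * x) = if invs x y then (len x).-1 else (len x).+1.
Proof.
rewrite /len (eq_count (invs_genM s x)) -/y.
have -> p q : count (fun z => p z (+) q z) cox_enum =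
  (count (fun z => p z && ~~ q z) cox_enum + count (fun z => ~~ p z && q z) cox_enum)%N.
  by elim: cox_enum => //= z r ->; case: (p z); case: (q z) => /=; lia.
have -> : count (invs x) cox_enum = (count (fun z => invs x z && (z != y)) cox_enum + invs x y)%N.
  have -> : (invs x y : nat) = count (fun z => invs x z && (z == y)) cox_enum.
    rewrite -[LHS]muln1 -(count_mem_enum y) /=.
    elim: cox_enum => /= [|z r <-]; first by rewrite muln0.
    case: eqP => [->|]; rewrite ?andbT ?andbF; lia.
  by elim: cox_enum => //= z r ->; case: (invs x z); case: eqP => /=; lia.
have -> : count (fun z => ~~ invs x z && (z == y)) cox_enum = ~~ invs x y.
  rewrite -[RHS]muln1 -(count_mem_enum y) /=.
  elim: cox_enum => /= [|z r ->]; first by rewrite muln0.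
  case: eqP => [->|]; rewrite ?andbT ?andbF; lia.
by case: (invs x y) => /=; lia.
Qed.

(** Strong exchange: if a letter [s] toggles [y], then [y = x^-1 s x] for the suffix [x] after it,
    and [s x y = x], so that this letter is the one to delete. *)
Lemma exchange u y : invs (cox_word u) y ->
  exists2 v, (size v).+1 = size u & cox_word v = cox_word u * y.
Proof.
elim: u => [|s u IH]; first by rewrite cox_word_nil invs1.
rewrite cox_word_cons invs_genM; case: eqP => [->|_].
  by exists u; rewrite // !mulgA mulgK cox_gen_sq mul1g.
rewrite addbF => /IH [v sv ev]; exists (s :: v); rewrite /= ?sv //.
by rewrite cox_word_cons ev mulgA.
Qed.

Lemma len_word_le u : (len (cox_word u) <= size u)%N.
Proof.
elim: u => [|s u IH]; first by rewrite cox_word_nil len1.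
by rewrite cox_word_cons len_genM /=; case: ifP; lia.
Qed.

(** Take a shortest word. If its first letter removed an inversion, exchange in the suffix would
    give a word for the same element with two letters fewer; so every letter adds an inversion. *)
Lemma reduced_word x : exists2 u, cox_word u = x & size u = len x.
Proof.
have [u0 ux] := @cox_word_surj _ _ W x.
pose P n := `[< exists2 u, cox_word u = x & size u = n >].
have exP : exists n, P n by exists (size u0); apply/asboolP; exists u0.
case: (ex_minnP exP) => n /asboolP[u {}ux un] nmin; exists u => //.
have {}nmin v : cox_word v = cox_word u -> (size u <= size v)%N.
  by move=> vu; rewrite un; apply: nmin; apply/asboolP; exists v => //; rewrite vu.
rewrite -ux; elim: u nmin {ux un} => [|s u IH] min; first by rewrite cox_word_nil len1.
rewrite cox_word_cons len_genM -IH.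
  case: ifP => // /exchange[v sv ev].
  have := min v; rewrite ev cox_word_cons !mulgA mulgV mul1g => /(_ erefl) /=; lia.
by move=> v vu; have := min (s :: v); rewrite !cox_word_cons vu => /(_ erefl).
Qed.

Lemma len_eq0 x : len x = 0%N -> x = 1.
Proof. by move=> x0; have [u ux] := reduced_word x; rewrite x0 => /size0nil u0; rewrite -ux u0. Qed.

Lemma lenM x y : (len (x * y)%g <= len x + len y)%N.
Proof.
have [u <- <-] := reduced_word x; have [v <- <-] := reduced_word y.
by rewrite -cox_word_cat -size_cat len_word_le.
Qed.

Lemma lenV x : len x^-1 = len x.
Proof.
have le y : (len y^-1%g <= len y)%N.
  by have [u <- <-] := reduced_word y; rewrite cox_wordV -[size u]size_rev len_word_le.
by apply/eqP; rewrite eqn_leq le -{1}[x]invgK le.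
Qed.

Lemma len_refl_lt x y : invs x y -> (len (x * y)%g < len x)%N.
Proof.
have [u ux <-] := reduced_word x; rewrite -ux => /exchange[v sv <-].
by rewrite -sv ltnS len_word_le.
Qed.

Lemma len_Mgen x s :
  len (x * cox_gen s) = if invs x (cox_gen s) then (len x).-1 else (len x).+1.
Proof.
have E : len (x * cox_gen s) = (len x).+1 \/ len (x * cox_gen s) = (len x).-1.
  by rewrite -[len x]lenV -lenV invgM cox_genV len_genM; case: ifP; [right|left].
case: ifP => [/len_refl_lt|ninv]; first by case: E; lia.
have : invs (x * cox_gen s) (cox_gen s).
  by rewrite invsM invs_gen eqxx mulgK ninv.
move=> /len_refl_lt; rewrite cox_genKr; case: E => //; lia.
Qed.

Definition rdesc x s := invs x (cox_gen s).

Lemma len_rdesc x s : len (x * cox_gen s) = if rdesc x s then (len x).-1 else (len x).+1.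
Proof. exact: len_Mgen. Qed.

Lemma rdescE x s : rdesc x s = (len (x * cox_gen s)%g < len x)%N.
Proof.
apply/idP/idP => [/len_refl_lt //|]; rewrite len_rdesc; case: ifP => //; lia.
Qed.

Lemma len_bound x : (len x <= size cox_enum)%N.
Proof. exact: count_size. Qed.

Lemma invs_sq x y : invs x y -> y * y = 1.
Proof.
have [u <-] := cox_word_surj x; elim: u => [|s u IH]; first by rewrite cox_word_nil invs1.
rewrite cox_word_cons invs_genM; case: eqP => [-> _|_]; last by rewrite addbF.
by rewrite !mulgA mulgK -[_ * cox_gen s * cox_gen s]mulgA cox_gen_sq mulg1 mulVg.
Qed.

Lemma invs_self x y : invs x y -> invs y y.
Proof.
move=> xy; have yy := invs_sq xy; apply/negPn/negP => /negbTE nyy.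
have /len_refl_lt : invs (x * y) y by rewrite invsM nyy mulgK xy.
rewrite -mulgA yy mulg1; have := len_refl_lt xy; lia.
Qed.

(* [w0] inverts every reflection, so each reflection is inverted by exactly one
   of the two factors of [w0 = (w0 * x^-1) * x]. *)
Lemma len_longest w0 x : (forall y, (len y <= len w0)%N) ->
  len w0 = (len (w0 * x^-1)%g + len x)%N.
Proof.
move=> w0max.
have w0y z y : invs z y -> invs w0 y.
  move=> zy; apply/negPn/negP => /negbTE nw; have yy := invs_sq zy.
  have /len_refl_lt : invs (w0 * y) y by rewrite invsM (invs_self zy) mulgK nw.
  by rewrite -mulgA yy mulg1; have := w0max (w0 * y); lia.
have split_y y : (invs w0 y : nat) = (invs (w0 * x^-1) (x * y * x^-1) + invs x y)%N.
  have := invsM (w0 * x^-1) x y; rewrite mulgVK.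
  have := @w0y x y; case: (invs x y); first by move=> -> //; case: (invs _ _).
  by move=> _ ->; case: (invs _ _).
have perm : perm_eq [seq x * y * x^-1 | y <- cox_enum] cox_enum.
  apply: uniq_perm; rewrite ?undup_uniq ?map_inj_uniq ?undup_uniq //.
    by move=> y z /mulIg/mulgI.
  move=> y; rewrite mem_cox_enum; apply/mapP; exists (x^-1 * y * x); rewrite ?mem_cox_enum //.
  by rewrite !mulgA mulgV mul1g mulgK.
have -> : len (w0 * x^-1) = count (fun y => invs (w0 * x^-1) (x * y * x^-1)) cox_enum.
  by rewrite /len -(permP perm) count_map.
rewrite /len; elim: cox_enum => //= y r ->; rewrite split_y; lia.
Qed.

End Length.
#[global] Opaque len invs.

(** * Dihedral subgroups and their cosets *)

Section Dihedral.
Variables (V : finType) (M : coxeter_matrix V) (W : coxeter_system M).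
Local Open Scope group_scope.

Local Notation cox_gen := (cox_gen W).
Local Notation cox_word := (cox_word W).
Implicit Types (u v : seq V) (s t : V) (x y z w : W).

Definition alt_elt s t n : W := cox_word (alt_seq s t n).

Lemma alt_seqSr s t n : alt_seq s t n.+1 = rcons (alt_seq s t n) (if odd n then t else s).
Proof.
elim: n s t => // n IH s t; rewrite -[LHS]/(s :: alt_seq t s n.+1) IH /=.
by case: (odd n).
Qed.

Lemma alt_eltSr s t n : alt_elt s t n.+1 = alt_elt s t n * cox_gen (if odd n then t else s).
Proof. by rewrite /alt_elt alt_seqSr cox_word_rcons. Qed.

Lemma alt_eltS s t n : alt_elt s t n.+1 = cox_gen s * alt_elt t s n.
Proof. exact: cox_word_cons. Qed.

Lemma alt_elt_refl s t n :
  alt_elt s t n.+1 = (cox_gen s * cox_gen t) ^+ n * cox_gen s * alt_elt s t n.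
Proof.
elim: n s t => [|n IH] s t; first by rewrite mul1g alt_eltS.
rewrite alt_eltS IH alt_eltS !mulgA expgSr -(cox_rot_swap W s t n).
by congr (_ * _); rewrite -!mulgA cox_gen_sq mulg1.
Qed.

Lemma invs_altV s t n y : invs (alt_elt s t n)^-1 y ->
  exists2 j, (j < n)%N & y = (cox_gen s * cox_gen t) ^+ j * cox_gen s.
Proof.
elim: n => [|n IH]; first by rewrite invg1 invs1.
rewrite alt_eltSr invgM cox_genV invs_genM.
have -> : (alt_elt s t n)^-1^-1 * cox_gen (if odd n then t else s) * (alt_elt s t n)^-1
   = (cox_gen s * cox_gen t) ^+ n * cox_gen s.
  by rewrite invgK -alt_eltSr alt_elt_refl mulgK.
case: eqP => [->|_]; first by exists n.
by rewrite addbF => /IH[j jn ->]; exists j => //; apply: ltnW.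
Qed.

(** Appending a letter adds [(s t)^n s] to the inversions [(s t)^j s], [j < n], of the inverse; it
    is new because [s t] has order exactly [M s t]. *)
Lemma len_alt_elt s t n : s != t -> (n <= M s t)%N -> len (alt_elt s t n) = n.
Proof.
move=> st; elim: n => [|n IH] nm; first by rewrite len1.
rewrite -lenV alt_eltSr invgM cox_genV len_genM.
rewrite [_^-1^-1]invgK lenV IH 1?ltnW // -alt_eltSr alt_elt_refl mulgK.
case: ifP => // /invs_altV[j jn] /mulIg; rewrite -(subnKC (ltnW jn)) expgnDr => e.
have /eqP : (cox_gen s * cox_gen t) ^+ (n - j) = 1.
  by apply: (@mulgI _ ((cox_gen s * cox_gen t) ^+ j)); rewrite e mulg1.
by rewrite (negbTE (cox_rot_neq1 W st _)) //; lia.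
Qed.

Definition alt_elt2 s t (b : bool) n := if b then alt_elt s t n else alt_elt t s n.

Lemma alt_elt2_max s t b : s != t -> alt_elt2 s t b (M s t) = alt_elt s t (M s t).
Proof. by case: b => // st; rewrite /alt_elt (cox_alt W st). Qed.

Lemma len_alt_elt2 s t b n : s != t -> (n <= M s t)%N -> len (alt_elt2 s t b n) = n.
Proof.
by move=> st nm; case: b; rewrite len_alt_elt //; rewrite 1?eq_sym // (cox_sym M).
Qed.

Lemma alt_elt2Sr s t b n :
  alt_elt2 s t b n.+1 = alt_elt2 s t b n * cox_gen (if odd n (+) b then s else t).
Proof. by case: b; rewrite /alt_elt2 alt_eltSr; case: (odd n). Qed.

Lemma alt_eltV s t n : (alt_elt s t n)^-1 = alt_elt2 s t (odd n) n.
Proof.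
elim: n s t => [|n IH] s t; first exact: invg1.
rewrite alt_eltS invgM IH cox_genV alt_elt2Sr /=.
by case: (odd n).
Qed.

Lemma dihedral_word s t u : s != t -> all (mem [:: s; t]) u ->
  exists b n, (n <= M s t)%N /\ cox_word u = alt_elt2 s t b n.
Proof.
move=> st; elim: u => [|r u IH] /=; first by exists true, 0%N.
move=> /andP[rst /IH[b [n [nm un]]]].
have m2 := cox_ge2 M st.
have [c rc] : exists c : bool, r = if c then s else t.
  by move: rst; rewrite !inE => /orP[]/eqP ->; [exists true|exists false].
have up k : (k < M s t)%N -> exists b n, (n <= M s t)%N /\ cox_gen r * alt_elt2 s t (~~ c) k = alt_elt2 s t b n.
  by move=> km; exists c, k.+1; rewrite rc; split=> //; case: (c); rewrite /= alt_eltS.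
have down k : (k <= M s t)%N -> exists b n, (n <= M s t)%N /\ cox_gen r * alt_elt2 s t c k = alt_elt2 s t b n.
  case: k => [|k] km; last first.
    exists (~~ c), k; split; first exact: ltnW.
    by rewrite rc; case: (c); rewrite /= alt_eltS cox_genK.
  have -> : alt_elt2 s t c 0 = alt_elt2 s t (~~ c) 0 by case: (c).
  by apply: up; lia.
rewrite cox_word_cons un; case: (altP (b =P c)) => [->|bc]; first exact: down.
have -> : b = ~~ c by move: bc; case: (b); case: (c).
case: (ltngtP n (M s t)) nm => // [nm _|-> _]; first exact: up.
by rewrite alt_elt2_max // -(alt_elt2_max c) //; apply: down.
Qed.

Lemma alt_seq_mem s t n : all (mem [:: s; t]) (alt_seq s t n).
Proof.
elim: n s t => //= n IH s t; rewrite !inE eqxx /=.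
by rewrite (eq_all (a2 := mem [:: t; s])) // => x; rewrite !inE orbC.
Qed.

(** Take [y] of least length in the coset of [x]. If a letter [l] lengthens the alternating element
    [a] but shortens [y a], then [a l a^-1] is an inversion of [y], and multiplying [y] by it gives
    a shorter element of the same coset. *)
Lemma dihedral_coset s t x : s != t ->
  exists y b n, [/\ (n <= M s t)%N, x = y * alt_elt2 s t b n &
    forall c k, (k <= M s t)%N -> len (y * alt_elt2 s t c k) = (len y + k)%N].
Proof.
move=> st.
pose P n := `[< exists2 u, all (mem [:: s; t]) u & len (x * cox_word u) = n >].
have exP : exists n, P n by exists (len x); apply/asboolP; exists [::]; rewrite // mulg1.
case: (ex_minnP exP) => n /asboolP[u ust un] nmin.
have [b [k [km uk]]] : exists b n, (n <= M s t)%N /\ cox_word (rev u) = alt_elt2 s t b n.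
  by apply: dihedral_word; rewrite // all_rev.
exists (x * cox_word u), b, k; split=> //.
  by rewrite -uk -mulgA -cox_wordV mulgV mulg1.
move=> c; elim=> [|j IH] jm; first by case: c; rewrite mulg1 addn0.
rewrite alt_elt2Sr; set l := (if _ then _ else _); set a := alt_elt2 s t c j.
rewrite mulgA len_rdesc (IH (ltnW jm)); case: ifP; last by rewrite addnS.
rewrite /rdesc invsM.
have -> : invs a (cox_gen l) = false.
  apply/negbTE; rewrite -/(rdesc a l) rdescE /l /a -alt_elt2Sr !len_alt_elt2 //; lia.
move=> /len_refl_lt h.
pose e := if c then alt_seq s t j else alt_seq t s j.
have ae : a = cox_word e by rewrite /a /e; case: (c).
have est : all (mem [:: s; t]) e.
  rewrite /e; case: (c); rewrite ?alt_seq_mem //.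
  by rewrite (eq_all (a2 := mem [:: t; s])) ?alt_seq_mem // => z; rewrite !inE orbC.
have : P (len (x * cox_word u * (a * cox_gen l * a^-1))).
  apply/asboolP; exists (u ++ e ++ [:: l] ++ rev e).
    rewrite !all_cat ust all_rev est /= /l !inE; case: ifP; by rewrite eqxx ?orbT.
  by rewrite !cox_word_cat cox_word1 -cox_wordV -ae !mulgA.
move=> /nmin; have := h; rewrite un; lia.
Qed.

Lemma rdesc2 s t x : s != t -> rdesc x s -> rdesc x t ->
  exists2 y, x = y * alt_elt s t (M s t) & len x = (len y + M s t)%N.
Proof.
move=> st; have [y [b [n [nm xy ly]]]] := dihedral_coset x st.
case: (ltngtP n (M s t)) nm => // [nm _|en _] xs xt.
  have : rdesc x (if odd n (+) b then s else t) by case: ifP.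
  by rewrite rdescE xy -mulgA -alt_elt2Sr (ly b _ nm) (ly b _ (ltnW nm)); lia.
exists y; first by rewrite xy en alt_elt2_max.
by rewrite xy en ly.
Qed.

Lemma not_rdesc2 s t x n : s != t -> ~~ rdesc x s -> ~~ rdesc x t ->
  (n <= M s t)%N -> len (x * alt_elt s t n) = (len x + n)%N.
Proof.
move=> st; have [y [b [k [km xy ly]]]] := dihedral_coset x st.
case: k => [|k] in km xy.
  have -> : x = y by rewrite xy; case: (b); rewrite mulg1.
  by move=> _ _ nm; rewrite (ly true).
move=> xs xt; have : ~~ rdesc x (if odd k (+) b then s else t) by case: ifP.
by rewrite rdescE xy alt_elt2Sr mulgA cox_genKr -mulgA -alt_elt2Sr (ly b _ km) (ly b _ (ltnW km)); lia.
Qed.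

(** * Weak order *)

Definition additive x y := len (x * y) == (len x + len y)%N.
Definition wprefix x w := additive x (x^-1 * w).

Lemma additive1 x : additive x 1.
Proof. by rewrite /additive mulg1 len1 addn0. Qed.

Lemma additiveA x y z :
  additive x y && additive (x * y) z = additive y z && additive x (y * z).
Proof.
have E : x * y * z = x * (y * z) by rewrite mulgA.
rewrite /additive; have := lenM (x * y) z; rewrite E => h2.
have h1 := lenM x y; have h3 := lenM y z; have h4 := lenM x (y * z); lia.
Qed.

Lemma additive_wprefix x y : additive x y = wprefix x (x * y).
Proof. by rewrite /wprefix mulKg. Qed.

Lemma wprefixP x w : reflect (exists2 y, w = x * y & additive x y) (wprefix x w).
Proof.
apply: (iffP idP) => [h|[y -> h]]; last by rewrite -additive_wprefix.
by exists (x^-1 * w); rewrite ?mulgA ?mulgV ?mul1g.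
Qed.

Lemma wprefix_refl x : wprefix x x.
Proof. by rewrite /wprefix mulVg additive1. Qed.

Lemma wprefix1 x : wprefix 1 x.
Proof. by rewrite /wprefix /additive invg1 !mul1g len1. Qed.

Lemma wprefix_trans y x z : wprefix x y -> wprefix y z -> wprefix x z.
Proof.
move=> /wprefixP[p -> xp] /wprefixP[q -> xyq]; rewrite -mulgA -additive_wprefix.
by have := additiveA x p q; rewrite xp xyq /= => /esym/andP[].
Qed.

Lemma len_wprefix x y : wprefix x y -> (len x <= len y)%N.
Proof. by move=> /wprefixP[p -> /eqP ->]; rewrite leq_addr. Qed.

Lemma wprefix_anti x y : wprefix x y -> (len y <= len x)%N -> x = y.
Proof.
move=> /wprefixP[p -> /eqP ->] h; suff -> : p = 1 by rewrite mulg1.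
by apply: len_eq0; apply/eqP; rewrite -leqn0; move: h; lia.
Qed.

Lemma additive_sub z x y : wprefix x y -> additive z y -> additive z x.
Proof.
by move=> /wprefixP[q -> vq] pw; have := additiveA z x q; rewrite vq pw /= => /andP[].
Qed.

Lemma additive_wprefix_mul z x y :
  wprefix x y -> additive z y -> wprefix (z * x) (z * y).
Proof.
move=> /wprefixP[q -> vq] pw; rewrite mulgA -additive_wprefix.
by have := additiveA z x q; rewrite vq pw /= => /andP[].
Qed.

Lemma wprefix_cancel z x y :
  additive z x -> additive z y -> wprefix (z * x) (z * y) -> wprefix x y.
Proof.
move=> zx zy /wprefixP[q]; rewrite -mulgA => /mulgI -> zxq.
by have := additiveA z x q; rewrite zx zxq -additive_wprefix => /esym/andP[].
Qed.

Lemma len_gen s : len (cox_gen s) = 1%N.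
Proof. by rewrite -[cox_gen s]mul1g len_rdesc /rdesc invs1 len1. Qed.

Lemma additive_gen x s : additive x (cox_gen s) = ~~ rdesc x s.
Proof. by rewrite /additive len_gen len_rdesc; case: ifP => /=; lia. Qed.

Lemma additiveV x y : additive x y = additive y^-1 x^-1.
Proof. by rewrite /additive -invgM !lenV addnC. Qed.

Lemma wprefix_neq1 x y : wprefix x y -> x != y ->
  exists s, wprefix (x * cox_gen s) y && additive x (cox_gen s).
Proof.
move=> /wprefixP[p -> xp]; have [u up su] := reduced_word p.
case: u up su => [<-|s u pu su _]; first by rewrite mulg1 eqxx.
exists s; move: xp; rewrite -pu cox_word_cons => xp.
have su' : additive (cox_gen s) (cox_word u).
  rewrite /additive -cox_word_cons pu -su len_gen /= add1n.
  have := @len_word_le _ _ W u; have := lenM (cox_gen s) (cox_word u).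
  by rewrite -cox_word_cons pu -su len_gen /=; lia.
have := additiveA x (cox_gen s) (cox_word u).
by rewrite xp su' mulgA -additive_wprefix => /andP[-> ->].
Qed.

Lemma wprefix_join s t w : s != t -> wprefix (cox_gen s) w -> wprefix (cox_gen t) w ->
  wprefix (alt_elt s t (M s t)) w.
Proof.
have E r : wprefix (cox_gen r) w -> rdesc w^-1 r.
  move=> /wprefixP[y -> /eqP h]; rewrite rdescE invgM cox_genV cox_genKr lenV.
  by rewrite -cox_genV -invgM lenV h len_gen.
move=> st /E ws /E wt; have [y wy ly] := rdesc2 st ws wt.
apply/wprefixP; exists y^-1.
  by apply: invg_inj; rewrite invgM invgK alt_eltV alt_elt2_max.
by rewrite additiveV invgK alt_eltV alt_elt2_max // /additive -wy ly len_alt_elt.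
Qed.

Lemma additive_join z s t : s != t -> additive z (cox_gen s) -> additive z (cox_gen t) ->
  additive z (alt_elt s t (M s t)).
Proof.
rewrite !additive_gen => st zs zt.
by rewrite /additive not_rdesc2 // len_alt_elt.
Qed.

Lemma wprefix_alt_elt s t (a := alt_elt s t (M s t)) : s != t ->
  wprefix (cox_gen s) a /\ wprefix (cox_gen t) a.
Proof.
have pre r r' : r != r' -> wprefix (cox_gen r) (alt_elt r r' (M r r')).
  move=> rr'; have m0 := cox_gt0 M r r'; rewrite -(prednK m0) alt_eltS -additive_wprefix.
  rewrite /additive -alt_eltS prednK // !len_alt_elt //; first by rewrite len_gen; lia.
    by rewrite eq_sym.
  by rewrite (cox_sym M); apply: leq_pred.
move=> st; split; first exact: pre.
by rewrite /a /alt_elt cox_alt // (cox_sym M); apply: pre; rewrite eq_sym.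
Qed.

(* Newman's lemma in the prefix-closed set of [y <= w] with [z * y] additive. *)
Lemma max_additive_wprefix z w : exists2 y, wprefix y w && additive z y &
  forall x, wprefix x w -> additive z x -> wprefix x y.
Proof.
pose C y := wprefix y w && additive z y.
have CP x y : C y -> wprefix x y -> C x.
  move=> /andP[yw zy] xy; rewrite /C (wprefix_trans xy yw); exact: additive_sub zy.
have step n : forall x, C x -> (len w - len x < n)%N -> exists2 y, C y && wprefix x y &
    forall x', C x' -> wprefix x x' -> wprefix x' y.
  elim: n => // n IH x Cx xn.
  have IHs s : additive x (cox_gen s) -> C (x * cox_gen s) ->
      exists2 y, C y && wprefix (x * cox_gen s) y &
      forall x', C x' -> wprefix (x * cox_gen s) x' -> wprefix x' y.
    move=> /eqP xs Cxs; apply: IH => //.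
    by have /andP[/len_wprefix + _] := Cxs; rewrite xs len_gen; lia.
  have [noext|] := pselect (forall s, ~ (additive x (cox_gen s) /\ C (x * cox_gen s))).
    exists x; rewrite ?Cx ?wprefix_refl // => x' Cx' xx'.
    case: (eqVneq x x') => [->|/(wprefix_neq1 xx')[s /andP[h1 h2]]]; first exact: wprefix_refl.
    by case: (noext s); split=> //; apply: CP h1.
  move=> /existsNP[s /contrapT[xs Cxs]].
  have [y /andP[Cy xsy] ymax] := IHs s xs Cxs.
  exists y; first by rewrite Cy (wprefix_trans _ xsy) // -additive_wprefix.
  move=> x' Cx' xx'.
  case: (eqVneq x x') => [<-|/(wprefix_neq1 xx')[t /andP[xtx' xt]]].
    by rewrite (wprefix_trans _ xsy) // -additive_wprefix.
  case: (eqVneq s t) => [st|st]; first by rewrite ymax // st.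
  have Cxt : C (x * cox_gen t) by apply: CP xtx'.
  have [y' /andP[Cy' xty'] y'max] := IHs t xt Cxt.
  (* Local confluence: [x * a] lies in the set and above [x t], hence below [y']. So [y'] is above
     [x s], and therefore below [y]. *)
  pose a := alt_elt s t (M s t).
  have wprefixV r : additive x (cox_gen r) -> C (x * cox_gen r) ->
      wprefix (cox_gen r) (x^-1 * w).
    move=> xr /andP[/wprefixP[q wq xrq] _]; rewrite wq -mulgA mulKg -additive_wprefix.
    by have := additiveA x (cox_gen r) q; rewrite xr xrq => /esym/andP[].
  have /wprefixP[q wq aq] : wprefix a (x^-1 * w) by apply: wprefix_join => //; apply: wprefixV.
  have xq : additive x (a * q) by case/andP: Cx; rewrite /wprefix wq.
  have /andP[xa xaq] : additive x a && additive (x * a) q by rewrite additiveA aq xq.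
  have Ca : C (x * a).
    apply/andP; split.
      by apply/wprefixP; exists q; rewrite // -mulgA -wq mulVKg.
    have zx : additive z x by case/andP: Cx.
    have zxr r : additive x (cox_gen r) -> C (x * cox_gen r) -> additive (z * x) (cox_gen r).
      move=> xr /andP[_ zxr]; have := additiveA z x (cox_gen r).
      by rewrite xr zxr zx.
    have := additiveA z x a; rewrite zx additive_join ?zxr //=.
    by move=> /esym/andP[].
  have [sa ta] : wprefix (cox_gen s) a /\ wprefix (cox_gen t) a by apply: wprefix_alt_elt.
  move: (additive_wprefix_mul sa xa) (additive_wprefix_mul ta xa) => {}sa {}ta.
  have y'y : wprefix y' y.
    apply: ymax Cy' (wprefix_trans sa _); exact: y'max.
  exact: wprefix_trans (y'max _ Cx' xtx') y'y.
have C1 : C 1 by rewrite /C wprefix1 additive1.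
have [y /andP[Cy _] ymax] := step _ 1 C1 (ltnSn _).
exists y => // x xw zx; apply: ymax; last exact: wprefix1.
by rewrite /C xw zx.
Qed.

End Dihedral.

(** * The positive monoid: Matsumoto's theorem, heads, cancellation *)

Inductive mon_eq (V : finType) (M : coxeter_matrix V) : seq V -> seq V -> Prop :=
| mon_rel l s t r : s != t ->
    mon_eq M (l ++ alt_seq s t (M s t) ++ r) (l ++ alt_seq t s (M s t) ++ r)
| mon_refl u : mon_eq M u u
| mon_sym u v : mon_eq M u v -> mon_eq M v u
| mon_trans u v w : mon_eq M u v -> mon_eq M v w -> mon_eq M u w.
Arguments mon_refl {V M u}.

Section ArtinMonoid.
Variables (V : finType) (M : coxeter_matrix V).
Implicit Types (u v : seq V) (s t : V).

Lemma mon_cat l r u v : mon_eq M u v -> mon_eq M (l ++ u ++ r) (l ++ v ++ r).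
Proof.
elim=> {u v} [l' s t r' st|u|u v _ IH|u v w _ IH1 _ IH2].
- by have := @mon_rel _ M (l ++ l') _ _ (r' ++ r) st; rewrite -!catA.
- exact: mon_refl.
- exact: mon_sym.
- exact: mon_trans IH1 IH2.
Qed.

Lemma mon_catl l u v : mon_eq M u v -> mon_eq M (l ++ u) (l ++ v).
Proof. by move=> /(mon_cat l [::]); rewrite !cats0. Qed.

Lemma mon_catr r u v : mon_eq M u v -> mon_eq M (u ++ r) (v ++ r).
Proof. exact: (mon_cat [::] r). Qed.

Lemma mon_cons s u v : mon_eq M u v -> mon_eq M (s :: u) (s :: v).
Proof. exact: (mon_catl [:: s]). Qed.

Lemma mon_size u v : mon_eq M u v -> size u = size v.
Proof.
elim=> {u v} [l s t r st|//|u v _ -> //|u v w _ -> _ -> //].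
by rewrite !size_cat !size_alt_seq.
Qed.

Lemma mem_alt_seq s t n : (1 < n)%N -> alt_seq s t n =i [:: s; t].
Proof.
case: n => [|[|n]] // _ x; elim: n s t => // n IH s t.
by rewrite inE IH !inE; case: (x == s); case: (x == t).
Qed.

Lemma mon_mem u v : mon_eq M u v -> u =i v.
Proof.
elim=> {u v} [l s t r st|//|u v _ h x|u v w _ h1 _ h2 x]; last 2 first.
- by rewrite h.
- by rewrite h1 h2.
have m2 := cox_ge2 M st.
by move=> x; rewrite !mem_cat !mem_alt_seq // !inE [(x == s) || _]orbC.
Qed.

Lemma rev_alt_seq s t n :
  rev (alt_seq s t n) = if odd n then alt_seq s t n else alt_seq t s n.
Proof.
elim: n s t => // n IH s t.
by rewrite {1}alt_seqSr rev_rcons IH /=; case: (odd n).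
Qed.

Lemma mon_rev u v : mon_eq M u v -> mon_eq M (rev u) (rev v).
Proof.
elim=> {u v} [l s t r st|u|u v _ IH|u v w _ IH1 _ IH2].
- rewrite !rev_cat -!catA !rev_alt_seq; case: odd; last apply: mon_sym; exact: mon_rel.
- exact: mon_refl.
- exact: mon_sym.
- exact: mon_trans IH1 IH2.
Qed.

Local Notation artin_word u := (pres_class (braid_rel M) (pos_word u)).

Lemma mon_artin u v : mon_eq M u v -> artin_word u = artin_word v.
Proof.
elim=> {u v} [l s t r st|//|u v _ -> //|u v w _ -> _ -> //].
apply/pres_classP; rewrite /pos_word !map_cat -/(pos_word _) -/(pos_word _).
rewrite -!/(pos_word _) !pos_word_alt.
by apply: pres_rel; exists s, t.
Qed.

Variable W : coxeter_system M.
Local Open Scope group_scope.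
Local Notation cox_gen := (cox_gen W).
Local Notation cox_word := (cox_word W).
Implicit Types (x y z w : W).

Definition reduced u := size u == len (cox_word u).

Lemma reduced_cons s u : reduced (s :: u) = reduced u && additive (cox_gen s) (cox_word u).
Proof.
rewrite /reduced /additive len_gen cox_word_cons /= add1n.
have h1 := len_word_le W u; have := lenM (cox_gen s) (cox_word u).
rewrite len_gen; lia.
Qed.

Lemma reduced_cat u v : additive (cox_word u) (cox_word v) -> reduced u -> reduced v ->
  reduced (u ++ v).
Proof. by rewrite /reduced size_cat cox_word_cat => /eqP -> /eqP -> /eqP ->. Qed.

Lemma reduced_alt s t n : s != t -> (n <= M s t)%N -> reduced (alt_seq s t n).
Proof.
move=> st nm; rewrite /reduced size_alt_seq; have := len_alt_elt W st nm.
by rewrite /alt_elt => ->.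
Qed.

Definition red_word x : seq V := s2val (cid2 (reduced_word x)).

Lemma red_wordK x : cox_word (red_word x) = x.
Proof. by rewrite /red_word; case: cid2. Qed.

Lemma red_wordP x : reduced (red_word x).
Proof. by rewrite /reduced red_wordK /red_word; case: cid2 => /= u _ ->. Qed.

Lemma wprefix_cons s u : reduced (s :: u) -> wprefix (cox_gen s) (cox_word (s :: u)).
Proof. by rewrite reduced_cons => /andP[_]; rewrite additive_wprefix. Qed.

(** Equal first letters are cancelled. If they are [s] and [t], the join of [s] and [t] is a prefix
    of the element, so by induction after the first letter each word can be made to start with its
    alternating word of length [M s t]; one braid relation links the two. *)
Theorem matsumoto u v : reduced u -> reduced v -> cox_word u = cox_word v -> mon_eq M u v.
Proof.
elim: {u}(size u).+1 {-2}u (ltnSn (size u)) v => // n IH [|s u] un v ru rv uv.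
  move: rv; rewrite /reduced -uv len1 => /eqP/size0nil ->; exact: mon_refl.
case: v rv uv => [|t v] rv uv.
  by move: ru; rewrite /reduced uv len1.
have [ru' su] : reduced u /\ additive (cox_gen s) (cox_word u).
  by apply/andP; rewrite -reduced_cons.
have [rv' tv] : reduced v /\ additive (cox_gen t) (cox_word v).
  by apply/andP; rewrite -reduced_cons.
have suv : size v = size u.
  by move: ru rv; rewrite /reduced uv => /eqP <- /eqP [].
have vn : (size v < n)%N by rewrite suv.
case: (eqVneq s t) => [st|st].
  rewrite -st; apply/mon_cons/IH => //.
  by move: uv; rewrite -st => /mulgI.
have ps : wprefix (cox_gen s) (cox_word (s :: u)) by apply: wprefix_cons.
have pt : wprefix (cox_gen t) (cox_word (s :: u)) by rewrite uv; apply: wprefix_cons.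
have /wprefixP[y wy ay] := wprefix_join st ps pt.
have m0 := cox_gt0 M s t.
have half r r' p : r != r' -> cox_word (r :: p) = alt_elt W r r' (M r r') * y ->
    additive (alt_elt W r r' (M r r')) y -> reduced (r :: p) -> (size p < n)%N ->
    mon_eq M (r :: p) (alt_seq r r' (M r r') ++ red_word y).
  move=> rr' e a rrp pn; have m0' := cox_gt0 M r r'.
  have := reduced_cat (u := alt_seq r r' (M r r')) (v := red_word y).
  rewrite red_wordK => /(_ a (reduced_alt rr' (leqnn _)) (red_wordP _)).
  move: e; rewrite -(prednK m0') alt_eltS /= cox_word_cons -mulgA => /mulgI e.
  rewrite reduced_cons => /andP[red _]; apply/mon_cons/IH => //.
    by move: rrp; rewrite reduced_cons => /andP[].
  by rewrite cox_word_cat red_wordK.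
have ts : t != s by rewrite eq_sym.
have altE : alt_elt W s t (M s t) = alt_elt W t s (M t s).
  by rewrite /alt_elt cox_alt // (cox_sym M t s).
apply: mon_trans (half s t u st wy ay ru un) _.
apply: mon_trans (mon_sym (half t s v ts _ _ rv vn)); rewrite -?altE -?uv //.
rewrite (cox_sym M t s); exact: (@mon_rel _ M [::]).
Qed.

(** * Head and tail of a positive word *)

Definition max_wprefix z w : W := s2val (cid2 (max_additive_wprefix z w)).

Lemma max_wprefixP z w : wprefix (max_wprefix z w) w /\ additive z (max_wprefix z w).
Proof. by rewrite /max_wprefix; case: cid2 => /= y /andP[]. Qed.

Lemma max_wprefix_max z w x : wprefix x w -> additive z x -> wprefix x (max_wprefix z w).
Proof. by rewrite /max_wprefix; case: cid2 => /= y _; apply. Qed.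

Lemma wprefix_antisym x y : wprefix x y -> wprefix y x -> x = y.
Proof. by move=> xy /len_wprefix; apply: wprefix_anti. Qed.

(** The greedy choice may be made in stages: what [s z] absorbs from [w] is found by letting [z]
    absorb first and then cutting down to what [s] accepts. Hence letters acting one at a time
    compute the action of a whole reduced word. *)
Lemma max_wprefixM s z w (y := max_wprefix z w) : additive (cox_gen s) z ->
  max_wprefix (cox_gen s) (z * y) = z * max_wprefix (cox_gen s * z) w.
Proof.
move=> sz; set y2 := max_wprefix (cox_gen s * z) w.
have [yw zy] := max_wprefixP z w; rewrite -/y in yw zy.
have [y2w szy2] := max_wprefixP (cox_gen s * z) w; rewrite -/y2 in y2w szy2.
have /andP[zy2 szy2'] : additive z y2 && additive (cox_gen s) (z * y2).
  by rewrite -additiveA sz szy2.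
apply: wprefix_antisym; last first.
  apply: max_wprefix_max => //; apply: additive_wprefix_mul => //; exact: max_wprefix_max.
have [h1 h2] := max_wprefixP (cox_gen s) (z * y).
set q := max_wprefix _ _ in h1 h2 *.
have /wprefixP[q' qq' zq'] : wprefix z q.
  by apply: max_wprefix_max; rewrite -?additive_wprefix.
rewrite qq' in h1 h2 *; apply: additive_wprefix_mul; last exact: zy2.
have /andP[_ szq'] : additive (cox_gen s) z && additive (cox_gen s * z) q'.
  by rewrite additiveA zq' h2.
by apply: max_wprefix_max => //; apply: wprefix_trans yw; apply: wprefix_cancel h1.
Qed.

Lemma max_wprefix1 w : max_wprefix 1 w = w.
Proof.
have [h _] := max_wprefixP 1 w; apply: wprefix_antisym => //.
by apply: max_wprefix_max; rewrite ?wprefix_refl // /additive !mul1g len1.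
Qed.

(** Prepending a letter to a pair (head, tail): the head keeps the part that stays simple after [s],
    and the rest returns to the tail as a word, which matters only up to [mon_eq]. *)
Definition head_step s (p : W * seq V) : W * seq V :=
  let y := max_wprefix (cox_gen s) p.1 in
  (cox_gen s * y, red_word (y^-1 * p.1) ++ p.2).

Definition state_eq (p q : W * seq V) := p.1 = q.1 /\ mon_eq M p.2 q.2.

Lemma state_trans p q r : state_eq p q -> state_eq q r -> state_eq p r.
Proof. by move=> [e h] [e' h']; split; [rewrite e|apply: mon_trans h']. Qed.

Lemma state_sym p q : state_eq p q -> state_eq q p.
Proof. by move=> [e h]; split=> //; apply: mon_sym. Qed.

Lemma red_word_cat x y : additive x y -> mon_eq M (red_word x ++ red_word y) (red_word (x * y)).
Proof.
move=> xy; apply: matsumoto; rewrite ?red_wordP //; last by rewrite cox_word_cat !red_wordK.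
by apply: reduced_cat; rewrite ?red_wordK ?red_wordP.
Qed.

Lemma red_word1 : red_word 1 = [::].
Proof. by have := red_wordP 1; rewrite /reduced red_wordK len1 => /eqP/size0nil. Qed.

Lemma red_word_gen s : mon_eq M (red_word (cox_gen s)) [:: s].
Proof.
apply: matsumoto; rewrite ?red_wordP ?red_wordK ?cox_word1 //.
by rewrite /reduced cox_word1 len_gen.
Qed.

Lemma foldr_head_eq u p q : state_eq p q ->
  state_eq (foldr head_step p u) (foldr head_step q u).
Proof.
move=> pq; elim: u => //= s u [e h]; rewrite /head_step e; split=> //=.
exact: mon_catl.
Qed.

(* Up to [mon_eq] the action of a reduced word depends only on its class in the
   Coxeter group, so both sides of a braid relation act alike. *)
Lemma foldr_head_reduced u w c (y := max_wprefix (cox_word u) w) : reduced u ->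
  state_eq (foldr head_step (w, c) u) (cox_word u * y, red_word (y^-1 * w) ++ c).
Proof.
rewrite {}/y; elim: u => [|s u IH].
  rewrite /= max_wprefix1 mulVg red_word1 mul1g => _; split=> //; exact: mon_refl.
rewrite reduced_cons /= => /andP[/IH [e h] su].
rewrite /head_step; split; rewrite /= e max_wprefixM //; first exact: mulgA.
move: h => /=; set z := cox_word u; set y := max_wprefix z w; set y2 := max_wprefix _ w => h.
have [y2w szy2] := max_wprefixP (cox_gen s * z) w; rewrite -/y2 in y2w szy2.
have [yw zy] := max_wprefixP z w; rewrite -/y in yw zy.
have zy2 : additive z y2.
  by have := additiveA (cox_gen s) z y2; rewrite su szy2 => /esym/andP[].
have /wprefixP[q yq y2q] : wprefix y2 y by apply: max_wprefix_max.
have /wprefixP[r wr yr] := yw.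
apply: mon_trans (mon_catl _ h) _; rewrite catA.
apply: mon_catr; have -> : (z * y2)^-1 * (z * y) = q.
  by rewrite invgM -mulgA mulKg yq mulKg.
have -> : y^-1 * w = r by rewrite wr mulKg.
have -> : y2^-1 * w = q * r by rewrite wr yq -mulgA mulKg.
apply: red_word_cat; have := additiveA y2 q r; rewrite -yq y2q yr.
by move=> /esym/andP[].
Qed.

Definition head_tail u := foldr head_step (1, [::]) u.

Lemma head_tail_eq u v : mon_eq M u v -> state_eq (head_tail u) (head_tail v).
Proof.
elim=> {u v} [l s t r st|u|u v _ IH|u v w _ IH1 _ IH2].
- rewrite /head_tail !foldr_cat; apply: foldr_head_eq.
  case: (foldr _ _ r) => w c.
  apply: state_trans (foldr_head_reduced _ _ (reduced_alt st (leqnn _))) _.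
  apply: state_sym; rewrite cox_alt //; apply: foldr_head_reduced.
  by rewrite (cox_sym M s t); apply: reduced_alt; rewrite // eq_sym.
- split=> //; exact: mon_refl.
- exact: state_sym.
- exact: state_trans IH1 IH2.
Qed.

Lemma head_tailE u : mon_eq M u (red_word (head_tail u).1 ++ (head_tail u).2).
Proof.
elim: u => [|s u IH] /=; first by rewrite red_word1; apply: mon_refl.
apply: mon_trans (mon_cons s IH) _; rewrite /head_step /=.
move: (head_tail u) => [w c] /=.
have [/wprefixP[q wq yq] sy] := max_wprefixP (cox_gen s) w.
set y := max_wprefix _ w in wq yq sy *; rewrite {1}wq wq mulKg catA -cat_cons.
apply: mon_catr; apply: mon_trans (mon_cons s (mon_sym (red_word_cat yq))) _.
rewrite -cat_cons; apply: mon_catr; apply: mon_trans (red_word_cat sy).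
by rewrite -cat1s; apply/mon_catr/mon_sym/red_word_gen.
Qed.

(** A step can be undone: the new head determines [y], and [y] prepended to the new tail rebuilds
    the old head and tail. *)
Lemma mon_cancel_cons s u v : mon_eq M (s :: u) (s :: v) -> mon_eq M u v.
Proof.
move=> /head_tail_eq[]; rewrite /= => /mulgI e h.
apply: mon_trans (head_tailE u) _; apply: mon_trans (mon_sym (head_tailE v)).
move: e h; move: (head_tail u) (head_tail v) => [x c] [x' c'] /= e.
have [/wprefixP[q wq yq] _] := max_wprefixP (cox_gen s) x.
have [/wprefixP[q' wq' yq'] _] := max_wprefixP (cox_gen s) x'.
rewrite -e in wq' yq' *; set y := max_wprefix _ x in wq wq' yq yq' *.
rewrite {1}wq wq' !mulKg => h.
have := mon_catl (red_word y) h; rewrite !catA => {}h.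
rewrite wq; apply: mon_trans (mon_trans h _).
  by apply/mon_catr/mon_sym/red_word_cat.
by apply/mon_catr/red_word_cat.
Qed.

Lemma head_wprefix s u : wprefix (cox_gen s) (head_tail (s :: u)).1.
Proof.
have [_ sy] := max_wprefixP (cox_gen s) (head_tail u).1.
by rewrite /= -additive_wprefix.
Qed.

(** Both letters are prefixes of the common head, where the weak order supplies their join. *)
Lemma mon_lcm_cons s t u v : s != t -> mon_eq M (s :: u) (t :: v) ->
  exists v', mon_eq M (s :: u) (alt_seq s t (M s t) ++ v').
Proof.
move=> st uv; have [e _] := head_tail_eq uv.
have := head_wprefix t v; rewrite -e => ht.
have /wprefixP[q hq aq] := wprefix_join st (head_wprefix s u) ht.
exists (red_word q ++ (head_tail (s :: u)).2).
apply: mon_trans (head_tailE _) _; rewrite catA; apply: mon_catr.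
rewrite hq; apply: mon_trans (mon_sym (red_word_cat aq)) _.
apply/mon_catr/matsumoto; rewrite ?red_wordP ?red_wordK //.
exact: reduced_alt.
Qed.

Lemma longest_exists : exists w0, forall x, (len x <= len w0)%N.
Proof.
pose P n := `[< exists x, len x = n >].
have exP : exists n, P n by exists (len (1 : W)); apply/asboolP; exists 1.
have bP n : P n -> (n <= size (cox_enum W))%N.
  by move=> /asboolP[x <-]; apply: len_bound.
case: (ex_maxnP exP bP) => n /asboolP[w0 <-] h.
by exists w0 => x; apply: h; apply/asboolP; exists x.
Qed.

Lemma len_eq1 x : len x = 1%N -> exists s, x = cox_gen s.
Proof.
have [u <-] := reduced_word x => <-; case: u => [|s [|]] // _.
by exists s; rewrite cox_word1.
Qed.

(** Let [D] be a word for the longest element. Lengths add along [w0], so [D] can start and end with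
    any letter, and [w0 s w0] has length 1. Passing [D] turns a letter into another one, and passing
    it twice restores the letter because [w0 w0 = 1]. *)
Lemma mon_central : exists z : seq V, (forall s, mon_eq M (s :: z) (z ++ [:: s])) /\
  forall s, exists u, mon_eq M z (s :: u).
Proof.
have [w0 w0max] := longest_exists.
have h x := len_longest x w0max.
have w0w0 : w0 * w0 = 1.
  by apply: len_eq0; have := h w0^-1; rewrite invgK lenV; lia.
have w0V : w0^-1 = w0 by apply: mulg1_eq.
have hs s : len w0 = (len (w0 * cox_gen s)).+1.
  by have := h (cox_gen s); rewrite cox_genV len_gen addn1.
have divl s : additive (cox_gen s) (cox_gen s * w0).
  rewrite /additive cox_genK len_gen -[len (cox_gen s * w0)]lenV invgM cox_genV w0V.
  by rewrite add1n -hs.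
have divr s : additive (w0 * cox_gen s) (cox_gen s).
  by rewrite /additive cox_genKr len_gen addn1 -hs.
have swap s : exists t, w0 * cox_gen s = cox_gen t * w0.
  have := h (w0 * cox_gen s); rewrite invgM cox_genV w0V {1}(hs s) => e.
  have [|t et] := @len_eq1 (w0 * (cox_gen s * w0)).
    by move: e; rewrite -add1n => /addIn <-.
  by exists t; rewrite -et -!mulgA w0w0 mulg1.
pose D := red_word w0.
have Dl s : mon_eq M D (s :: red_word (cox_gen s * w0)).
  rewrite /D -{1}[w0](cox_genK (W := W) s); apply: mon_trans (mon_sym (red_word_cat (divl s))) _.
  by rewrite -cat1s; apply/mon_catr/red_word_gen.
have Dr s : mon_eq M D (red_word (w0 * cox_gen s) ++ [:: s]).
  rewrite /D -{1}[w0](cox_genKr (W := W) s); apply: mon_trans (mon_sym (red_word_cat (divr s))) _.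
  by apply/mon_catl/red_word_gen.
have DE s t : w0 * cox_gen s = cox_gen t * w0 -> mon_eq M (t :: D) (D ++ [:: s]).
  move=> e; apply: mon_trans (mon_cons t (Dr s)) _; rewrite -cat_cons; apply: mon_catr.
  by rewrite e; apply/mon_sym/Dl.
exists (D ++ D); split=> s; last first.
  by exists (red_word (cox_gen s * w0) ++ D); rewrite -cat_cons; apply: mon_catr.
have [t et] := swap s.
have es : w0 * cox_gen t = cox_gen s * w0.
  by rewrite -[cox_gen t](mulgK w0) -et !mulgA w0w0 mul1g w0V.
apply: mon_trans (mon_catr D (DE _ _ es)) _; rewrite -!catA.
exact/mon_catl/DE.
Qed.

End ArtinMonoid.

(** * Embedding of the monoid in the Artin group *)

Section Embedding.
Variables (V : finType) (M : coxeter_matrix V).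
Hypothesis Mfin : finite_type M.
Implicit Types (u v : seq V) (s t : V).

Lemma mon_cancel l u v : mon_eq M (l ++ u) (l ++ v) -> mon_eq M u v.
Proof.
have [W] := coxeter_systemP Mfin.
by elim: l => // s l IH /(mon_cancel_cons W)/IH.
Qed.

Lemma mon_cancelr r u v : mon_eq M (u ++ r) (v ++ r) -> mon_eq M u v.
Proof. by move=> /mon_rev; rewrite !rev_cat => /mon_cancel/mon_rev; rewrite !revK. Qed.

Lemma mon_lcm s t u v : s != t -> mon_eq M (s :: u) (t :: v) ->
  exists v', mon_eq M (s :: u) (alt_seq s t (M s t) ++ v').
Proof. have [W] := coxeter_systemP Mfin; exact: mon_lcm_cons. Qed.

(* Inverting each letter [s] as [u z^-1] with [s u = z] central embeds the
   monoid in its group of fractions. *)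
Lemma mon_embed u v : pres_eq (braid_rel M) (pos_word u) (pos_word v) -> mon_eq M u v.
Proof.
have [W] := coxeter_systemP Mfin.
have [z [zc /choice[f zf]]] := mon_central W.
have zcu w : mon_eq M (w ++ z) (z ++ w).
  elim: w => [|s w IH]; first by rewrite cats0; apply: mon_refl.
  apply: mon_trans (mon_cons s IH) _; rewrite -cat_cons.
  by have := mon_catr w (zc s); rewrite -catA.
pose zp n := flatten (nseq n z).
have zpc n w : mon_eq M (w ++ zp n) (zp n ++ w).
  elim: n => [|n IH]; first by rewrite cats0; apply: mon_refl.
  rewrite /zp /= -/(zp n); apply: (mon_trans (v := z ++ w ++ zp n)).
    by have := mon_catr (zp n) (zcu w); rewrite -!catA.
  by rewrite -[X in mon_eq _ _ X]catA; apply: mon_catl.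
(* A signed word is read as the fraction [num w] over [z ^ den w]; [E] compares two fractions after
   cross-multiplication by powers of the central [z]. *)
pose num (w : word V) := flatten [seq if l.2 then [:: l.1] else f l.1 | l <- w].
pose den (w : word V) := count (fun l => ~~ l.2) w.
pose E w w' := mon_eq M (num w ++ zp (den w')) (num w' ++ zp (den w)).
have zpD m n : zp (m + n)%N = zp m ++ zp n by rewrite /zp nseqD flatten_cat.
have numD w w' : num (w ++ w') = num w ++ num w' by rewrite /num map_cat flatten_cat.
have denD w w' : den (w ++ w') = (den w + den w')%N by rewrite /den count_cat.
have num_pos w : num (pos_word w) = w by elim: w => //= s w; rewrite /num /= => ->.
have den_pos w : den (pos_word w) = 0%N by elim: w => //= s w; rewrite /den /= => ->.
have fz s : mon_eq M (f s ++ [:: s]) z.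
  apply: (@mon_cancel [:: s]); rewrite /= -cat_cons.
  by apply: mon_trans (mon_catr _ (mon_sym (zf s))) _; apply/mon_sym/zc.
have Ecat l r w w' : E w w' -> E (l ++ w ++ r) (l ++ w' ++ r).
  rewrite /E !numD !denD -!catA => h; apply: mon_catl.
  have zpr k : mon_eq M (num r ++ zp (den l + (k + den r))%N)
      (zp k ++ num r ++ zp (den l + den r)%N).
    have -> : (den l + (k + den r) = k + (den l + den r))%N by lia.
    by rewrite zpD !catA; apply/mon_catr/zpc.
  apply: mon_trans (mon_catl _ (zpr _)) _.
  apply: mon_sym; apply: mon_trans (mon_catl _ (zpr _)) _.
  have := mon_catr (num r ++ zp (den l + den r)%N) (mon_sym h).
  by rewrite -!catA.
suff main w w' : pres_eq (braid_rel M) w w' -> E w w'.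
  by move=> /main; rewrite /E !num_pos !den_pos !cats0.
elim=> {w w'} [l w w' r [s [t [st -> ->]]]|l [s b] r|w|w w' _ IH|w1 w2 w3 _ h1 _ h2].
- apply: Ecat; rewrite /E -!pos_word_alt !num_pos !den_pos !cats0.
  by have := @mon_rel _ M [::] s t [::] st; rewrite !cats0.
- rewrite -[r in E _ (l ++ r)]cat0s; apply: Ecat; rewrite /E /den /= addn0.
  case: b => /=; rewrite /num /zp /= !cats0; last exact: fz.
  exact/mon_sym/zf.
- exact: mon_refl.
- exact: mon_sym.
- apply: (@mon_cancelr (zp (den w2))); rewrite -!catA -!zpD.
  apply: (mon_trans (v := num w2 ++ zp (den w1 + den w3)%N)).
    by rewrite addnC !zpD !catA; apply: mon_catr.
  by rewrite addnC [(den w1 + _)%N]addnC !zpD !catA; apply: mon_catr.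
Qed.

End Embedding.

(* An abstract copy of [artin M], for the same reason as [coxeter_system]. *)
Record artin_system (V : finType) (M : coxeter_matrix V) := ArtinSystem {
  artin_carrier :> groupType;
  gen : V -> artin_carrier;
  pos u := (foldr (fun s x => gen s * x) 1 u)%g;
  posP : forall u v, pos u = pos v <-> mon_eq M u v
}.
Arguments gen {V M} a s.
Arguments pos {V M} a u : simpl never.

(** * Divisibility and least common multiples of positive elements *)

Section Garside.
Variables (V : finType) (M : coxeter_matrix V).
Hypothesis Mfin : finite_type M.
Variable G : artin_system M.
Local Open Scope group_scope.
Local Notation gen := (gen G).
Local Notation pos := (pos G).
Implicit Types (u v : seq V) (s t : V) (X Y Z : {set V}) (a b c d e p q x y : G).

Lemma pos_nil : pos [::] = 1. Proof. by []. Qed.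

Lemma pos_cons s u : pos (s :: u) = gen s * pos u.
Proof. by []. Qed.

Lemma pos1 s : pos [:: s] = gen s.
Proof. exact: mulg1. Qed.

Lemma pos_cat u v : pos (u ++ v) = pos u * pos v.
Proof. by elim: u => [|s u IH]; rewrite ?mul1g // cat_cons !pos_cons IH mulgA. Qed.

Lemma pos_mem u v : pos u = pos v -> u =i v.
Proof. by move=> /posP/mon_mem. Qed.

Lemma pos_size u v : pos u = pos v -> size u = size v.
Proof. by move=> /posP/mon_size. Qed.

Definition pmon X a := exists2 u, all (mem X) u & pos u = a.
Local Notation P := (pmon (finset.setTfor V)).
Definition ldvd a b := P (a^-1 * b).

Lemma pmon_pos X u : all (mem X) u -> pmon X (pos u).
Proof. by exists u. Qed.

Lemma P_pos u : P (pos u).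
Proof. by exists u => //; apply/allP => s _ /=; rewrite inE. Qed.

Lemma PP a : P a <-> exists u, a = pos u.
Proof. by split=> [[u _ <-]|[u ->]]; [exists u | apply: P_pos]. Qed.

Lemma pmonS X Y a : X \subset Y -> pmon X a -> pmon Y a.
Proof.
move=> /fintype.subsetP XY [u uX <-]; exists u => //.
by apply/allP => s /(allP uX)/XY.
Qed.

Lemma pmonT X a : pmon X a -> P a.
Proof. by apply: pmonS; apply: finset.subsetT. Qed.

Lemma pmon1 X : pmon X 1.
Proof. by exists [::]. Qed.

Lemma pmonM X a b : pmon X a -> pmon X b -> pmon X (a * b).
Proof.
by move=> [u uX <-] [v vX <-]; exists (u ++ v); rewrite ?all_cat ?uX // pos_cat.
Qed.

Lemma pmonX X a n : pmon X a -> pmon X (a ^+ n).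
Proof. by move=> Xa; elim: n => [|n IH]; [apply: pmon1|rewrite expgS; apply: pmonM]. Qed.

Lemma pmon_posE X u : pmon X (pos u) <-> all (mem X) u.
Proof.
split=> [[v vX /pos_mem vu]|uX]; last by exists u.
by rewrite -(eq_all_r vu).
Qed.

Lemma pmon_gen X s : pmon X (gen s) <-> s \in X.
Proof. by rewrite -pos1 pmon_posE /= andbT. Qed.

Lemma pmon_factor X a b : P a -> P b -> pmon X (a * b) -> pmon X a /\ pmon X b.
Proof.
move=> /PP[u ->] /PP[v ->]; rewrite -pos_cat !pmon_posE all_cat.
by move=> /andP.
Qed.

Lemma P_gen s : P (gen s).
Proof. by apply/pmon_gen; rewrite inE. Qed.

(** Independent of the word, since braid relations preserve length. Outside the positive monoid the
    default word gives degree 0, so the rules for [deg] assume positivity. *)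
Definition deg a : nat := size (xget [::] [set u | pos u = a]%classic).

Lemma deg_pos u : deg (pos u) = size u.
Proof.
apply: pos_size; rewrite /deg.
by case: (xgetP [::] [set v | pos v = pos u]%classic) => [v _ //|/(_ u)]; case.
Qed.

Lemma degM a b : P a -> P b -> deg (a * b) = (deg a + deg b)%N.
Proof. by move=> /PP[u ->] /PP[v ->]; rewrite -pos_cat !deg_pos size_cat. Qed.

Lemma deg1 : deg 1 = 0%N. Proof. by rewrite -pos_nil deg_pos. Qed.

Lemma deg_gen s : deg (gen s) = 1%N. Proof. by rewrite -pos1 deg_pos. Qed.

Lemma deg_eq0 a : P a -> deg a = 0%N -> a = 1.
Proof. by move=> /PP[u ->]; rewrite deg_pos => /size0nil ->. Qed.

Lemma deg_eq1 a : P a -> deg a = 1%N -> exists s, a = gen s.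
Proof.
move=> /PP[u ->]; rewrite deg_pos; case: u => [|s [|]] // _.
by exists s; rewrite pos1.
Qed.

Lemma gen_inj : injective gen.
Proof.
move=> s t; rewrite -!pos1 => /pos_mem/(_ t).
by rewrite !inE eqxx => /eqP.
Qed.

Lemma pmon_case X a : pmon X a -> a = 1 \/ exists s b, [/\ s \in X, pmon X b & a = gen s * b].
Proof.
move=> [[|s u] /= uX <-]; [by left | right].
by case/andP: uX => sX uX; exists s, (pos u); split=> //; exists u.
Qed.

Lemma pmon_ind X (Q : G -> Prop) : Q 1 ->
  (forall s b, s \in X -> pmon X b -> Q b -> Q (gen s * b)) ->
  forall a, pmon X a -> Q a.
Proof.
move=> Q1 QM a [u uX <-]; elim: u uX => [|s u IH] //= /andP[sX uX].
by rewrite pos_cons; apply: QM => //; [exists u | apply: IH].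
Qed.

Lemma ldvdP a b : ldvd a b <-> exists2 c, P c & b = a * c.
Proof. by split=> [h|[c Pc ->]]; [exists (a^-1 * b); rewrite ?mulVKg | rewrite /ldvd mulKg]. Qed.

Lemma ldvd_mulr a c : P c -> ldvd a (a * c).
Proof. by rewrite /ldvd mulKg. Qed.

Lemma ldvd_refl a : ldvd a a.
Proof. by rewrite /ldvd mulVg; apply: pmon1. Qed.

Lemma ldvd1 a : P a -> ldvd 1 a.
Proof. by rewrite /ldvd invg1 mul1g. Qed.

Lemma ldvd_trans b a c : ldvd a b -> ldvd b c -> ldvd a c.
Proof.
move=> /ldvdP[x Px ->] /ldvdP[y Py ->]; rewrite -mulgA.
by apply/ldvd_mulr/pmonM.
Qed.

Lemma ldvd_mul2l c a b : ldvd (c * a) (c * b) <-> ldvd a b.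
Proof. by rewrite /ldvd invgM -mulgA mulKg. Qed.

Lemma ldvd_pmon X a b : P a -> ldvd a b -> pmon X b -> pmon X a.
Proof. by move=> Pa /ldvdP[c Pc ->] /(pmon_factor Pa Pc)[]. Qed.

Lemma ldvd_deg a b : P a -> ldvd a b -> (deg a <= deg b)%N.
Proof. by move=> Pa /ldvdP[c Pc ->]; rewrite degM // leq_addr. Qed.

Lemma ldvd_deg_eq a b : P a -> ldvd a b -> (deg b <= deg a)%N -> b = a.
Proof.
move=> Pa /ldvdP[c Pc ->]; rewrite degM // => h.
by rewrite (@deg_eq0 c) ?mulg1 //; lia.
Qed.

Lemma gen_alt_lcm s t a b : s != t -> P a -> P b -> gen s * a = gen t * b ->
  ldvd (pos (alt_seq s t (M s t))) (gen s * a).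
Proof.
move=> st /PP[u ->] /PP[v ->]; rewrite -!pos_cons => /posP/(mon_lcm Mfin st)[w].
by move=> /(posP G) ->; rewrite pos_cat; apply/ldvd_mulr/P_pos.
Qed.

Lemma ldvd_alt s t a : s != t -> ldvd (gen s) a -> ldvd (gen t) a ->
  ldvd (pos (alt_seq s t (M s t))) a.
Proof. by move=> st /ldvdP[b Pb ->] /ldvdP[c Pc]; apply: gen_alt_lcm. Qed.

Lemma pos_alt_sym s t : s != t ->
  pos (alt_seq s t (M s t)) = pos (alt_seq t s (M s t)).
Proof.
move=> st; apply/posP; have := @mon_rel _ M [::] s t [::] st; by rewrite !cats0.
Qed.

(** * Least common multiples *)

(** The last clause, that the lcm uses only letters of its two arguments, is part of the definition
    because it comes out of the same recursion as the lcm. *)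
Definition is_lcm2 a b d := [/\ P d, ldvd a d, ldvd b d,
  forall c, P c -> ldvd a c -> ldvd b c -> ldvd d c &
  forall X, pmon X a -> pmon X b -> pmon X d].

(** The degree of a common multiple bounds the recursion. For first letters [s], [t] with lcm
    [mu = s m1 = t m2'], take the lcm [m1 f1] of [a1] and [m1], the lcm [m2' f2] of [b1] and [m2'],
    and then the lcm [d3] of [f1] and [f2]; the result is [mu d3]. *)
Lemma lcm2_exists a b c : P a -> P b -> P c -> ldvd a c -> ldvd b c ->
  exists d, is_lcm2 a b d.
Proof.
have [n] := ubnP (deg c); elim: n a b c => // n IH a b c cn.
move=> /pmon_case[-> Pb Pc _ bc|[s [a1 [_ Pa1 ->]]]].
  by exists b; split=> //; [apply: ldvd1 | apply: ldvd_refl].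
move=> /pmon_case[-> Pc ac _|[t [b1 [_ Pb1 ->]]]].
  have Psa : P (gen s * a1) by apply: pmonM => //; apply: P_gen.
  by exists (gen s * a1); split=> //; [apply: ldvd_refl | apply: ldvd1].
move=> Pc /ldvdP[x Px cx] /ldvdP[y Py cy].
have Pa1x : P (a1 * x) by apply: pmonM.
have Pb1y : P (b1 * y) by apply: pmonM.
have cs : c = gen s * (a1 * x) by rewrite cx mulgA.
have ct : c = gen t * (b1 * y) by rewrite cy mulgA.
have dc1 : (deg (a1 * x) < n)%N by move: cn; rewrite cs degM ?deg_gen //; apply: P_gen.
have dc2 : (deg (b1 * y) < n)%N by move: cn; rewrite ct degM ?deg_gen //; apply: P_gen.
case: (eqVneq s t) => [st|st].
  rewrite -st in ct *; have e : a1 * x = b1 * y by apply: (@mulgI _ (gen s)); rewrite -cs -ct.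
  have [|d [Pd d1 d2 d3 d4]] := IH a1 b1 (a1 * x) dc1 Pa1 Pb1 Pa1x (ldvd_mulr _ Px).
    by rewrite e; apply: ldvd_mulr.
  exists (gen s * d); split; rewrite ?ldvd_mul2l //.
  - by apply: pmonM => //; apply: P_gen.
  - move=> c' Pc' /ldvdP[x' Px' ->]; rewrite -mulgA !ldvd_mul2l => h.
    by apply: d3 => //; [apply: pmonM | apply: ldvd_mulr].
  - move=> X /(pmon_factor (P_gen s) Pa1)[hs ha] /(pmon_factor (P_gen s) Pb1)[_ hb].
    by apply: pmonM => //; apply: d4.
set mu := pos (alt_seq s t (M s t)).
have m2 := cox_ge2 M st.
pose m1 := pos (alt_seq t s (M s t).-1).
pose m2' := pos (alt_seq s t (M s t).-1).
have m0 := cox_gt0 M s t.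
have mu1 : mu = gen s * m1 by rewrite /mu -{1}(prednK m0).
have mu2 : mu = gen t * m2' by rewrite /mu pos_alt_sym // -{1}(prednK m0).
have Pm1 : P m1 by apply: P_pos.
have Pm2 : P m2' by apply: P_pos.
have lmu c' : P c' -> ldvd (gen s * a1) c' -> ldvd (gen t * b1) c' -> ldvd mu c'.
  move=> Pc' h1 h2; apply: ldvd_alt => //; first exact: ldvd_trans (ldvd_mulr _ Pa1) h1.
  exact: ldvd_trans (ldvd_mulr _ Pb1) h2.
have /ldvdP[e Pe ce] : ldvd mu c.
  by apply: lmu => //; rewrite ?cx ?[in X in ldvd _ X]cy; [apply: ldvd_mulr|rewrite -cx cy; apply: ldvd_mulr].
have e1 : a1 * x = m1 * e by apply: (@mulgI _ (gen s)); rewrite -cs ce mu1 mulgA.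
have e2 : b1 * y = m2' * e by apply: (@mulgI _ (gen t)); rewrite -ct ce mu2 mulgA.
have [|d1 [Pd1 ad1 md1 d1min d1X]] := IH a1 m1 (a1 * x) dc1 Pa1 Pm1 Pa1x (ldvd_mulr _ Px).
  by rewrite e1; apply: ldvd_mulr.
have [|d2 [Pd2 bd2 md2 d2min d2X]] := IH b1 m2' (b1 * y) dc2 Pb1 Pm2 Pb1y (ldvd_mulr _ Py).
  by rewrite e2; apply: ldvd_mulr.
have /ldvdP[f1 Pf1 d1f] := md1; have /ldvdP[f2 Pf2 d2f] := md2.
have f1e c' : ldvd d1 (m1 * c') -> ldvd f1 c' by rewrite d1f ldvd_mul2l.
have f2e c' : ldvd d2 (m2' * c') -> ldvd f2 c' by rewrite d2f ldvd_mul2l.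
have en : (deg e < n)%N by move: dc1; rewrite e1 degM //; lia.
have [||d3 [Pd3 fd3 gd3 d3min d3X]] := IH f1 f2 e en Pf1 Pf2 Pe.
- by apply: f1e; rewrite -e1; apply: d1min => //; rewrite ?e1; [rewrite -e1|]; apply: ldvd_mulr.
- by apply: f2e; rewrite -e2; apply: d2min => //; rewrite ?e2; [rewrite -e2|]; apply: ldvd_mulr.
exists (mu * d3); split.
- by apply: pmonM => //; apply: P_pos.
- rewrite mu1 -mulgA ldvd_mul2l; apply: ldvd_trans ad1 _.
  by rewrite d1f ldvd_mul2l.
- rewrite mu2 -mulgA ldvd_mul2l; apply: ldvd_trans bd2 _.
  by rewrite d2f ldvd_mul2l.
- move=> c' Pc' h1 h2; have /ldvdP[e' Pe' ce'] := lmu _ Pc' h1 h2.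
  rewrite ce' ldvd_mul2l; apply: d3min => //.
    apply: f1e; apply: d1min; [exact: pmonM| |exact: ldvd_mulr].
    by move: h1; rewrite ce' mu1 -mulgA ldvd_mul2l.
  apply: f2e; apply: d2min; [exact: pmonM| |exact: ldvd_mulr].
  by move: h2; rewrite ce' mu2 -mulgA ldvd_mul2l.
- move=> X /(pmon_factor (P_gen s) Pa1)[hs ha] /(pmon_factor (P_gen t) Pb1)[ht hb].
  have hmu : pmon X mu.
    apply/pmon_pos/allP => r; rewrite mem_alt_seq // !inE.
    by case/orP => /eqP ->; apply/pmon_gen.
  have [_ hm1] : pmon X (gen s) /\ pmon X m1 by apply: pmon_factor => //; [apply: P_gen | rewrite -mu1].
  have [_ hm2] : pmon X (gen t) /\ pmon X m2' by apply: pmon_factor => //; [apply: P_gen | rewrite -mu2].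
  apply: pmonM => //; apply: d3X.
    by have := d1X _ ha hm1; rewrite d1f => /(pmon_factor Pm1 Pf1)[].
  by have := d2X _ hb hm2; rewrite d2f => /(pmon_factor Pm2 Pf2)[].
Qed.

End Garside.

(** * The elements Delta_X and standard parabolic subgroups *)

Section GarsideElements.
Variables (V : finType) (M : coxeter_matrix V).
Hypothesis Mfin : finite_type M.
Variable G : artin_system M.
Local Open Scope group_scope.
Local Notation gen := (gen G).
Local Notation pos := (pos G).
Local Notation pmon := (@pmon V M G).
Local Notation P := (pmon (finset.setTfor V)).
Local Notation ldvd := (@ldvd V M G).
Implicit Types (u v : seq V) (s t : V) (X Y Z : {set V}) (a b c d e p q x y : G).

Lemma common_multiple : exists2 z, P z & forall s, ldvd (gen s) z.
Proof.
have [W] := coxeter_systemP Mfin; have [z [_ zs]] := mon_central W.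
exists (pos z) => [|s]; first exact: P_pos.
have [u /(posP G) ->] := zs s; rewrite pos_cons; exact/ldvd_mulr/P_pos.
Qed.

Definition is_lcm_set X d := [/\ pmon X d,
  forall s, s \in X -> ldvd (gen s) d &
  forall e, P e -> (forall s, s \in X -> ldvd (gen s) e) -> ldvd d e].

Lemma lcm_set_exists X : exists d, is_lcm_set X d.
Proof.
have [z Pz zs] := common_multiple.
suff [d [Xd ds dmin]] : exists d, [/\ pmon X d,
    forall s, s \in enum X -> ldvd (gen s) d &
    forall e, P e -> (forall s, s \in enum X -> ldvd (gen s) e) -> ldvd d e].
  exists d; split=> // [s sX|e Pe h]; first by apply: ds; rewrite mem_enum.
  by apply: dmin => // s; rewrite mem_enum; apply: h.
have: all (mem X) (enum X) by apply/allP => s; rewrite mem_enum.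
elim: (enum X) => [_|s r IH /= /andP[sX /IH[d [Xd ds dmin]]]].
  by exists 1; split=> // [|e Pe _]; [apply: pmon1 | apply: ldvd1].
have [|d' [Pd' sd' dd' d'min d'X]] := lcm2_exists Mfin (P_gen G s) (pmonT Xd) Pz (zs s).
  by apply: dmin.
exists d'; split=> [|t|e Pe h]; first by apply: d'X => //; apply/pmon_gen.
  by rewrite inE => /orP[/eqP -> //|/ds td]; apply: ldvd_trans td dd'.
apply: d'min => //; first by apply: h; rewrite mem_head.
by apply: dmin => // t tr; apply: h; rewrite inE tr orbT.
Qed.

Definition garside X : G := xget 1 [set d | is_lcm_set X d]%classic.
Local Notation D := garside.

Lemma garsideP X : is_lcm_set X (D X).
Proof. by rewrite /D; have [d h] := lcm_set_exists X; case: (xgetP 1 [set d | is_lcm_set X d]%classic) => [e ->//|/(_ d)]. Qed.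

Lemma garside_pmon X : pmon X (D X).
Proof. by have [] := garsideP X. Qed.

Lemma garside_P X : P (D X).
Proof. exact/pmonT/garside_pmon. Qed.
Hint Resolve garside_P garside_pmon P_gen : core.

Lemma garside_gen X s : s \in X -> ldvd (gen s) (D X).
Proof. by have [_ h _] := garsideP X; apply: h. Qed.

Lemma garside_min X e : P e -> (forall s, s \in X -> ldvd (gen s) e) -> ldvd (D X) e.
Proof. by have [_ _ h] := garsideP X; apply: h. Qed.

Lemma garside_uniq X d : P d -> (forall s, s \in X -> ldvd (gen s) d) ->
  (forall e, P e -> (forall s, s \in X -> ldvd (gen s) e) -> ldvd d e) -> d = D X.
Proof.
move=> Pd ds dmin; apply: ldvd_deg_eq => //; first exact: garside_min.
by apply: ldvd_deg => //; apply: dmin => // s; apply: garside_gen.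
Qed.

Lemma garsideS X Y : X \subset Y -> ldvd (D X) (D Y).
Proof. by move=> /fintype.subsetP XY; apply: garside_min => // s /XY/garside_gen. Qed.

Lemma garside_deg_gt0 X s : s \in X -> (0 < deg (D X))%N.
Proof. by move=> /garside_gen/(ldvd_deg (P_gen G s)); rewrite deg_gen. Qed.

(* For [t <> s] the lcm [s m] of [s] and [t] divides [s D]: the alternating
   word [m] of length [M s t - 1] from [t] is a prefix of the lcm, hence of [D]. *)
Lemma garside_dvd_genM X s : s \in X -> ldvd (D X) (gen s * D X).
Proof.
move=> sX; apply: garside_min; first exact: pmonM.
move=> t tX; case: (eqVneq s t) => [->|st]; first exact: ldvd_mulr.
have ts : t != s by rewrite eq_sym.
have m0 := cox_gt0 M s t; have m0' := cox_gt0 M t s.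
apply: (@ldvd_trans _ _ _ (pos (alt_seq t s (M t s)))).
  rewrite -(prednK m0') /= pos_cons; exact/ldvd_mulr/P_pos.
rewrite (cox_sym M t s) -pos_alt_sym // -(prednK m0) /= pos_cons ldvd_mul2l.
have /ldvd_trans : ldvd (pos (alt_seq t s (M s t).-1)) (pos (alt_seq t s (M t s))).
  rewrite (cox_sym M t s) -{2}(prednK m0) alt_seqSr -cats1 pos_cat.
  exact/ldvd_mulr/P_pos.
by apply; apply: ldvd_alt => //; apply: garside_gen.
Qed.

Lemma garside_conj X s : s \in X -> exists2 t, t \in X & gen s * D X = D X * gen t.
Proof.
move=> sX; have /ldvdP[c Pc e] := garside_dvd_genM sX.
have : deg (gen s * D X) = (deg c + deg (D X))%N by rewrite e degM // addnC.
rewrite degM // deg_gen => /addIn/esym/(deg_eq1 Pc)[t ct].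
exists t; rewrite -?ct //; have : pmon X (D X * c).
  by rewrite -e; apply: pmonM => //; apply/pmon_gen.
by move=> /(pmon_factor (garside_P X) Pc)[_]; rewrite ct => /pmon_gen.
Qed.

(** The permutation of the letters of [X] induced by conjugation by [D X]. For [s] in [X] such a [t]
    exists by [garside_conj]; the default makes the function total. *)
Definition tau X s : V := odflt s [pick t | (t \in X) && (gen s * D X == D X * gen t)].

Lemma tauP X s : s \in X -> tau X s \in X /\ gen s * D X = D X * gen (tau X s).
Proof.
move=> sX; rewrite /tau; case: pickP => [t /andP[tX /eqP]//|h].
have [t tX e] := garside_conj sX.
by have := h t; rewrite tX e eqxx.
Qed.

Lemma tau_in X s : s \in X -> tau X s \in X. Proof. by case/tauP. Qed.

Lemma tau_genM X s : s \in X -> gen s * D X = D X * gen (tau X s).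
Proof. by case/tauP. Qed.

Lemma tau_inj X : {in X &, injective (tau X)}.
Proof.
move=> s t sX tX e; apply/(@gen_inj _ _ G)/(@mulIg _ (D X)).
by rewrite !tau_genM // e.
Qed.

Lemma tau_im X : tau X @: X = X.
Proof.
apply/eqP; rewrite eqEcard card_in_imset ?leqnn ?andbT; last exact: tau_inj.
by apply/fintype.subsetP => t /imsetP[s sX ->]; apply: tau_in.
Qed.

Lemma garside_genr X t : t \in X -> exists2 d, P d & D X = d * gen t.
Proof.
rewrite -{1}(tau_im X) => /imsetP[s sX ->].
have /ldvdP[d Pd e] := garside_gen sX; exists d => //.
by apply/(@mulgI _ (gen s)); rewrite tau_genM // {1}e mulgA.
Qed.

(** Reversal of words is an anti-automorphism. It fixes [D X], which every letter of [X] divides on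
    the right as well, and it turns [s D = D t] into [t D = D s]. *)
Lemma tauK X : {in X, involutive (tau X)}.
Proof.
move=> s sX; have [t_in e] := tauP sX; set t := tau X s in t_in e *.
have [u _ Du] := garside_P X.
have revD : pos (rev u) = D X.
  apply: ldvd_deg_eq => //; last by rewrite -Du !deg_pos size_rev.
  apply: garside_min => [|r rX]; first exact: P_pos.
  have [d /PP[v ->] Dd] := garside_genr rX.
  have /(posP G)/mon_rev/(posP G) : pos u = pos (v ++ [:: r]).
    by rewrite pos_cat pos1 Du.
  by rewrite rev_cat pos_cat pos1 => ->; apply/ldvd_mulr/P_pos.
have /(posP G)/mon_rev/(posP G) : pos (s :: u) = pos (u ++ [:: t]).
  by rewrite pos_cons pos_cat pos1 Du.
rewrite rev_cons rev_cat -cats1 !pos_cat !pos1 revD => e2.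
by apply/(@gen_inj _ _ G)/(@mulgI _ (D X)); rewrite -tau_genM // e2.
Qed.

Lemma garside_genM X s : s \in X -> D X * gen s = gen (tau X s) * D X.
Proof. by move=> sX; rewrite tau_genM ?tau_in // tauK. Qed.

Definition centre X : G := D X * D X.

Lemma centreP X : P (centre X). Proof. exact: pmonM. Qed.
Lemma centre_pmon X : pmon X (centre X). Proof. exact: pmonM. Qed.

Lemma centre_comm X s : s \in X -> commute (centre X) (gen s).
Proof.
move=> sX; rewrite /commute /centre -mulgA garside_genM // mulgA.
by rewrite garside_genM ?tau_in // tauK // mulgA.
Qed.

(** * Standard parabolic subgroups *)

Definition par X : set G := smallest (@subgroup_set G) [set gen s | s in [set` X]]%classic.

Lemma par_subgroup X : subgroup_set (par X).
Proof.
split=> [H [[]//]|x y Hx Hy H HH|x Hx H HH].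
  have [[_ HM _] _] := HH; apply: HM; [exact: Hx|exact: Hy].
have [[_ _ HV] _] := HH; apply: HV; exact: Hx.
Qed.

Lemma par1 X : par X 1. Proof. by have [] := par_subgroup X. Qed.
Lemma parM X a b : par X a -> par X b -> par X (a * b).
Proof. by have [_ + _] := par_subgroup X; apply. Qed.
Lemma parV X a : par X a -> par X a^-1.
Proof. by have [_ _] := par_subgroup X; apply. Qed.
Lemma parX X a n : par X a -> par X (a ^+ n).
Proof. by move=> Xa; elim: n => [|n IH]; [apply: par1|rewrite expgS; apply: parM]. Qed.
Lemma par_gen X s : s \in X -> par X (gen s).
Proof. by move=> sX H [_ HX]; apply: HX; exists s. Qed.

Lemma par_min X (H : set G) : subgroup_set H -> (forall s, s \in X -> H (gen s)) ->
  forall a, par X a -> H a.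
Proof. by move=> HG HX a; apply; split=> // _ [s sX <-]; apply: HX. Qed.

Lemma parS X Y : X \subset Y -> forall a, par X a -> par Y a.
Proof.
move=> /fintype.subsetP XY; apply: par_min; first exact: par_subgroup.
by move=> s /XY; apply: par_gen.
Qed.

Lemma par_pmon X a : pmon X a -> par X a.
Proof.
move: a; apply: pmon_ind => [|s b sX Xb IH]; first exact: par1.
by apply: parM => //; apply: par_gen.
Qed.

Lemma centralizer_subgroup c : subgroup_set [set a | commute c a]%classic.
Proof.
split=> [|x y|x] /=; [exact: commute1|exact: commuteM|exact: commuteV].
Qed.

Lemma centre_par X a n : par X a -> commute (centre X ^+ n) a.
Proof.
move=> Xa; apply/commute_sym/commuteX/commute_sym; move: a Xa.
by apply: par_min; [exact: centralizer_subgroup | exact: centre_comm].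
Qed.

Lemma pmon_complete X a : pmon X a -> exists2 b, pmon X b & exists n, a * b = centre X ^+ n.
Proof.
move: a; apply: pmon_ind => [|s a sX Xa [b Xb [n ab]]].
  by exists 1; [apply: pmon1 | exists 0%N; rewrite mulg1].
have /ldvdP[d Pd e] := garside_gen sX.
have Xd : pmon X d.
  have : pmon X (gen s * d) by rewrite -e.
  by move=> /(pmon_factor (P_gen _ s) Pd)[].
exists (b * d * D X); first by do ?apply: pmonM.
exists n.+1; rewrite !mulgA -(mulgA (gen s)) ab.
have /centre_par/commute_sym h := par_gen sX.
by rewrite (h n) -[_ * gen s * d]mulgA -e -mulgA -expgSr.
Qed.

(** The elements with a positive central multiple form a subgroup. For inverses, a positive element
    is completed on the right to a central power, which is possible because every letter of [X]
    divides [D X]. *)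
Lemma par_posE X a : par X a -> exists n, pmon X (centre X ^+ n * a).
Proof.
pose H := [set b | par X b /\ exists n, pmon X (centre X ^+ n * b)]%classic.
suff h : forall b, par X b -> H b by move=> /h[].
apply: par_min.
- split=> [|x y [Xx [n nx]] [Xy [m my]]|x [Xx [n nx]]] /=.
  + by split; [exact: par1|exists 0%N; rewrite mulg1; apply: pmon1].
  + split; first exact: parM.
    exists (m + n)%N; rewrite expgnDr -mulgA (mulgA (_ ^+ n)).
    have := centre_par m Xx; rewrite /commute => h.
    have -> : centre X ^+ m * (centre X ^+ n * x * y) = centre X ^+ n * x * (centre X ^+ m * y).
      rewrite !mulgA -expgnDr addnC expgnDr -!mulgA; congr (_ * _).
      by rewrite !mulgA h.
    exact: pmonM.
  + split; first exact: parV.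
    have [b Xb [m e]] := pmon_complete nx; exists m.
    have -> : centre X ^+ m * x^-1 = centre X ^+ n * b; last by apply: pmonM => //; apply/pmonX/centre_pmon.
    have h := centre_par n Xx; have hb := centre_par m (parV Xx).
    by rewrite hb -e h -!mulgA mulKg.
- by move=> s sX /=; split; [exact: par_gen | exists 0%N; rewrite mul1g; apply/pmon_gen].
Qed.

Lemma par_P X a : par X a -> P a -> pmon X a.
Proof.
move=> /par_posE[n Xna] Pa.
by have [] := pmon_factor (pmonX n (centreP X)) Pa Xna.
Qed.

Lemma par_genE X s : par X (gen s) <-> s \in X.
Proof. by split=> [/par_P/(_ (P_gen _ s))/pmon_gen//|/par_gen]. Qed.

Lemma par_sub X Y : (forall a, par X a -> par Y a) -> X \subset Y.
Proof. by move=> h; apply/fintype.subsetP => s /par_genE/h/par_genE. Qed.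

Lemma par_inj X Y : par X = par Y -> X = Y.
Proof. by move=> e; apply/eqP; rewrite finset.eqEsubset; apply/andP; split; apply: par_sub => a; rewrite e. Qed.

End GarsideElements.

(** * Conjugators between standard parabolic subgroups *)

Section Normalizers.
Variables (V : finType) (M : coxeter_matrix V).
Hypothesis Mfin : finite_type M.
Variable G : artin_system M.
Local Open Scope group_scope.
Local Notation gen := (gen G).
Local Notation pos := (pos G).
Local Notation pmon := (@pmon V M G).
Local Notation P := (pmon (finset.setTfor V)).
Local Notation ldvd := (@ldvd V M G).
Local Notation D := (@garside V M G).
Local Notation par := (@par V M G).
Local Notation centre := (@centre V M G).
Implicit Types (s t u v : V) (X Y Z : {set V}) (a b c d e p q x y : G).

Let garside_P' X : P (D X). Proof. exact: garside_P. Qed.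
Let garside_pmon' X : pmon X (D X). Proof. exact: garside_pmon. Qed.
Let P_gen' s : P (gen s). Proof. exact: P_gen. Qed.
Hint Resolve garside_P' garside_pmon' P_gen' : core.

Definition head_free Z a := forall s, s \in Z -> ~ ldvd (gen s) a.

Lemma head_exists Z a : P a ->
  exists b c, [/\ pmon Z b, P c, head_free Z c & a = b * c].
Proof.
have [n] := ubnP (deg a); elim: n a => // n IH a an Pa.
have [h|] := pselect (head_free Z a).
  by exists 1, a; split; rewrite ?mul1g //; apply: pmon1.
move=> /existsNP[s /not_implyP[sZ /contrapT /ldvdP[a' Pa' e]]].
have [|b [c [Zb Pc hc e']]] := IH a' _ Pa'.
  by move: an; rewrite e degM // deg_gen.
exists (gen s * b), c; split=> //; last by rewrite e e' mulgA.
by apply: pmonM => //; apply/pmon_gen.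
Qed.

Lemma head_max Z a p d : P a -> head_free Z a -> pmon Z p -> pmon Z d ->
  ldvd d (p * a) -> ldvd d p.
Proof.
move=> Pa ha Zp Zd dpa.
have [|m [Pm dm pm mmin mX]] := lcm2_exists Mfin (pmonT Zd) (pmonT Zp) (pmonM (pmonT Zp) Pa) dpa.
  exact: ldvd_mulr.
have : ldvd m (p * a) by apply: mmin => //; [apply: pmonM => //; apply: pmonT Zp | apply: ldvd_mulr].
have /ldvdP[h Ph mh] := pm; rewrite mh ldvd_mul2l => hd.
have [_ Zh] : pmon Z p /\ pmon Z h.
  by apply: pmon_factor; rewrite -?mh //; [apply: pmonT Zp | apply: mX].
case: (pmon_case Zh) => [h1|[s [h' [sZ Zh' e]]]]; first by rewrite mh h1 mulg1 in dm.
case: (ha s sZ); apply: ldvd_trans hd; rewrite e.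
exact/ldvd_mulr/pmonT/Zh'.
Qed.

(* [a] conjugates the generators of [Y] to generators of [Z], because
   [p * a * gen s = q * a] with [p], [q] in the monoid of [Z] forces [p] to divide [q]. *)
Lemma conj_par_gen Y Z a : P a -> head_free Z a ->
  (forall x, par Y x -> par Z (a * x * a^-1)) ->
  forall s, s \in Y -> exists2 t, t \in Z & a * gen s = gen t * a.
Proof.
move=> Pa ha aYZ s sY; have [n Zq] := par_posE Mfin (aYZ _ (par_gen sY)).
set q := centre Z ^+ n * _ in Zq; set p := centre Z ^+ n in q Zq.
have Zp : pmon Z p by apply/pmonX/centre_pmon.
have e : q * a = p * (a * gen s) by rewrite /q -mulgA mulgVK.
have pq : ldvd p q.
  by apply: (head_max Pa ha) => //; rewrite e; apply/ldvd_mulr/pmonM.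
have /ldvdP[r Pr qr] := pq.
have Zr : pmon Z r.
  by have [] := pmon_factor (pmonT Zp) Pr (eq_ind _ (pmon Z) Zq _ qr).
have e2 : a * gen s = r * a by apply: (@mulgI _ p); rewrite -e qr mulgA.
have : deg (a * gen s) = deg (r * a) by rewrite e2.
rewrite !degM // deg_gen addnC => /addIn/esym/(deg_eq1 Pr)[t rt].
by exists t; rewrite -?rt //; apply/(pmon_gen G); rewrite -rt.
Qed.

Definition conj_par a Y Z := (forall x, par Y x -> par Z (a * x * a^-1)) /\
  (forall x, par Z x -> par Y (a^-1 * x * a)).

Lemma conj_subgroup (H : set G) c : subgroup_set H ->
  subgroup_set [set x | H (c * x * c^-1)]%classic.
Proof.
move=> [H1 HM HV]; split=> [|x y Hx Hy|x Hx] /=.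
- by rewrite mulg1 mulgV.
- by have := HM _ _ Hx Hy; rewrite !mulgA mulgVK.
- by have := HV _ Hx; rewrite !invgM invgK mulgA.
Qed.

(** Let [T] collect the letters to which [a] conjugates letters of [Y]. Then [a] carries A_Y into
    A_T, so every letter of [Z] lies in A_T, and a letter in A_T belongs to [T]. *)
Lemma conj_par_genV Y Z a : P a -> head_free Z a -> conj_par a Y Z ->
  forall t, t \in Z -> exists2 s, s \in Y & gen t * a = a * gen s.
Proof.
move=> Pa ha [aYZ aZY] t tZ.
pose T := [set r | `[< exists2 s, s \in Y & gen r * a = a * gen s >]]%SET.
suff /(par_genE Mfin) : par T (gen t) by rewrite finset.inE => /asboolP.
have := aZY _ (par_gen tZ).
pose H := [set x | par T (a * x * a^-1)]%classic.
have /[apply] : forall x, par Y x -> H x.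
  apply: par_min; first exact/conj_subgroup/par_subgroup.
  move=> s sY; have [r rZ e] := conj_par_gen Pa ha aYZ sY.
  rewrite /H /= e mulgK; apply: par_gen; rewrite finset.inE; apply/asboolP.
  by exists s.
by rewrite /H /= !mulgA mulgV mul1g mulgK.
Qed.

Definition ribbon Z a := forall t, t \in Z -> exists s, gen t * a = a * gen s.

Lemma ribbon_pmon Z a p : ribbon Z a -> pmon Z p -> exists2 q, P q & p * a = a * q.
Proof.
move=> ra; move: p; apply: pmon_ind => [|s b sZ Zb [q Pq e]].
  by exists 1; [apply: pmon1 | rewrite mul1g mulg1].
have [t et] := ra s sZ.
exists (gen t * q); first by apply: pmonM.
by rewrite -mulgA e mulgA et mulgA.
Qed.

(** A nontrivial [a] can only begin with [v]. The ribbon [d] that splits off conjugates the letters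
    of [X] other than [tau X v] to letters of [Z], so the quotient satisfies the hypotheses with
    [tau X v] in place of [v]: this is why [v] varies in the induction. *)
Lemma ribbon_setD1 X v a (Z := X :\ v) : v \in X -> pmon X a -> head_free Z a ->
  ribbon Z a -> exists b k, par Z b /\ a = b * D X ^+ k.
Proof.
rewrite {}/Z; have [n] := ubnP (deg a).
elim: n v a => // n IH v a an vX Xa ha ra; set Z := X :\ v in ha ra *.
have ZX : Z \subset X by apply: finset.subD1set.
have inZ r : (r \in Z) = (r != v) && (r \in X) by rewrite finset.in_setD1.
case: (pmon_case Xa) => [->|[r [a1 [rX Xa1 e]]]].
  by exists 1, 0%N; split; [apply: par1 | rewrite mulg1].
have Pa : P a := pmonT Xa.
have va : ldvd (gen v) a.
  case: (eqVneq r v) => [<-|rv]; first by rewrite e; apply/ldvd_mulr/pmonT/Xa1.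
  by case: (ha r); [rewrite inZ rv | rewrite e; apply/ldvd_mulr/pmonT/Xa1].
have [q Pq DZa] := ribbon_pmon ra (garside_pmon Mfin G Z).
have /ldvdP[d Pd dE] := garsideS Mfin G ZX.
have : ldvd (D X) (D Z * a).
  apply: garside_min => // [|t tX]; first by apply: pmonM.
  case: (eqVneq t v) => [->|tv].
    by rewrite DZa; apply: ldvd_trans va _; apply: ldvd_mulr.
  have tZ : t \in Z by rewrite inZ tv.
  by apply: ldvd_trans (garside_gen Mfin G tZ) _; apply: ldvd_mulr.
rewrite {1}dE ldvd_mul2l => /ldvdP[c Pc ae].
(* [v] divides [D X] but does not occur in [D Z], so [d] is not trivial and the degree drops. *)
have d_gt0 : (0 < deg d)%N.
  rewrite lt0n; apply/negP => /eqP/(deg_eq0 Pd) d1.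
  have : pmon Z (gen v).
    apply: ldvd_pmon (garside_gen Mfin G vX) _ => //.
    by rewrite dE d1 mulg1.
  by move=> /pmon_gen; rewrite inZ eqxx.
have dconj u : u \in X :\ tau G X v ->
    exists2 t, t \in Z & d * gen u = gen t * d.
  rewrite finset.in_setD1 => /andP[uv uX].
  have tX := tau_in Mfin G uX; set t' := tau G X u in tX.
  have t'Z : t' \in Z.
    by rewrite inZ tX andbT; apply: contra uv => /eqP <-; rewrite tauK.
  exists (tau G Z t'); first exact: tau_in.
  have dE' : d = (D Z)^-1 * D X by rewrite dE mulKg.
  rewrite dE' -mulgA garside_genM // -/t' !mulgA; congr (_ * _).
  by apply: (@mulgI _ (D Z)); apply: (@mulIg _ (D Z)); rewrite !mulgA mulgV mul1g mulgVK -tau_genM // mulgV mul1g.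
have Xc : pmon X c by have [] := pmon_factor Pd Pc (eq_ind _ (pmon X) Xa _ ae).
have [|||b [k [Zb ck]]] := IH (tau G X v) c _ (tau_in Mfin G vX) Xc.
- by move: an; rewrite ae degM //; lia.
- move=> u /dconj[t tZ et] /ldvdP[c' Pc' e']; case: (ha t tZ).
  by rewrite ae e' mulgA et -mulgA; apply/ldvd_mulr/pmonM.
- move=> u /dconj[t tZ et]; have [s es] := ra t tZ; exists s.
  by apply: (@mulgI _ d); rewrite mulgA et -mulgA -ae es ae mulgA.
(* From [a = d c = D_Z^-1 D_X b D_X^k]; conjugation by [D X] carries the parabolic without [tau X v]
   back to the one without [v]. *)
exists ((D Z)^-1 * (D X * b * (D X)^-1)), k.+1; split; last first.
  by rewrite ae ck expgS !mulgA mulgVK dE mulKg.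
apply: parM; first by apply: parV; apply: par_pmon.
pose H := [set x | par Z (D X * x * (D X)^-1)]%classic.
apply: (par_min (H := H)) Zb; first exact/conj_subgroup/par_subgroup.
move=> u; rewrite finset.in_setD1 => /andP[uv uX].
rewrite /H /= garside_genM // mulgK; apply: par_gen.
by rewrite inZ tau_in // andbT; apply: contra uv => /eqP <-; rewrite tauK.
Qed.

Lemma zexpgB (x : G) k m : exists n, x ^+ k * (x ^+ m)^-1 = zexpg x n.
Proof.
case: (leqP m k) => [mk|km].
  by exists (Posz (k - m)%N); rewrite /= -{1}(subnK mk) expgnDr mulgK.
exists (Negz (m - k).-1); rewrite /= prednK ?subn_gt0 // -{1}(subnK (ltnW km)).
by rewrite expgnDr invgM mulgA mulgV mul1g.
Qed.

Theorem normalizer_setD1 X v Y a (Z := X :\ v) : v \in X -> par X a -> Y \subset X ->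
  conj_par a Y Z -> exists b n, par Z b /\ a = b * zexpg (D X) n.
Proof.
move=> vX Xa YX [aYZ aZY].
have ZX : Z \subset X by apply: finset.subD1set.
have [m Xp] := par_posE Mfin Xa; set z := centre X ^+ m in Xp; set p := z * a in Xp.
have zc x : par X x -> z * x = x * z by move=> /(centre_par Mfin m).
have pE x : par Z (a * x * a^-1) -> p * x * p^-1 = a * x * a^-1.
  move=> /(parS ZX)/zc h; rewrite /p invgM !mulgA.
  by move: h; rewrite !mulgA => ->; rewrite mulgK.
have pVE x : par Z x -> p^-1 * x * p = a^-1 * x * a.
  move=> /(parS ZX)/zc h; rewrite /p invgM !mulgA -[_ * z^-1 * x]mulgA.
  by rewrite -[_ * (_ * x) * z]mulgA -[_^-1 * x * z]mulgA -h mulKg.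
have [b [c [Zb Pc hc pbc]]] := head_exists Z (pmonT Xp).
have bZ := par_pmon Zb.
have cE : c = b^-1 * p by rewrite pbc mulKg.
have Xc : pmon X c.
  by have [] := pmon_factor (pmonT Zb) Pc (eq_ind _ (pmon X) Xp _ pbc).
have cYZ : conj_par c Y Z.
  split=> x hx.
    have -> : c * x * c^-1 = b^-1 * (p * x * p^-1) * b by rewrite cE invgM invgK !mulgA.
    by rewrite pE; [exact: parM (parM (parV bZ) (aYZ _ hx)) bZ | exact: aYZ].
  have -> : c^-1 * x * c = p^-1 * (b * x * b^-1) * p by rewrite cE invgM invgK !mulgA.
  have h : par Z (b * x * b^-1) := parM (parM bZ hx) (parV bZ).
  by rewrite pVE //; apply: aZY.
have rc : ribbon Z c by move=> t /(conj_par_genV Pc hc cYZ)[s _ e]; exists s.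
have [b' [k [Zb' ck]]] := ribbon_setD1 vX Xc hc rc.
have [n en] := zexpgB (D X) k (2 * m).
exists (b * b'), n; split; first exact: parM bZ Zb'.
(* The multiplier that made [a] positive is an even power of [D X], so removing it only changes the
   exponent. *)
have z2 : z = D X ^+ (2 * m) by rewrite expgnA.
have zV x : par X x -> z^-1 * x = x * z^-1.
  by move=> /zc h; apply: (@mulgI _ z); rewrite mulVKg mulgA h mulgK.
have Xbc := parM (parS ZX bZ) (parM (parS ZX Zb') (parX k (par_pmon (garside_pmon' X)))).
by rewrite -en -z2 -[a](mulKg z) -/p pbc ck zV // !mulgA.
Qed.

End Normalizers.

(** * Centres of parabolics and commuting Garside elements *)

Section Centres.
Variables (V : finType) (M : coxeter_matrix V).
Hypothesis Mfin : finite_type M.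
Variable G : artin_system M.
Local Open Scope group_scope.
Local Notation gen := (gen G).
Local Notation pos := (pos G).
Local Notation pmon := (@pmon V M G).
Local Notation P := (pmon (finset.setTfor V)).
Local Notation ldvd := (@ldvd V M G).
Local Notation D := (@garside V M G).
Local Notation par := (@par V M G).
Local Notation centre := (@centre V M G).
Implicit Types (s t u v w : V) (X Y Z : {set V}) (a b c d e p q x y : G).

Let garside_P' X : P (D X). Proof. exact: garside_P. Qed.
Let garside_pmon' X : pmon X (D X). Proof. exact: garside_pmon. Qed.
Let P_gen' s : P (gen s). Proof. exact: P_gen. Qed.
Let P_pos' r : P (pos r). Proof. exact: P_pos. Qed.
Hint Resolve garside_P' garside_pmon' P_gen' P_pos' : core.

Lemma adjacent_sym s t : adjacent M s t = adjacent M t s.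
Proof. by rewrite /adjacent /= eq_sym cox_sym. Qed.

Lemma connected_ind X (Q : V -> Prop) s : connected_on M X -> s \in X -> Q s ->
  (forall v w, v \in X -> w \in X -> adjacent M v w -> Q v -> Q w) ->
  forall t, t \in X -> Q t.
Proof.
move=> [_ cX] sX Qs step t tX; have /connectP[p pp ->] := cX s t sX tX.
elim: p s sX Qs pp => //= r p IH s sX Qs /andP[/and3P[_ rX sr] pp].
by apply: IH => //; apply: step sr Qs.
Qed.

Lemma ldvd_gen_mul_alt s t a : s != t -> P a -> ldvd (gen t) (gen s * a) ->
  ldvd (pos (alt_seq t s (M s t).-1)) a.
Proof.
move=> st Pa ta; rewrite -(ldvd_mul2l (gen s)) -pos_cons.
have -> : s :: alt_seq t s (M s t).-1 = alt_seq s t (M s t).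
  by rewrite -{2}(prednK (cox_gt0 M s t)).
by apply: ldvd_alt => //; apply: ldvd_mulr.
Qed.

Lemma ldvd_gen_mul s t a : s != t -> P a -> ldvd (gen t) (gen s * a) -> ldvd (gen t) a.
Proof.
move=> st Pa /(ldvd_gen_mul_alt st Pa); apply: ldvd_trans.
have m2 := cox_ge2 M st.
have -> : (M s t).-1 = (M s t).-2.+1 by lia.
by rewrite /= pos_cons; apply: ldvd_mulr.
Qed.

(** Both [s] and [t] divide [t a = a t']; as the label is at least 3, the word [s t] divides [a],
    hence [t] divides [b]. Finally [a = b s']. *)
Lemma quasicentral_adjacent s t t' a b : adjacent M s t -> P b ->
  a = gen s * b -> gen t * a = a * gen t' ->
  (exists s', gen s * a = a * gen s') -> ldvd (gen t) a.
Proof.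
move=> /andP[st m3] Pb ab ta [s' sa].
have ts : t != s by rewrite eq_sym.
have Pa : P a by rewrite ab; apply: pmonM.
have bs : a = b * gen s' by apply: (@mulgI _ (gen s)); rewrite sa {1}ab mulgA.
have : ldvd (gen s) (gen t * a) by rewrite ta ab -mulgA; apply/ldvd_mulr/pmonM.
move=> /(ldvd_gen_mul_alt ts Pa); rewrite (cox_sym M t s).
have -> : (M s t).-1 = (M s t - 3).+2 by lia.
rewrite ab /= pos_cons ldvd_mul2l pos_cons => h.
have tb : ldvd (gen t) b by apply: ldvd_trans h; apply: ldvd_mulr.
by rewrite -ab bs; apply: ldvd_trans tb _; apply: ldvd_mulr.
Qed.

(** Divisibility by one letter spreads along the edges of [X] to all of its letters, so a nontrivial
    [c] is divisible by [D X], and the quotient is again quasicentral. *)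
Lemma quasicentral_power X c : connected_on M X -> pmon X c -> ribbon X c ->
  exists k, c = D X ^+ k.
Proof.
move=> cX; have [n] := ubnP (deg c); elim: n c => // n IH c cn Xc rc.
case: (pmon_case Xc) => [->|[s [b [sX Xb e]]]]; first by exists 0%N.
have Pc := pmonT Xc; have Pb := pmonT Xb.
have all_dvd t : t \in X -> ldvd (gen t) c.
  apply: (connected_ind (s := s) (Q := fun t => ldvd (gen t) c)) => //.
    by rewrite e; apply: ldvd_mulr.
  move=> v w vX wX vw /ldvdP[b' Pb' e'].
  have [w' ew] := rc w wX.
  exact: quasicentral_adjacent vw Pb' e' ew (rc v vX).
have /ldvdP[c' Pc' ce] : ldvd (D X) c by apply: garside_min.
have Xc' : pmon X c' by have [] := pmon_factor (garside_P' X) Pc' (eq_ind _ (pmon X) Xc _ ce).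
have [||k ck] := IH c' _ Xc'.
- by move: cn; rewrite ce degM //; have := garside_deg_gt0 Mfin G sX; lia.
- move=> u uX; have tX := tau_in Mfin G uX.
  have [s' es] := rc _ tX; exists s'; apply: (@mulgI _ (D X)).
  by rewrite mulgA garside_genM // -mulgA -ce es ce mulgA.
by exists k.+1; rewrite expgS -ck.
Qed.

Theorem centre_power X c : connected_on M X -> par X c ->
  (forall s, s \in X -> commute c (gen s)) -> exists n, c = zexpg (D X) n.
Proof.
move=> cX Xc cc; have [m Xp] := par_posE Mfin Xc.
have [|k ek] := quasicentral_power cX Xp.
  move=> s sX; exists s; rewrite mulgA (_ : gen s * _ = centre X ^+ m * gen s).
    by rewrite -!mulgA cc.
  exact: esym (centre_par Mfin m (par_gen sX)).
have [n en] := zexpgB (D X) k (2 * m); exists n; rewrite -en -ek.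
have -> : D X ^+ (2 * m) = centre X ^+ m by rewrite expgnA.
by rewrite (centre_par Mfin m Xc) mulgK.
Qed.

(** The first letter [u] divides [s u r], so the alternating word from [u] with [M s u - 1] letters
    divides [u r]. With a label of at least 3 that word contains [s], which does not occur; so [u]
    commutes with [s] and can be cancelled. *)
Lemma comm_letters (r : seq V) s : s \notin r -> gen s * pos r = pos r * gen s ->
  forall t, t \in r -> ~~ adjacent M s t.
Proof.
elim: r => // u r IH; rewrite inE negb_or => /andP[su sr] e.
rewrite !pos_cons in e.
have us : u != s by rewrite eq_sym.
have Pr := P_pos' r.
have h : ldvd (pos (alt_seq u s (M s u).-1)) (gen u * pos r).
  apply: ldvd_gen_mul_alt; rewrite ?pos_cons //; first exact: pmonM.
  by rewrite e -mulgA; apply/ldvd_mulr/pmonM.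
have m2 : M s u = 2.
  have := cox_ge2 M su; case: (ltngtP (M s u) 2) => // m3 _.
  move: h; have -> : (M s u).-1 = (M s u - 3).+2 by lia.
  rewrite /= -pos_cons => /ldvdP[c /PP[w ->]]; rewrite -pos_cat => /pos_mem/(_ s).
  by rewrite !inE eqxx orbT (negbTE su) (negbTE sr).
have comm : gen s * gen u = gen u * gen s.
  by have := pos_alt_sym G su; rewrite m2 /= !pos_cons pos_nil !mulg1.
have e2 : gen s * pos r = pos r * gen s.
  by apply: (@mulgI _ (gen u)); rewrite mulgA -comm -mulgA e -mulgA.
move=> t; rewrite inE => /orP[/eqP->|/IH -> //].
by rewrite /adjacent /= su m2.
Qed.

Lemma comm_gen_adjacent s t : gen s * gen t = gen t * gen s -> ~~ adjacent M s t.
Proof.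
case: (eqVneq s t) => [->|st] e; first by rewrite /adjacent /= eqxx.
by apply: (@comm_letters [:: t]); rewrite ?inE ?pos1.
Qed.

Lemma nonadjacent_comm s t : ~~ adjacent M s t -> commute (gen s) (gen t).
Proof.
case: (eqVneq s t) => [->|st] //; rewrite /adjacent /= st /= -ltnNge => m3.
have m2 : M s t = 2 by have := cox_ge2 M st; lia.
by have := pos_alt_sym G st; rewrite m2 /= !pos_cons pos_nil !mulg1.
Qed.

(** * Commuting Garside elements *)

Section Ribbon.
Variables (X : {set V}) (v : V).
Hypothesis vX : v \notin X.

Definition rib : G := locked ((D X)^-1 * D (v |: X)).

Lemma ribE : D (v |: X) = D X * rib.
Proof. by rewrite /rib -lock mulVKg. Qed.

Lemma rib_P : P rib.
Proof. by rewrite /rib -lock; have := garsideS Mfin G (finset.subsetUr [set v]%SET X). Qed.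
Hint Resolve rib_P : core.

Lemma rib_min e : P e -> ldvd (gen v) (D X * e) -> ldvd rib e.
Proof.
move=> Pe ve; rewrite -(ldvd_mul2l (D X)) -ribE; apply: (garside_min Mfin); first exact: pmonM.
move=> s; rewrite finset.in_setU1 => /orP[/eqP -> //|sX].
by apply: ldvd_trans (garside_gen Mfin G sX) _; apply: ldvd_mulr.
Qed.

(** If [rib = s d], then [v] divides [D_X s d = tau(s) D_X d]. Since [tau(s)] differs from [v],
    already [D_X d] is divisible by [v], so [rib] divides the shorter [d]. *)
Lemma rib_head_free : head_free X rib.
Proof.
move=> s sX /ldvdP[d Pd e].
have tX := tau_in Mfin G sX.
have : ldvd (gen v) (gen (tau G X s) * (D X * d)).
  rewrite mulgA -garside_genM // -mulgA -e -ribE.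
  by apply: garside_gen => //; rewrite finset.in_setU1 eqxx.
have tv : tau G X s != v by apply: contra vX => /eqP <-.
move=> /(ldvd_gen_mul tv (pmonM (garside_P' X) Pd))/(rib_min Pd).
by move=> /(ldvd_deg rib_P); rewrite e degM // deg_gen; lia.
Qed.

Lemma rib_conj s : s \in X -> exists2 t, t \in v |: X & gen s * rib = rib * gen t.
Proof.
move=> sX; have tX := tau_in Mfin G sX.
have tvX : tau G X s \in v |: X by rewrite finset.in_setU1 tX orbT.
exists (tau G (v |: X) (tau G X s)); first exact: tau_in.
apply: (@mulgI _ (D X)); rewrite !mulgA garside_genM // -[LHS]mulgA -!ribE.
exact: tau_genM.
Qed.

(** For [s] in [X] the element [s rib = rib t] is the lcm of [s] and [rib]: it is one degree above
    [rib], which [s] does not divide. So the letters of [p] can be cancelled one by one. *)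
Lemma rib_dvd p q : pmon X p -> P q -> ldvd rib (p * q) -> ldvd rib q.
Proof.
move=> Xp Pq; move: p Xp; apply: pmon_ind => [|s b sX Xb IH]; first by rewrite mul1g.
have Pbq : P (b * q) by apply: pmonM => //; apply: pmonT Xb.
rewrite -mulgA => h; apply: IH.
have [t _ et] := rib_conj sX.
have [|m [Pm sm rm mmin _]] := lcm2_exists Mfin (P_gen' s) rib_P (pmonM (P_gen' s) Pbq) _ h.
  exact: ldvd_mulr.
have msr : ldvd m (gen s * rib).
  by apply: mmin; rewrite ?et; [apply: pmonM|rewrite -et; apply: ldvd_mulr|apply: ldvd_mulr].
have /ldvdP[e Pe me] := rm.
have e0 : deg e != 0.
  apply/negP => /eqP/(deg_eq0 Pe) e1; apply: (rib_head_free sX).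
  by move: sm; rewrite me e1 mulg1.
have : gen s * rib = m.
  apply: ldvd_deg_eq => //.
  by rewrite me !degM // deg_gen; lia.
move=> msr'; rewrite -(ldvd_mul2l (gen s)) msr'; apply: mmin => //.
  exact: pmonM.
exact: ldvd_mulr.
Qed.

Lemma rib_dvd_gen : ldvd (gen v) rib.
Proof.
have rX : pmon (v |: X) rib.
  by have [] := pmon_factor (garside_P' X) rib_P (eq_ind _ (pmon (v |: X)) (garside_pmon' _) _ ribE).
case: (pmon_case rX) => [e|[s [b [sX Xb e]]]].
  have : ldvd (gen v) (D X) by rewrite -[D X]mulg1 -e -ribE; apply: garside_gen; rewrite // finset.in_setU1 eqxx.
  move=> /(ldvd_pmon (P_gen' v))/(_ (garside_pmon' X))/pmon_gen.
  by rewrite (negbTE vX).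
move: sX; rewrite finset.in_setU1 => /orP[/eqP <-|sX].
  by rewrite e; apply/ldvd_mulr/pmonT/Xb.
by case: (rib_head_free sX); rewrite e; apply/ldvd_mulr/pmonT/Xb.
Qed.

(** [v] occurs in [rib]. A letter [t] of [X] adjacent to an occurring letter occurs too: otherwise
    [t rib = rib t'] forces [t' = t], against [comm_letters]. Connectedness then reaches all of
    [X]. *)
Lemma rib_support Y s : connected_on M X -> s \in X -> adjacent M v s ->
  pmon Y rib -> X \subset Y.
Proof.
move=> cX sX vs [r rY er].
have vr : v \in r.
  have /ldvdP[d /PP[w ->]] := rib_dvd_gen; rewrite -er -pos_cons => /pos_mem ->.
  by rewrite inE eqxx.
have step t w : t \in X -> w \in r -> adjacent M t w -> t \in r.
  move=> tX wr tw; apply/negPn/negP => tr; have [t' _ et] := rib_conj tX.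
  have e : pos (t :: r) = pos (r ++ [:: t']) by rewrite pos_cat pos_cons pos1 er.
  have tt' : t = t'.
    have := pos_mem e t; rewrite inE eqxx mem_cat (negbTE tr) inE /=.
    by move=> /esym/eqP.
  by have := comm_letters tr _ wr; rewrite tw er {2}tt' => /(_ et).
apply/fintype.subsetP => t tX; apply: (allP rY).
apply: (connected_ind (s := s) (Q := fun t => t \in r)) cX _ _ _ t tX => //.
  by apply: step vr _ => //; rewrite adjacent_sym.
by move=> w w' wX w'X ww' wr; apply: step wr _ => //; rewrite adjacent_sym.
Qed.

End Ribbon.

Definition orth X Y := forall s t, s \in X -> t \in Y -> s != t /\ ~~ adjacent M s t.

(** A first letter [v] of [c] divides [c z = z c], with [z] the central power. The positive exponent
    frees a factor [D X], so [rib X v] divides [c]. If [v] had a neighbour in [X], the letters of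
    [rib X v] would cover [X] and lie in [Y]; hence [v] commutes with A_X and is stripped off. *)
Lemma centralizer_letters X Y k c : connected_on M X -> ~~ (X \subset Y) ->
  pmon Y c -> head_free X c -> commute (centre X ^+ k.+1) c ->
  pmon [set w | (w \notin X) && [forall s in X, ~~ adjacent M w s]]%SET c.
Proof.
move=> cX XY; have [n] := ubnP (deg c); elim: n c => // n IH c cn Yc hc zc.
case: (pmon_case Yc) => [->|[v [b [vY Yb e]]]]; first exact: pmon1.
have Pb := pmonT Yb.
have vc : ldvd (gen v) c by rewrite e; apply: ldvd_mulr.
have vX : v \notin X by apply/negP => /hc.
have Pc := pmonT Yc.
have Xz : pmon X (centre X ^+ k.+1) by apply/pmonX/centre_pmon.
have : ldvd (rib X v) c.
  have zE : centre X ^+ k.+1 = D X * (D X * centre X ^+ k) by rewrite expgS mulgA.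
  have XDz : pmon X (D X * centre X ^+ k) by apply: pmonM => //; apply/pmonX/centre_pmon.
  apply: (rib_dvd vX XDz) => //; apply: rib_min.
    by apply: pmonM => //; apply: pmonT XDz.
  rewrite mulgA -zE zc; apply: ldvd_trans vc _.
  exact/ldvd_mulr/pmonT/Xz.
move=> rc; have Yr := ldvd_pmon (rib_P X v) rc Yc.
have nadj s : s \in X -> ~~ adjacent M v s.
  by move=> sX; apply/negP => vs; move: XY; rewrite (rib_support vX cX sX vs Yr).
have vcomm : commute (centre X ^+ k.+1) (gen v).
  move: (centre X ^+ k.+1) (par_pmon Xz); apply: par_min; first last.
    by move=> s sX /=; apply/commute_sym/nonadjacent_comm/nadj.
  have [h1 hM hV] := centralizer_subgroup (gen v).
  split=> [|x y hx hy|x hx]; apply: commute_sym; first exact: h1.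
    by apply: hM; apply: commute_sym.
  by apply: hV; apply: commute_sym.
rewrite e; apply: pmonM.
  apply/(pmon_gen G); rewrite finset.inE vX /=; apply/forallP => s; apply/implyP; exact: nadj.
apply: IH => //; first by move: cn; rewrite e degM // deg_gen.
  move=> s sX /ldvdP[b' Pb' eb]; apply: (hc s sX); rewrite e eb mulgA.
  by rewrite nonadjacent_comm ?nadj // -mulgA; apply/ldvd_mulr/pmonM.
apply: (@mulgI _ (gen v)); rewrite [RHS]mulgA -e -zc e !mulgA.
by rewrite vcomm.
Qed.

Theorem garside_commute_nested X Y k l : connected_on M X -> connected_on M Y ->
  commute (centre X ^+ k.+1) (centre Y ^+ l.+1) -> [\/ X \subset Y, Y \subset X | orth X Y].
Proof.
move=> cX cY com; case: (boolP (X \subset Y)) => [XY|nXY]; first by constructor 1.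
set b := centre Y ^+ l.+1 in com *.
have Yb : pmon Y b by apply/pmonX/centre_pmon.
have [b0 [b1 [Xb0 Pb1 hb1 be]]] := head_exists X (pmonT Yb).
have [Yb0 Yb1] := pmon_factor (pmonT Xb0) Pb1 (eq_ind _ (pmon Y) Yb _ be).
have z0 := centre_par Mfin k.+1 (par_pmon Xb0).
have z1 : commute (centre X ^+ k.+1) b1.
  apply: (@mulgI _ b0); rewrite mulgA -z0 -mulgA -be com be -mulgA.
  by rewrite mulgA.
have := centralizer_letters cX nXY Yb1 hb1 z1; set O := [set w | _]%SET => Ob1.
(* Every letter of [Y] divides [b = b0 b1], so it lies in [X] or in [O]. No edge joins the two, so a
   connected [Y] that meets [X] is contained in it. *)
have YXO t : t \in Y -> t \in X :|: O.
  move=> tY; apply/(pmon_gen G); apply: (@ldvd_pmon _ _ _ _ _ b) => //.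
    apply: ldvd_trans (garside_gen Mfin G tY) _; rewrite /b expgS /centre -!mulgA.
    by apply/ldvd_mulr/pmonM => //; apply/pmonX/pmonM.
  rewrite be; apply: pmonM.
    by apply: pmonS Xb0; apply: finset.subsetUl.
  by apply: pmonS Ob1; apply: finset.subsetUr.
have Oadj w s : w \in O -> s \in X -> w \notin X /\ ~~ adjacent M w s.
  by rewrite finset.inE => /andP[wX /forallP/(_ s)/implyP h] sX; split=> //; apply: h.
have [[s sY sX]|h] := pselect (exists2 s, s \in Y & s \in X).
  constructor 2; apply/fintype.subsetP.
  apply: (connected_ind (s := s) (Q := fun t => t \in X)) cY _ _ _ => //.
  move=> v w vY wY vw vX; have := YXO w wY; rewrite finset.in_setU => /orP[//|wO].
  by have [_] := Oadj w v wO vX; rewrite adjacent_sym vw.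
constructor 3 => s t sX tY.
have : t \in O.
  by have := YXO t tY; rewrite finset.in_setU => /orP[tX|//]; case: h; exists t.
move=> /Oadj/(_ sX)[tX ts]; split; last by rewrite adjacent_sym.
by apply: contraNneq tX => <-.
Qed.

End Centres.

(** * Maximal nested families of connected vertex sets *)

Section Families.
Variables (V : finType) (M : coxeter_matrix V).
Implicit Types (s t u v w : V) (X Y Z K L Q : {set V}) (F : {set {set V}}).

Definition compat X Y := [\/ X \subset Y, Y \subset X | orth M X Y].

Lemma compat_sym X Y : compat X Y -> compat Y X.
Proof.
case=> [h|h|h]; [by constructor 2|by constructor 1|constructor 3 => s t sY tX].
by have [st] := h t s tX sY; rewrite eq_sym adjacent_sym.
Qed.

(** [X] need not be connected, and is a member exactly when it is; in this form the notion passes to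
    [X - v] and to the parts of a splitting. *)
Definition max_nested X F := [/\ forall Y, Y \in F -> connected_on M Y /\ Y \subset X,
  forall Y Z, Y \in F -> Z \in F -> compat Y Z &
  forall Q, connected_on M Q -> Q \subset X ->
    (forall Y, Y \in F -> compat Q Y) -> Q \in F].

Lemma max_nested_top X F : connected_on M X -> max_nested X F -> X \in F.
Proof.
move=> cX [FX _ Fmax]; apply: Fmax => // Y /FX[_ YX]; by constructor 2.
Qed.

Definition component X w : {set V} :=
  [set t | connect [rel a b | [&& a \in X, b \in X & adjacent M a b]] w t].

Lemma component_sub X w : w \in X -> component X w \subset X.
Proof.
move=> wX; apply/fintype.subsetP => t; rewrite finset.inE => /connectP[p pp ->].
elim: p w wX pp => //= r p IH w wX /andP[/and3P[_ rX _]]; exact: IH.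
Qed.

Lemma component_adj X w s t : s \in component X w -> s \in X -> t \in X ->
  adjacent M s t -> t \in component X w.
Proof.
rewrite !finset.inE => ws sX tX st; apply: connect_trans ws (connect1 _).
by rewrite /= sX tX.
Qed.

Lemma mem_component X w : w \in component X w.
Proof. by rewrite finset.inE connect0. Qed.

Lemma component_connected X w : w \in X -> connected_on M (component X w).
Proof.
move=> wX; have /fintype.subsetP KX := component_sub wX.
set K := component X w in KX *; set e := [rel a b | [&& a \in K, b \in K & adjacent M a b]].
split; first by apply/finset.set0Pn; exists w; apply: mem_component.
have eC : connect_sym e.
  by apply: sym_connect_sym => a b; rewrite /= andbCA adjacent_sym.
have wt t : t \in K -> connect e w t.
  rewrite finset.inE => /connectP[p pp ->] {t}.
  suff gen s : s \in K -> connect e w s ->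
      path [rel a b | [&& a \in X, b \in X & adjacent M a b]] s p -> connect e w (last s p).
    exact: gen (mem_component X w) (connect0 _ _) pp.
  elim: p s {pp} => //= r p IH s sK ws /andP[/and3P[sX rX sr]].
  have rK : r \in K by apply: component_adj sr.
  by apply: IH => //; apply: connect_trans ws (connect1 _); rewrite /= sK rK.
by move=> s t sK tK; rewrite (connect_trans _ (wt t tK)) // eC wt.
Qed.

Lemma connected_sub_component X w Y t : connected_on M Y -> Y \subset X ->
  t \in Y -> t \in component X w -> Y \subset component X w.
Proof.
move=> cY /fintype.subsetP YX tY tK; apply/fintype.subsetP.
apply: (connected_ind (s := t) (Q := fun r => r \in component X w)) cY _ _ _ => //.
by move=> a b aY bY ab aK; apply: component_adj ab; rewrite ?YX.
Qed.

Lemma component_compat X w Y : w \in X -> connected_on M Y -> Y \subset X ->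
  compat (component X w) Y.
Proof.
move=> wX cY YX; have [[t tY tK]|h] := pselect (exists2 t, t \in Y & t \in component X w).
  by constructor 2; apply: connected_sub_component tK.
have /fintype.subsetP KX := component_sub wX; move/fintype.subsetP in YX.
constructor 3 => s t sK tY; split; first by apply/negP => /eqP st; case: h; exists s; rewrite ?st // -st.
apply/negP => st; case: h; exists t => //.
exact: component_adj sK (KX _ sK) (YX _ tY) st.
Qed.

(** Suppose the proper members cover [X], and let [Y] be a largest one. A neighbour [b] outside [Y]
    lies in some member [Y'], which cannot contain [Y], lie inside [Y] or be orthogonal to it. So
    [Y] is closed under adjacency and equals [X]. *)
Lemma cover_proper X F : connected_on M X -> max_nested X F ->
  exists2 v, v \in X & v \notin finset.cover (F :\ X).
Proof.
move=> cX [FX Fc _]; apply: contrapT => h.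
have XU v : v \in X -> v \in finset.cover (F :\ X).
  by move=> vX; apply/negPn/negP => vU; case: h; exists v.
have [/finset.set0Pn[w wX] _] := cX.
have /finset.bigcupP[Y0 Y0F wY0] := XU w wX.
have [Y YF Ymax] := @arg_maxnP _ Y0 (fun Y => Y \in F :\ X) (fun Y => #|Y|) Y0F.
move: (YF); rewrite finset.in_setD1 => /andP[YX YF'].
have [cY /fintype.subsetP sYX] := FX Y YF'.
have [/finset.set0Pn[y yY] _] := cY.
case/negP: YX; rewrite finset.eqEsubset; apply/andP; split; apply/fintype.subsetP => //.
apply: (connected_ind (s := y) (Q := fun r => r \in Y)) cX _ _ _ => //; first exact: sYX.
move=> a b aX bX ab aY; apply/negPn/negP => bY.
have /finset.bigcupP[Y' Y'F bY'] := XU b bX.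
have Y'F' : Y' \in F by move: Y'F; rewrite finset.in_setD1 => /andP[].
case: (Fc Y Y' YF' Y'F') => [YY'|/fintype.subsetP Y'Y|o].
- have : (#|Y| < #|Y'|)%N.
    apply: proper_card; apply/properP; split=> //; by exists b.
  by have Y'le := Ymax _ Y'F; rewrite ltnNge; move: Y'le => /= ->.
- by rewrite Y'Y in bY.
- by have [_] := o a b aY bY'; rewrite ab.
Qed.

(** Each component of [X - v] is compatible with every member, hence is a member by maximality; so
    the proper members miss only [v]. *)
Lemma max_nested_cover X F (U := finset.cover (F :\ X)) : connected_on M X -> max_nested X F ->
  (exists2 v, v \in X & U = X :\ v) /\ max_nested U (F :\ X).
Proof.
move=> cX mF; have [v vX vU] := cover_proper cX mF; have [FX Fc Fmax] := mF.
have FXv Y : Y \in F :\ X -> Y \subset X :\ v.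
  move=> YF; apply/fintype.subsetP => t tY; rewrite finset.in_setD1.
  have /FX[_ /fintype.subsetP YX] : Y \in F by move: YF; rewrite finset.in_setD1 => /andP[].
  rewrite YX // andbT; apply: contra vU => /eqP <-; apply/finset.bigcupP; by exists Y.
have UE : U = X :\ v.
  apply/eqP; rewrite finset.eqEsubset; apply/andP; split.
    by apply/finset.bigcupsP.
  apply/fintype.subsetP => w wXv; have cK := component_connected wXv.
  have KXv := component_sub wXv; set K := component _ w in cK KXv.
  have KX : K \subset X by apply: fintype.subset_trans KXv (finset.subD1set _ _).
  apply/finset.bigcupP; exists K; last exact: mem_component.
  have vK : v \notin K.
    by apply/negP => /(fintype.subsetP KXv); rewrite finset.in_setD1 eqxx.
  rewrite finset.in_setD1; apply/andP; split.
    by apply/negP => /eqP KE; rewrite KE vX in vK.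
  apply: Fmax => // Y YF; case: (eqVneq Y X) => [->|YX]; first by constructor 1.
  apply: component_compat => //; first by have [] := FX _ YF.
  by apply: FXv; rewrite finset.in_setD1 YX.
split; first by exists v.
have sub Y : Y \in F :\ X -> Y \in F by rewrite finset.in_setD1 => /andP[].
split=> [Y YF|Y Z /sub YF /sub ZF|Q cQ QU Qc]; last 2 first.
- exact: Fc.
- have QX : Q \subset X by move: QU; rewrite UE => /fintype.subset_trans; apply; apply: finset.subD1set.
  rewrite finset.in_setD1; apply/andP; split.
    apply/negP => /eqP QE; move: QU; rewrite QE UE => /fintype.subsetP/(_ v vX).
    by rewrite finset.in_setD1 eqxx.
  apply: Fmax => // Y YF; case: (eqVneq Y X) => [->|YX]; first by constructor 1.
  by apply: Qc; rewrite finset.in_setD1 YX.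
- by split; [have [] := FX _ (sub _ YF) | apply/finset.bigcup_sup].
Qed.

Section Transport.
Variables (X : {set V}) (f : V -> V).
Hypothesis fX : forall s, s \in X -> f s \in X.
Hypothesis fK : forall s, s \in X -> f (f s) = s.
Hypothesis f_adj : forall s t, s \in X -> t \in X -> adjacent M (f s) (f t) = adjacent M s t.

Lemma imset_sub Y : Y \subset X -> f @: Y \subset X.
Proof.
move=> /fintype.subsetP YX; apply/fintype.subsetP => _ /imsetP[s /YX sX ->]; exact: fX.
Qed.

Lemma imsetK Y : Y \subset X -> f @: (f @: Y) = Y.
Proof.
move=> /fintype.subsetP YX; apply/setP => t; apply/imsetP/idP => [[_ /imsetP[s sY ->] ->]|tY].
  by rewrite fK ?YX.
by exists (f t); [apply: imset_f | rewrite fK ?YX].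
Qed.

Lemma imset_connected Y : Y \subset X -> connected_on M Y -> connected_on M (f @: Y).
Proof.
move=> YX cY; have /fintype.subsetP YX' := YX; have [/finset.set0Pn[w wY] _] := cY.
split; first by apply/finset.set0Pn; exists (f w); apply: imset_f.
move=> _ _ /imsetP[s sY ->] /imsetP[t tY ->].
apply: (connected_ind (s := s) (Q := fun r => connect _ (f s) (f r))) cY sY _ _ t tY => //.
move=> a b aY bY ab h; apply: connect_trans h (connect1 _).
by rewrite /= !imset_f //= f_adj ?YX'.
Qed.

Lemma imset_compat Y Z : Y \subset X -> Z \subset X -> compat Y Z -> compat (f @: Y) (f @: Z).
Proof.
move=> /fintype.subsetP YX /fintype.subsetP ZX.
case=> [h|h|h]; [by constructor 1; apply: imsetS|by constructor 2; apply: imsetS|].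
constructor 3 => _ _ /imsetP[s sY ->] /imsetP[t tZ ->].
have [st nst] := h s t sY tZ; rewrite (f_adj (YX _ sY) (ZX _ tZ)); split=> //.
apply: contra st => /eqP/(congr1 f); rewrite (fK (YX _ sY)) (fK (ZX _ tZ)) => ->.
exact: eqxx.
Qed.

Lemma imset_max_nested F : max_nested X F -> max_nested X [set f @: Y | Y : {set V} in F].
Proof.
move=> [FX Fc Fmax]; split=> [_ /imsetP[Y /FX[cY YX] ->]|_ _ /imsetP[Y YF ->] /imsetP[Z ZF ->]|Q cQ QX Qc].
- by split; [apply: imset_connected | apply: imset_sub].
- have [[_ YX] [_ ZX]] := (FX Y YF, FX Z ZF); apply: imset_compat => //; exact: Fc.
- apply/imsetP; exists (f @: Q); last by rewrite imsetK.
  apply: Fmax => [||Y YF]; [exact: imset_connected|exact: imset_sub|].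
  have [_ YX] := FX Y YF; rewrite -(imsetK YX); apply: imset_compat => //; first exact: imset_sub.
  by apply: Qc; apply/imsetP; exists Y.
Qed.

End Transport.

Lemma max_nested_split X K L F : X = K :|: L ->
  (forall s t, s \in K -> t \in L -> s != t /\ ~~ adjacent M s t) ->
  max_nested X F -> max_nested K [set Y in F | Y \subset K] /\
  forall Y, Y \in F -> Y \subset K \/ Y \subset L.
Proof.
move=> XE KL [FX Fc Fmax].
have KX : K \subset X by rewrite XE finset.subsetUl.
have dich Y : Y \in F -> Y \subset K \/ Y \subset L.
  move=> /FX[cY /fintype.subsetP YX].
  have inKL t : t \in Y -> (t \in K) || (t \in L) by move=> /YX; rewrite XE finset.in_setU.
  have [[t tY tK]|h] := pselect (exists2 t, t \in Y & t \in K).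
    left; apply/fintype.subsetP.
    apply: (connected_ind (s := t) (Q := fun r => r \in K)) cY _ _ _ => //.
    move=> a b aY bY ab aK; have /orP[//|bL] := inKL b bY.
    by have [_] := KL a b aK bL; rewrite ab.
  right; apply/fintype.subsetP => t tY; have /orP[tK|//] := inKL t tY.
  by case: h; exists t.
split=> //; split=> [Y|Y Z|Q cQ QK Qc].
- by rewrite finset.inE => /andP[/FX[cY _] YK].
- by rewrite !finset.inE => /andP[YF _] /andP[ZF _]; apply: Fc.
- rewrite finset.inE QK andbT; apply: Fmax => // [|Y YF].
    exact: fintype.subset_trans QK KX.
  have [YK|/fintype.subsetP YL] := dich Y YF.
    by apply: Qc; rewrite finset.inE YF.
  constructor 3 => s t sQ tY; apply: KL; [exact: (fintype.subsetP QK)|exact: YL].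
Qed.

Lemma not_connected_split X : X != finset.set0 -> ~ connected_on M X ->
  exists K L, [/\ X = K :|: L, (#|K| < #|X|)%N, (#|L| < #|X|)%N &
    forall s t, s \in K -> t \in L -> s != t /\ ~~ adjacent M s t].
Proof.
move=> /finset.set0Pn[w wX] ncX; have KX := component_sub wX.
set K := component X w in KX; exists K, (X :\: K).
have wK : w \in K := mem_component X w.
have nXK : ~~ (X \subset K).
  apply/negP => XK; apply: ncX.
  suff -> : X = K by apply: component_connected.
  by apply/eqP; rewrite finset.eqEsubset XK.
split.
- by rewrite -{1}(finset.setIidPr KX) finset.setID.
- by apply: proper_card; rewrite fintype.properE KX.
- by apply: proper_card; rewrite fintype.properE finset.subsetDl /=; apply/fintype.subsetPn; exists w; rewrite // finset.in_setD wK.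
- move=> s t sK; rewrite finset.in_setD => /andP[tK tX]; split.
    by apply: contra tK => /eqP <-.
  by apply: contra tK => st; apply: component_adj st => //; apply: (fintype.subsetP KX).
Qed.

End Families.

(** * Conjugators between maximal nested families *)

Section Recursion.
Variables (V : finType) (M : coxeter_matrix V).
Hypothesis Mfin : finite_type M.
Variable G : artin_system M.
Local Open Scope group_scope.
Local Notation gen := (gen G).
Local Notation D := (@garside V M G).
Local Notation par := (@par V M G).
Local Notation conj_par := (@conj_par V M G).
Local Notation max_nested := (max_nested M).
Implicit Types (s t u v w : V) (X Y Z K L Q : {set V}) (F E : {set {set V}}) (a b c : G).

Lemma conj_parV a Y Z : conj_par a Y Z -> conj_par a^-1 Z Y.
Proof. by move=> [h1 h2]; split=> x; rewrite ?invgK; [apply: h2|apply: h1]. Qed.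

Lemma conj_parM a b X Y Z : conj_par a X Y -> conj_par b Y Z -> conj_par (b * a) X Z.
Proof.
move=> [h1 h2] [h3 h4]; split=> x hx.
  by have := h3 _ (h1 _ hx); rewrite invgM !mulgA.
by have := h2 _ (h4 _ hx); rewrite invgM !mulgA.
Qed.

Lemma conj_par_in X a : par X a -> conj_par a X X.
Proof.
move=> Xa; split=> x Xx; first exact: parM (parM Xa Xx) (parV Xa).
exact: parM (parM (parV Xa) Xx) Xa.
Qed.

Lemma conj_par1_eq Y Z : conj_par 1 Y Z -> Y = Z.
Proof.
move=> [h1 h2]; apply/eqP; rewrite finset.eqEsubset; apply/andP; split; apply: (par_sub Mfin (G := G)) => x hx.
  by have := h1 _ hx; rewrite invg1 mulg1 mul1g.
by have := h2 _ hx; rewrite invg1 mulg1 mul1g.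
Qed.

Lemma conj_par_fun a Y Z Z' : conj_par a Y Z -> conj_par a Y Z' -> Z = Z'.
Proof.
move=> h h'; apply: conj_par1_eq; rewrite -(mulgV a).
exact: conj_parM (conj_parV h) h'.
Qed.

Lemma conj_par_inj a Y Y' Z : conj_par a Y Z -> conj_par a Y' Z -> Y = Y'.
Proof.
move=> h h'; apply: conj_par1_eq; rewrite -(mulVg a).
exact: conj_parM h (conj_parV h').
Qed.

Lemma conj_par_sub a X Y Z : par X a -> Y \subset X -> conj_par a Y Z -> Z \subset X.
Proof.
move=> Xa YX [_ h2]; apply: (par_sub Mfin (G := G)) => x hx.
have := parM (parM Xa (parS YX (h2 _ hx))) (parV Xa).
by rewrite !mulgA mulgV mul1g mulgK.
Qed.

Definition conj_fam a E F := (forall Y, Y \in E -> exists2 Z, Z \in F & conj_par a Y Z) /\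
  (forall Z, Z \in F -> exists2 Y, Y \in E & conj_par a Y Z).

Lemma conj_fam_cover a E F : conj_fam a E F ->
  conj_par a (finset.cover E) (finset.cover F).
Proof.
move=> [h1 h2]; split.
  pose H := [set x | par (finset.cover F) (a * x * a^-1)]%classic.
  apply: (par_min (H := H)); first exact/conj_subgroup/par_subgroup.
  move=> s /finset.bigcupP[Y YE sY]; have [Z ZF [h _]] := h1 Y YE.
  exact: parS (finset.bigcup_sup Z ZF) _ (h _ (par_gen sY)).
pose H := [set x | par (finset.cover E) (a^-1 * x * a^-1^-1)]%classic.
suff hH x : par (finset.cover F) x -> H x by move=> x /hH; rewrite /H /= invgK.
move: x; apply: par_min; first exact/conj_subgroup/par_subgroup.
move=> s /finset.bigcupP[Z ZF sZ]; have [Y YE [_ h]] := h2 Z ZF.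
rewrite /H /= invgK.
exact: parS (finset.bigcup_sup Y YE) _ (h _ (par_gen sZ)).
Qed.

Lemma conj_fam_setD1 X a E F : par X a -> conj_fam a E F -> conj_fam a (E :\ X) (F :\ X).
Proof.
move=> Xa [h1 h2]; have aX := conj_par_in Xa.
split=> Y; rewrite finset.in_setD1 => /andP[YX].
  move=> /h1[Z ZF h]; exists Z => //; rewrite finset.in_setD1 ZF andbT.
  by apply: contra YX => /eqP ZX; rewrite ZX in h; rewrite (conj_par_inj h aX).
move=> /h2[Z ZF h]; exists Z => //; rewrite finset.in_setD1 ZF andbT.
by apply: contra YX => /eqP ZX; rewrite ZX in h; rewrite (conj_par_fun h aX).
Qed.

Lemma zexpg_conj X n (c := zexpg (D X) n) : exists f : V -> V, forall s, s \in X ->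
  [/\ f s \in X, f (f s) = s & c * gen s = gen (f s) * c].
Proof.
suff main k : exists f : V -> V, forall s, s \in X ->
    [/\ f s \in X, f (f s) = s & D X ^+ k * gen s = gen (f s) * D X ^+ k].
  rewrite /c; case: n {c} => k /=; first exact: main.
  have [f fP] := main k.+1; exists f => s sX; have [h1 h2 h3] := fP s sX.
  split=> //; apply: (@mulgI _ (D X ^+ k.+1)); rewrite mulVKg !mulgA.
  by have [_ _ ->] := fP _ h1; rewrite h2 mulgK.
elim: k => [|k [f fP]]; first by exists id => s sX; rewrite mul1g mulg1.
(* The exponent is [k.+1], so an even [k] means an odd power, which acts on letters as [tau]. *)
exists (if odd k then id else tau G X) => s sX.
have [g [gX gD]] : exists g : V -> V, (forall t, t \in X -> g t = if odd k then tau G X t else t) /\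
    forall t, t \in X -> D X ^+ k * gen t = gen (g t) * D X ^+ k.
  elim: (k) => [|j [g [gX gD]]]; first by exists id; split=> // t tX; rewrite mul1g mulg1.
  exists (fun t => if odd j then t else tau G X t); split=> t tX /=; first by case: (odd j).
  rewrite expgS -mulgA gD // gX //; case: (odd j); last by rewrite mulgA garside_genM // mulgA.
  by rewrite mulgA garside_genM ?tau_in // tauK // mulgA.
have e : D X ^+ k.+1 * gen s = gen ((if odd k then id else tau G X) s) * D X ^+ k.+1.
  rewrite expgS -mulgA gD // gX //; case: (odd k); last by rewrite mulgA garside_genM // mulgA.
  by rewrite mulgA garside_genM ?tau_in // tauK // mulgA.
by split=> //; case: (odd k); rewrite ?tau_in ?tauK.
Qed.

Lemma conj_gens_par c Y f : (forall s, s \in Y -> c * gen s = gen (f s) * c) ->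
  conj_par c Y (f @: Y).
Proof.
move=> h; split.
  pose H := [set x | par (f @: Y) (c * x * c^-1)]%classic.
  apply: (par_min (H := H)); first exact/conj_subgroup/par_subgroup.
  by move=> s sY; rewrite /H /= h // mulgK; apply: par_gen; apply: imset_f.
pose H := [set x | par Y (c^-1 * x * c^-1^-1)]%classic.
suff hH x : par (f @: Y) x -> H x by move=> x /hH; rewrite /H /= invgK.
move: x; apply: par_min; first exact/conj_subgroup/par_subgroup.
move=> _ /imsetP[s sY ->]; rewrite /H /= invgK -mulgA -h // mulKg.
exact: par_gen.
Qed.

(** Once the power of [D X] is removed from [a], the remaining [b] links to [F] not [E] but its
    image [E1] under the graph automorphism induced by that power; [E'] is [E1] without [X]. *)
Lemma connected_step X E F a : connected_on M X -> max_nested X E -> max_nested X F ->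
  par X a -> conj_fam a E F -> exists v E' b n,
  [/\ v \in X, par (X :\ v) b, a = b * zexpg (D X) n,
      max_nested (X :\ v) (F :\ X) & max_nested (X :\ v) E' /\ conj_fam b E' (F :\ X)].
Proof.
move=> cX mE mF Xa aEF.
have [[v vX UF] mF'] := max_nested_cover cX mF.
have [[v' v'X UE] _] := max_nested_cover cX mE.
have aEF' := conj_fam_setD1 Xa aEF.
have := conj_fam_cover aEF'; rewrite UF => aU.
have UEX : finset.cover (E :\ X) \subset X by rewrite UE finset.subD1set.
have [b [n [Zb ab]]] := normalizer_setD1 Mfin vX Xa UEX aU.
have [f fP] := zexpg_conj X n; set c := zexpg (D X) n in ab fP.
have bE : b = a * c^-1 by rewrite ab mulgK.
have fX s : s \in X -> f s \in X by move=> /fP[].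
have fK s : s \in X -> f (f s) = s by move=> /fP[].
have fc s : s \in X -> c * gen s = gen (f s) * c by move=> /fP[].
(* Adjacency is read off from the group as failure to commute, so that conjugation by [c] preserves
   it. *)
have adj_comm s t : s \in X -> t \in X ->
    gen (f s) * gen (f t) = gen (f t) * gen (f s) -> gen s * gen t = gen t * gen s.
  move=> sX tX e; apply: (@mulgI _ c).
  by rewrite !mulgA !fc // -!mulgA !fc // !mulgA e.
have fadj s t : s \in X -> t \in X -> adjacent M (f s) (f t) = adjacent M s t.
  have one r r' : r \in X -> r' \in X -> adjacent M r r' -> adjacent M (f r) (f r').
    move=> rX r'X rr'; apply/negPn/negP => /(nonadjacent_comm G)/(adj_comm _ _ rX r'X).
    by move=> /(comm_gen_adjacent Mfin); rewrite rr'.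
  move=> sX tX; apply/idP/idP; last exact: one.
  by move=> /(one _ _ (fX _ sX) (fX _ tX)); rewrite !fK.
have EX Y : Y \in E -> Y \subset X by have [h _ _] := mE; move=> /h[].
pose E1 := [set f @: Y | Y : {set V} in E].
have mE1 : max_nested X E1 := imset_max_nested fX fK fadj mE.
have cconj Y : Y \subset X -> conj_par c Y (f @: Y).
  by move=> /fintype.subsetP YX; apply: conj_gens_par => s /YX/fc.
have bE1F : conj_fam b E1 F.
  have [h1 h2] := aEF; split=> [_ /imsetP[Y YE ->]|Z /h2[Y YE h]].
    have [Z ZF h] := h1 Y YE; exists Z => //; rewrite bE.
    exact: conj_parM (conj_parV (cconj _ (EX _ YE))) h.
  exists (f @: Y); first by apply/imsetP; exists Y.
  by rewrite bE; apply: conj_parM (conj_parV (cconj _ (EX _ YE))) h.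
have ZX : X :\ v \subset X := finset.subD1set X v.
have bE1F' := conj_fam_setD1 (parS ZX Zb) bE1F.
have [_ mE1'] := max_nested_cover cX mE1.
(* [b] carries the cover of [E1] without [X] to [X - v], and it carries [X - v] to itself, so both
   families omit the same vertex. *)
have U1 : finset.cover (E1 :\ X) = X :\ v.
  have := conj_fam_cover bE1F'; rewrite UF => h.
  exact: conj_par_inj h (conj_par_in Zb).
rewrite U1 in mE1'; rewrite UF in mF'.
by exists v, (E1 :\ X), b, n.
Qed.

Definition ascending F a := exists (r : seq {set V}) (n : {set V} -> int),
  [/\ uniq r, r =i F,
      {in r &, forall X Y, X \subset Y -> (index X r <= index Y r)%N} &
      a = \prod_(X <- r) zexpg (D X) (n X)].

Lemma ascending_rcons X F a n (F' := F :\ X) : X \in F -> (forall Y, Y \in F -> Y \subset X) ->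
  ascending F' a -> ascending F (a * zexpg (D X) n).
Proof.
move=> XF FX [r [m [ru rF rord ->]]].
have Xr : X \notin r by rewrite rF finset.in_setD1 eqxx.
exists (rcons r X), (fun Y => if Y == X then n else m Y); split.
- by rewrite rcons_uniq Xr.
- move=> Y; rewrite mem_rcons inE rF finset.in_setD1.
  by case: eqP => [->|].
- have ind Y : Y \in r -> index Y (rcons r X) = index Y r.
    by move=> Yr; rewrite -cats1 index_cat Yr.
  have indX : index X (rcons r X) = size r.
    by rewrite -cats1 index_cat (negbTE Xr) /= eqxx addn0.
  move=> Y Z; rewrite !mem_rcons !inE => /orP[/eqP ->|Yr] /orP[/eqP ->|Zr] YZ //.
  + have ZX : Z = X.
      apply/eqP; rewrite finset.eqEsubset YZ andbT; apply: FX.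
      by move: Zr; rewrite rF finset.in_setD1 => /andP[].
    by rewrite -ZX Zr in Xr.
  + by rewrite ind // indX ltnW // index_mem.
  + by rewrite !ind //; apply: rord.
- rewrite -cats1 big_cat big_seq1 eqxx; congr (_ * _).
  apply: eq_big_seq => Y Yr; case: eqP => // YX.
  by move: Xr; rewrite -YX Yr.
Qed.

(** A nonempty member below [K] is never contained in one below [L], nor conversely, so the two
    enumerations may be concatenated. *)
Lemma ascending_cat K L F a b : (forall Y, Y \in F -> Y != finset.set0) ->
  (forall Y, Y \in F -> Y \subset K \/ Y \subset L) -> K :&: L = finset.set0 ->
  ascending [set Y in F | Y \subset K] a -> ascending [set Y in F | Y \subset L] b ->
  ascending F (a * b).
Proof.
move=> F0 FKL KL0 [r [m [ru rF rord ->]]] [r' [m' [ru' rF' rord' ->]]].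
have disj Y : Y \in F -> Y \subset K -> Y \subset L -> False.
  move=> YF YK YL; have := F0 Y YF; rewrite -finset.subset0 -KL0 finset.subsetI.
  by rewrite YK YL.
have rP Y : Y \in r -> Y \in F /\ Y \subset K.
  by rewrite rF finset.inE => /andP.
have rP' Y : Y \in r' -> Y \in F /\ Y \subset L.
  by rewrite rF' finset.inE => /andP.
have rr' Y : Y \in r -> Y \in r' -> False.
  by move=> /rP[YF YK] /rP'[_ YL]; apply: disj YL.
exists (r ++ r'), (fun Y => if Y \in r then m Y else m' Y); split.
- rewrite cat_uniq ru ru' andbT /=; apply/hasPn => Y Yr'.
  by apply/negP => Yr; apply: rr' Yr'.
- move=> Y; rewrite mem_cat rF rF' !finset.inE -andb_orr.
  case YF : (Y \in F) => //=; by case: (FKL Y YF) => ->; rewrite ?orbT.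
- move=> Y Z; rewrite !mem_cat => Yrr Zrr YZ; rewrite !index_cat.
  case: (boolP (Y \in r)) (boolP (Z \in r)) => Yr; case=> Zr.
  + exact: rord.
  + by apply: leq_trans (leq_addr _ _); rewrite ltnW // index_mem.
  + have Yr' : Y \in r' by rewrite (negbTE Yr) in Yrr.
    have [YF YL] := rP' Y Yr'; have [_ ZK] := rP Z Zr.
    by case: (disj Y YF (fintype.subset_trans YZ ZK) YL).
  + rewrite (negbTE Yr) in Yrr; rewrite (negbTE Zr) in Zrr.
    by rewrite leq_add2l; apply: rord'.
- rewrite big_cat; congr (_ * _); apply: eq_big_seq => Y Yr; first by rewrite Yr.
  by case: ifP => // Yr2; case: (rr' Y Yr2 Yr).
Qed.

Lemma par_set0 a : par finset.set0 a -> a = 1.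
Proof.
move: a; apply: (par_min (H := [set x | x = 1]%classic)) => [|s]; last by rewrite finset.inE.
by split=> [//|x y -> ->|x ->] /=; rewrite ?mul1g ?invg1.
Qed.

Lemma par_comm K L a b : (forall s t, s \in K -> t \in L -> s != t /\ ~~ adjacent M s t) ->
  par K a -> par L b -> commute a b.
Proof.
move=> KL Ka Lb; have gL s : s \in K -> forall c, par L c -> commute (gen s) c.
  move=> sK; apply: par_min; first exact: centralizer_subgroup.
  by move=> t tL; have [_ h] := KL s t sK tL; apply: nonadjacent_comm.
apply: commute_sym; move: a Ka; apply: par_min; first exact: centralizer_subgroup.
by move=> s sK; apply: commute_sym; apply: gL.
Qed.

Lemma par_split K L a : (forall s t, s \in K -> t \in L -> s != t /\ ~~ adjacent M s t) ->
  par (K :|: L) a -> exists b c, [/\ par K b, par L c & a = b * c].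
Proof.
move=> KL; pose H := [set a : G | exists b c, [/\ par K b, par L c & a = b * c]]%classic.
move: a; apply: (par_min (H := H)); rewrite /H /=.
  split=> /= [|x y [b [c [Kb Lc ->]]] [b' [c' [Kb' Lc' ->]]]|x [b [c [Kb Lc ->]]]].
  - by exists 1, 1; split; [exact: par1|exact: par1|rewrite mulg1].
  - exists (b * b'), (c * c'); split; [exact: parM Kb Kb'|exact: parM Lc Lc'|].
    have h : b' * c = c * b' := par_comm KL Kb' Lc.
    by rewrite -!mulgA; congr (_ * _); rewrite !mulgA h.
  - exists b^-1, c^-1; split; [exact: parV Kb|exact: parV Lc|].
    by rewrite invgM; apply: esym; apply: par_comm KL (parV Kb) (parV Lc).
move=> s; rewrite finset.in_setU => /orP[sK|sL].
  by exists (gen s), 1; split; [exact: par_gen|exact: par1|rewrite mulg1].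
by exists 1, (gen s); split; [exact: par1|exact: par_gen|rewrite mul1g].
Qed.

Lemma conj_par_factor K L Y Z b c :
  (forall s t, s \in K -> t \in L -> s != t /\ ~~ adjacent M s t) ->
  par L c -> Y \subset K -> conj_par (b * c) Y Z -> conj_par b Y Z.
Proof.
move=> KL Lc YK h.
suff hc : conj_par c Y Y by have := conj_parM (conj_parV hc) h; rewrite mulgK.
have cc x : par Y x -> x * c = c * x.
  by move=> Yx; apply: par_comm KL (parS YK Yx) Lc.
split=> x Yx; first by rewrite -cc // mulgK.
by rewrite -mulgA cc // mulKg.
Qed.

(** A member [Y] below [L] cannot be carried to a [Z] below [K]: [b] centralizes A_Y, so [c] alone
    would carry [Y] to a subset of both [K] and [L], which is empty, and a generator would be
    conjugate to 1. *)
Lemma conj_fam_split K L E F b c :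
  (forall s t, s \in K -> t \in L -> s != t /\ ~~ adjacent M s t) ->
  (forall Y, Y \in E -> Y != finset.set0) ->
  (forall Y, Y \in E -> Y \subset K \/ Y \subset L) ->
  par K b -> par L c -> conj_fam (b * c) E F ->
  conj_fam b [set Y in E | Y \subset K] [set Y in F | Y \subset K].
Proof.
move=> KL E0 EKL Kb Lc [h1 h2].
have LK s t : s \in L -> t \in K -> s != t /\ ~~ adjacent M s t.
  by move=> sL tK; have [] := KL t s tK sL; rewrite eq_sym adjacent_sym.
have bc : b * c = c * b := par_comm KL Kb Lc.
have KL0 s : s \in K -> s \in L -> False.
  by move=> sK sL; have [] := KL s s sK sL; rewrite eqxx.
split=> [Y|Z]; rewrite finset.inE => /andP[].
  move=> YE YK; have [Z ZF h] := h1 Y YE.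
  have hb := conj_par_factor KL Lc YK h.
  by exists Z => //; rewrite finset.inE ZF; apply: conj_par_sub Kb YK hb.
move=> ZF ZK; have [Y YE h] := h2 Z ZF.
have [YK|YL] := EKL Y YE.
  by exists Y; [rewrite finset.inE YE | apply: conj_par_factor KL Lc YK h].
rewrite bc in h; have hc := conj_par_factor LK Kb YL h.
have ZL := conj_par_sub Lc YL hc.
have Z0 : Z = finset.set0.
  apply/eqP; rewrite -finset.subset0; apply/fintype.subsetP => s sZ.
  by case: (KL0 s); [apply: (fintype.subsetP ZK)|apply: (fintype.subsetP ZL)].
have /finset.set0Pn[s sY] := E0 Y YE.
have Yx := par_gen (G := G) sY; have [hc1 _] := hc.
have := hc1 _ Yx; rewrite Z0 => /par_set0/(congr1 (fun x => c^-1 * x * c)).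
rewrite !mulgA mulVg mul1g mulgVK mulg1 mulVg => e.
have := deg_gen G s; by rewrite e deg1.
Qed.

Theorem stabilizer_ascending X E F a : max_nested X E -> max_nested X F ->
  par X a -> conj_fam a E F -> ascending F a.
Proof.
have [n] := ubnP #|X|; elim: n X E F a => // n IH X E F a Xn mE mF Xa aEF.
have [cX|ncX] := pselect (connected_on M X).
  have [v [E' [b [k [vX Zb ab mF' [mE' bEF]]]]]] := connected_step cX mE mF Xa aEF.
  rewrite ab; apply: ascending_rcons.
  - exact: max_nested_top mF.
  - by have [h _ _] := mF; move=> Y /h[].
  - apply: IH mE' mF' Zb bEF.
    by move: Xn; rewrite (cardsD1 v X) vX.
have nonempty E1 : max_nested X E1 -> forall Y, Y \in E1 -> Y != finset.set0.
  by move=> [h _ _] Y /h[[]].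
case: (eqVneq X finset.set0) => [X0|X0].
  have F0 Y : (Y \in F) = false.
    apply/negP => YF; have /finset.set0Pn[s sY] := nonempty F mF Y YF.
    have [h _ _] := mF; have [_ /fintype.subsetP/(_ s sY)] := h Y YF.
    by rewrite X0 finset.inE.
  exists [::], (fun=> 0%R); split=> //.
  by rewrite big_nil; apply: par_set0; rewrite -X0.
have [K [L [XE Kn Ln KL]]] := not_connected_split X0 ncX.
have LK s t : s \in L -> t \in K -> s != t /\ ~~ adjacent M s t.
  by move=> sL tK; have [] := KL t s tK sL; rewrite eq_sym adjacent_sym.
have XE' : X = L :|: K by rewrite finset.setUC.
have [mEK dE] := max_nested_split XE KL mE; have [mFK dF] := max_nested_split XE KL mF.
have [mEL dE'] := max_nested_split XE' LK mE; have [mFL _] := max_nested_split XE' LK mF.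
have [b [c [Kb Lc abc]]] : exists b c, [/\ par K b, par L c & a = b * c].
  by apply: par_split KL _; rewrite -XE.
have bc : b * c = c * b := par_comm KL Kb Lc.
have bEF : conj_fam b [set Y in E | Y \subset K] [set Y in F | Y \subset K].
  by apply: conj_fam_split KL (nonempty E mE) dE Kb Lc _; rewrite -abc.
have cEF : conj_fam c [set Y in E | Y \subset L] [set Y in F | Y \subset L].
  by apply: conj_fam_split LK (nonempty E mE) dE' Lc Kb _; rewrite -bc -abc.
rewrite abc; apply: (ascending_cat (K := K) (L := L)) => //.
- exact: nonempty.
- apply/eqP; rewrite -finset.subset0; apply/fintype.subsetP => s.
  by rewrite finset.in_setI => /andP[sK sL]; have [] := KL s s sK sL; rewrite eqxx.
- by apply: IH mEK mFK Kb bEF; apply: leq_trans Kn _.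
- by apply: IH mEL mFL Lc cEF; apply: leq_trans Ln _.
Qed.

End Recursion.

Section CommuteConj.
Variable G : groupType.
Local Open Scope group_scope.

Lemma commute_conj (g x y : G) : commute x y -> commute (g * x * g^-1) (g * y * g^-1).
Proof.
have E (x' y' : G) : g * x' * g^-1 * (g * y' * g^-1) = g * (x' * y') * g^-1.
  by rewrite !mulgA mulgVK.
by rewrite /commute !E => ->.
Qed.

Lemma mulgVgK (g y : G) : g * (g^-1 * y * g) * g^-1 = y.
Proof. by rewrite !mulgA mulgV mul1g mulgK. Qed.

End CommuteConj.

(** * Conjugates of parabolics in the whole group *)

Section Conjugates.
Variables (V : finType) (M : coxeter_matrix V).
Hypothesis Mfin : finite_type M.
Variable G : artin_system M.
Hypothesis span : forall a : G, par (finset.setTfor V) a.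
Local Open Scope group_scope.
Local Notation gen := (gen G).
Local Notation pmon := (@pmon V M G).
Local Notation P := (pmon (finset.setTfor V)).
Local Notation D := (@garside V M G).
Local Notation par := (@par V M G).
Local Notation centre := (@centre V M G).
Local Notation conj_par := (@conj_par V M G).
Implicit Types (s t : V) (X Y Z : {set V}) (a b c g : G).

Lemma positive_multiple g : exists2 m, P (centre (finset.setTfor V) ^+ m * g) &
  forall x, commute (centre (finset.setTfor V) ^+ m) x.
Proof.
have [m Pm] := par_posE Mfin (span g); exists m => // x.
exact: (centre_par Mfin m (span x)).
Qed.

Lemma conj_par_positive g Y X : conj_par g Y X ->
  exists c, [/\ P c, head_free X c & conj_par c Y X].
Proof.
move=> h; have [m Pm zc] := positive_multiple g.
set z := _ ^+ m in Pm zc.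
have zX : conj_par z X X.
  by split=> x hx; [rewrite zc mulgK | rewrite -mulgA -zc mulKg].
have [b [c [Xb Pc hc e]]] := head_exists X Pm.
exists c; split=> //; rewrite -[c](mulKg b) -e.
exact: conj_parM (conj_parM h zX) (conj_parV (conj_par_in (par_pmon Xb))).
Qed.

(** A vertex of the complex is only given as a conjugate of some A_Y with [Y] connected. A positive
    head-free conjugator matches the letters of [Y] with those of [X] and preserves commutation,
    hence edges. *)
Lemma conj_par_connected g Y X : connected_on M Y -> conj_par g Y X -> connected_on M X.
Proof.
move=> cY /conj_par_positive[c [Pc hc h]].
have fwd := conj_par_gen Mfin Pc hc (proj1 h); have bwd := conj_par_genV Mfin Pc hc h.
split.
  have [/finset.set0Pn[s sY] _] := cY; have [t tX _] := fwd s sY.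
  by apply/finset.set0Pn; exists t.
move=> t1 t2 t1X t2X; have [s1 s1Y e1] := bwd t1 t1X; have [s2 s2Y e2] := bwd t2 t2X.
have uniqt t t' s : gen t * c = c * gen s -> gen t' * c = c * gen s -> t = t'.
  by move=> <- /mulIg/gen_inj.
pose Q r := forall t, t \in X -> gen t * c = c * gen r ->
  connect [rel a b | [&& a \in X, b \in X & adjacent M a b]] t1 t.
apply: (connected_ind (s := s1) (Q := Q)) cY s1Y _ _ s2 s2Y t2 t2X e2.
  by move=> t tX e; rewrite (uniqt _ _ _ e1 e).
move=> r r' rY r'Y rr' Qr t tX e.
have [t' t'X e'] := fwd r rY.
apply: connect_trans (Qr t' t'X (esym e')) (connect1 _).
rewrite /= t'X tX /=; apply/negPn/negP => /(nonadjacent_comm G) tt'.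
have /(comm_gen_adjacent Mfin) : gen r * gen r' = gen r' * gen r.
  have e3 : c * (gen r * gen r') = gen t' * gen t * c by rewrite mulgA e' -mulgA -e mulgA.
  have e4 : c * (gen r' * gen r) = gen t * gen t' * c by rewrite mulgA -e -mulgA e' mulgA.
  by apply: (@mulgI _ c); rewrite e3 e4 tt'.
by rewrite rr'.
Qed.

(* The exponent is positive because [g * z * g^-1 * p = p * z] for a positive
   [p], a central multiple of [g]. *)
Lemma conj_centre_power g Y X z : connected_on M X -> conj_par g Y X ->
  pmon Y z -> (0 < deg z)%N -> (forall a, par Y a -> commute z a) ->
  exists k, (g * z * g^-1) ^+ 2 = centre X ^+ k.+1.
Proof.
move=> cX h Yz z0 zc; set c := g * z * g^-1.
have Xc : par X c by have [h1 _] := h; apply: h1; apply: par_pmon Yz.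
have [n cn] : exists n, c = zexpg (D X) n.
  apply: (centre_power Mfin cX Xc) => s sX.
  have [_ h2] := h; have := zc _ (h2 _ (par_gen sX)).
  by move=> /(commute_conj g); rewrite mulgVgK.
have [m Pm wc] := positive_multiple g; set w := _ ^+ m in Pm wc.
have e : c * (w * g) = w * g * z by rewrite mulgA -wc -!mulgA /c !mulgA mulgVK.
have Pz := pmonT Yz.
(* [c D_X^k = 1] would give [w g = D_X^k w g z], whose degree is too large by at least [deg z]. This
   excludes exponents that are zero or negative. *)
have neg k : c * D X ^+ k != 1.
  apply/eqP => ck; have := congr1 (@deg _ _ G) (congr1 (fun x => D X ^+ k * x) e).
  have -> : D X ^+ k * (c * (w * g)) = w * g.
    rewrite mulgA (_ : D X ^+ k * c = 1) ?mul1g //.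
    by apply: (@mulgI _ c); rewrite mulgA ck mul1g mulg1.
  have PD : P (D X ^+ k) := pmonX k (garside_P Mfin G X).
  by rewrite (degM PD (pmonM Pm Pz)) (degM Pm Pz); lia.
case: n cn => [[|k]|k] cn.
- by have := neg 0%N; rewrite cn mulg1 eqxx.
(* Squaring turns the power of [D X] into a power of [centre X], the form in which commutation is
   analysed. *)
- by exists k; rewrite cn /zexpg -expgnA mulnC expgnA.
- by have := neg k.+1; rewrite cn /= mulVg eqxx.
Qed.

End Conjugates.

(** * Translation to the Artin group and the elements z_P *)

Section Artin.
Variables (V : finType) (M : coxeter_matrix V).
Hypothesis Mfin : finite_type M.
Local Open Scope group_scope.
Implicit Types (s t : V) (X Y Z : {set V}) (F : {set {set V}}).

Lemma artin_word (u : seq V) :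
  foldr (fun s x => sigma M s * x) 1 u = pres_class (braid_rel M) (pos_word u) :> artin M.
Proof.
elim: u => //= s u ->; rewrite /sigma /pres_gen.
by rewrite -pres_class_cat.
Qed.

Lemma artin_posP (u v : seq V) :
  foldr (fun s x => sigma M s * x) 1 u = foldr (fun s x => sigma M s * x) 1 v :> artin M <->
  mon_eq M u v.
Proof.
rewrite !artin_word; split; last exact: mon_artin.
by move=> /pres_classP; apply: mon_embed.
Qed.

Definition artin_sys : artin_system M := ArtinSystem (gen := sigma M) artin_posP.
Local Notation A := artin_sys.

Lemma artin_span (a : A) : par (finset.setTfor V) a.
Proof.
have -> : a = pres_class (braid_rel M) (repr (a : artin M)) by rewrite pres_class_repr.
elim: (repr _) => [|[s b] u IH]; first exact: par1.
rewrite -[(s, b) :: u]/([:: (s, b)] ++ u) pres_class_cat.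
have hs : par (finset.setTfor V) (gen A s) by apply: par_gen; rewrite finset.inE.
apply: (parM (G := A)) IH; case: b; first exact: hs.
by rewrite pres_class_letterV; apply: (parV (G := A)); apply: hs.
Qed.

Lemma pmon_positive (a : artin M) : positive_monoid a -> pmon (G := A) (finset.setTfor V) a.
Proof.
move=> /(_ (pmon (G := A) (finset.setTfor V))); apply.
split=> [|_ [s _ <-]]; last exact: (P_gen A).
by split; [exact: (pmon1 A) | move=> x y; apply: (pmonM (G := A))].
Qed.

Lemma positive_pmon (a : artin M) : pmon (G := A) (finset.setTfor V) a -> positive_monoid a.
Proof.
move: a; apply: (pmon_ind (G := A)) => [H [[h _] _] //|s b _ _ IH H HH].
have [[_ hM] hs] := HH; apply: hM; last exact: IH.
by apply: hs; exists s.
Qed.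

Lemma Delta_garside X : Delta M X = garside A X.
Proof.
have lcm_uniq (d : A) : is_lcm X d -> d = garside A X.
  move=> [Pd ds dmin]; apply: (garside_uniq Mfin (pmon_positive Pd)).
    by move=> s sX; exact: pmon_positive (ds s sX).
  move=> e Pe h; apply: pmon_positive; apply: (dmin e (positive_pmon Pe)) => s sX.
  exact: positive_pmon (h s sX).
have h : is_lcm X (garside A X).
  split=> [|s sX|e Pe he].
  - exact: positive_pmon (garside_P Mfin A X).
  - exact: positive_pmon (garside_gen Mfin A sX).
  - apply: positive_pmon; apply: (garside_min Mfin (pmon_positive Pe)) => s sX.
    exact: pmon_positive (he s sX).
rewrite /Delta; case: (xgetP 1 [set d | is_lcm X d]%classic) => [d -> /lcm_uniq //|/(_ (garside A X))].
by [].
Qed.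

Lemma zX_power X : exists2 k, zX M X = garside A X ^+ k.+1 &
  forall a : A, par X a -> commute (zX M X : A) a.
Proof.
rewrite /zX; case: asboolP => [h|_].
  exists 0%N; first exact: Delta_garside.
  by move=> a Xa; apply: commute_sym; apply: h.
exists 1%N; first by rewrite Delta_garside.
move=> a Xa; rewrite Delta_garside.
exact: (centre_par Mfin 1 Xa).
Qed.

Lemma conj_setP g X Y : std_parabolic M X = conj_set g (std_parabolic M Y) <->
  conj_par (G := A) g Y X.
Proof.
split=> [e|[h1 h2]].
  split=> x hx; first by change (std_parabolic M X (g * x * g^-1)); rewrite e; exists x.
  have : conj_set g (std_parabolic M Y) x by rewrite -e.
  move=> [y hy <-]; rewrite !mulgA mulVg mul1g mulgVK.
  exact: hy.
apply/seteqP; split=> [x hx|_ [y hy <-]]; last exact: h1.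
exists (g^-1 * x * g); first exact: h2.
by rewrite !mulgA mulgV mul1g mulgK.
Qed.

(** The pick made by [xget] comes from unknown [g] and [Y]. Conjugating by [g] puts it in the centre
    of A_X, and its positive degree before conjugation makes the exponent positive. *)
Lemma zP_power X (z := zP (std_parabolic M X) : A) : connected_on M X ->
  [/\ par X z, forall a : A, par X a -> commute z a &
      exists k, z ^+ 2 = centre A X ^+ k.+1].
Proof.
move=> cX; rewrite /z /zP.
set S := [set z | _]%classic.
have S0 : S (zX M X).
  exists 1, X; split; last by rewrite mul1g invg1 mulg1.
  by apply/conj_setP; split=> x hx; rewrite ?invg1 ?mul1g ?mulg1 ?invg1 ?mulg1.
case: (xgetP 1 S) => [_ -> [g [Y [/conj_setP h ->]]]|/(_ _ S0)//].
have [k zk zc] := zX_power Y.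
have Yz : pmon (G := A) Y (zX M Y) by rewrite zk; apply/pmonX/garside_pmon.
have [h1 h2] := h.
split.
- exact: h1 (par_pmon Yz).
- move=> a Xa; have := commute_conj g (zc _ (h2 _ Xa)).
  by rewrite mulgVgK.
- apply: (conj_centre_power Mfin artin_span cX h Yz) => //.
  have [s sY] : exists s, s \in Y.
    have [c [Pc hc hh]] := conj_par_positive Mfin artin_span h.
    have [/finset.set0Pn[t tX] _] := cX.
    by have [s sY _] := conj_par_genV Mfin Pc hc hh tX; exists s.
  rewrite zk expgS degM; [|exact: garside_P|exact/pmonX/garside_P].
  by have := garside_deg_gt0 Mfin A sY; lia.
Qed.

End Artin.

(** * From maximal simplices to maximal nested families *)

Section Simplices.
Variables (V : finType) (M : coxeter_matrix V).
Hypotheses (Mfin : finite_type M) (Mirr : irreducible_type M).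
Local Open Scope group_scope.
Implicit Types (s t : V) (X Y Z Q : {set V}) (F : {set {set V}}).
Local Notation A := (artin_sys Mfin).
Local Notation T := (finset.setTfor V).
Local Notation simplex_of F := [set std_parabolic M X | X in [set` F]]%classic.

Lemma std_parabolic_inj X Y : std_parabolic M X = std_parabolic M Y -> X = Y.
Proof. exact: (par_inj Mfin (G := A)). Qed.

Lemma std_parabolicT : std_parabolic M T = [set: artin M]%classic.
Proof. by apply/seteqP; split=> a _ //; exact: (@artin_span _ _ Mfin a). Qed.

Lemma std_vertex X : connected_on M X -> X <> T -> Cparab_vertex (std_parabolic M X).
Proof.
move=> cX XT; split; last by rewrite -std_parabolicT => /std_parabolic_inj.
exists 1, X; split=> //; apply/(conj_setP Mfin).
exact: (@conj_par_in _ _ A X 1 (@par1 _ _ A X)).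
Qed.

Lemma std_vertex_connected X : Cparab_vertex (std_parabolic M X) -> connected_on M X.
Proof.
move=> [[g [Y [cY /(conj_setP Mfin) h]]] _].
exact: (conj_par_connected Mfin (@artin_span _ _ Mfin) cY h).
Qed.

Lemma zP_compat X Y : connected_on M X -> connected_on M Y -> compat M X Y ->
  commute (zP (std_parabolic M X)) (zP (std_parabolic M Y)).
Proof.
move=> cX cY; have [Xz zX _] := zP_power Mfin cX; have [Yz zY _] := zP_power Mfin cY.
case=> [XY|YX|o].
- apply: commute_sym; exact: zY _ (parS XY Xz).
- exact: zX _ (parS YX Yz).
- exact: par_comm o Xz Yz.
Qed.

Lemma zP_commute_compat X Y : connected_on M X -> connected_on M Y ->
  commute (zP (std_parabolic M X)) (zP (std_parabolic M Y)) -> compat M X Y.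
Proof.
move=> cX cY h; have [_ _ [k zX]] := zP_power Mfin cX; have [_ _ [l zY]] := zP_power Mfin cY.
apply: (garside_commute_nested (G := A) Mfin cX cY (k := k) (l := l)).
rewrite -zX -zY; exact: commuteX2 h.
Qed.

(** The full vertex set is not a vertex of the complex, its parabolic not being proper, but it is
    compatible with everything; adding it gives the family a top and accounts for Delta_Gamma. *)
Lemma simplex_max_nested F : Cparab_maximal_simplex (simplex_of F) ->
  max_nested M T (T |: F) /\ T \notin F.
Proof.
move=> [[Sfin Svert Scomm] Smax].
have vert X : X \in F -> Cparab_vertex (std_parabolic M X) by move=> XF; apply: Svert; exists X.
have cF X : X \in F -> connected_on M X by move=> /vert/std_vertex_connected.
have TF : T \notin F.
  by apply/negP => /vert[_]; rewrite std_parabolicT; apply.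
have cFT X : X \in T |: F -> connected_on M X.
  by rewrite finset.in_setU1 => /orP[/eqP ->|/cF].
split=> //; split=> [Y YF|Y Z|Q cQ _ Qc].
- by split; [apply: cFT | apply: finset.subsetT].
- rewrite !finset.in_setU1 => /orP[/eqP ->|YF]; first by constructor 2; apply: finset.subsetT.
  move=> /orP[/eqP ->|ZF]; first by constructor 1; apply: finset.subsetT.
  by apply: zP_commute_compat; [exact: cF|exact: cF|apply: Scomm; [exists Y | exists Z]].
- rewrite finset.in_setU1; case: eqP => //= QT.
  (* A [Q] compatible with all members enlarges the simplex, so maximality puts it in [F]. *)
  have Qsimplex : Cparab_simplex (simplex_of F `|` [set std_parabolic M Q])%classic.
    have inFQ P : (simplex_of F `|` [set std_parabolic M Q])%classic P ->
        exists X, [/\ P = std_parabolic M X, Cparab_vertex P, connected_on M X &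
                      forall Y, Y \in F \/ Y = Q -> compat M X Y].
      case=> [[X XF <-]|->].
        exists X; split; [by []|exact: vert|exact: cF|].
        move=> Y [YF|->].
          apply: zP_commute_compat; [exact: cF|exact: cF|].
          by apply: Scomm; [exists X | exists Y].
        by apply: compat_sym; apply: Qc; rewrite finset.in_setU1 XF orbT.
      exists Q; split=> //; first exact: std_vertex.
      move=> Y [YF|->]; first by apply: Qc; rewrite finset.in_setU1 YF orbT.
      by constructor 1.
    have inF P : (simplex_of F `|` [set std_parabolic M Q])%classic P ->
        exists2 X, P = std_parabolic M X & X \in F \/ X = Q.
      by case=> [[X XF <-]|->]; [exists X => //; left | exists Q => //; right].
    split.
    + by rewrite finite_setU; split=> //; apply: finite_set1.
    + by move=> P /inFQ[X []].
    + move=> P P' /inFQ[X [-> _ cX XC]] /[dup] /inFQ[X' [-> _ cX' _]] /inF[Y /std_parabolic_inj <- YC].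
      by apply: zP_compat => //; apply: XC.
  have /seteqP[+ _] := Smax _ Qsimplex (@subsetUl _ _ _).
  move=> /(_ (std_parabolic M Q)) [|X XF /std_parabolic_inj <- //].
  by right.
Qed.

Lemma stabilizer_conj_fam F (g : artin M) :
  [set conj_set g P | P in simplex_of F]%classic = simplex_of F ->
  conj_fam (G := A) g (T |: F) (T |: F).
Proof.
move=> st; have gT : conj_par (G := A) g T T := conj_par_in (@artin_span _ _ Mfin g).
split=> Y; rewrite finset.in_setU1 => /orP[/eqP ->|YF].
- by exists T; rewrite // finset.in_setU1 eqxx.
- have : simplex_of F (conj_set g (std_parabolic M Y)).
    by rewrite -st; exists (std_parabolic M Y) => //; exists Y.
  move=> [Z ZF e]; exists Z; first by rewrite finset.in_setU1 [Z \in F]ZF orbT.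
  exact/(conj_setP Mfin).
- by exists T; rewrite // finset.in_setU1 eqxx.
- have : [set conj_set g P | P in simplex_of F]%classic (std_parabolic M Y).
    by rewrite st; exists Y.
  move=> [_ [Z ZF <-] e]; exists Z; first by rewrite finset.in_setU1 [Z \in F]ZF orbT.
  exact/(conj_setP Mfin).
Qed.

End Simplices.

Local Open Scope classical_set_scope.

(* The family of the X_i is given as the set [F] of its members. *)
Theorem theorem3 (V : finType) (M : coxeter_matrix V)
    (Mfin : finite_type M) (Mirr : irreducible_type M)
    (F : {set {set V}})
    (Fmax : Cparab_maximal_simplex [set std_parabolic M X | X in [set` F]])
    (g : artin M)
    (gstab : [set conj_set g P | P in [set std_parabolic M X | X in [set` F]]]
             = [set std_parabolic M X | X in [set` F]]) :
  ascending_product F g.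
Proof.
have [mF TF] := simplex_max_nested Mfin Mirr Fmax.
have gF := stabilizer_conj_fam Mfin gstab.
have gT := @artin_span _ _ Mfin g.
(* The top is peeled off separately, so that the power of Delta_Gamma stands apart at the right end;
   what remains is ascending over the family without its top, which is [F]. *)
have [v [E [b [n [_ Zb gb mF' [mE bEF]]]]]] := connected_step Mfin Mirr mF mF gT gF.
have [s [m [us sF sord bE]]] := stabilizer_ascending Mfin mE mF' Zb bEF.
exists s, m, n; split=> //.
  by move=> X; rewrite sF finset.in_setD1 finset.in_setU1; case: eqP => [->|] //=; rewrite (negbTE TF).
rewrite [LHS]gb bE (Delta_garside Mfin); congr (monoid.mul _ _).
by apply: eq_bigr => X _; rewrite (Delta_garside Mfin).
Qed.
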